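(* Let $K$ be a tetrahedron and $\ell\ge3$. The following degrees of freedom are unisolvent for $\mathbb P_{\ell+1}(K;\mathbb T)$: (1) $\boldsymbol\tau(\delta)$, all vertices $\delta$; (2) $(\operatorname{sym}\operatorname{curl}\boldsymbol\tau)(\delta)$, all vertices $\delta$; (3) $(\boldsymbol n_i^{\intercal}(\operatorname{sym}\operatorname{curl}\boldsymbol\tau)\boldsymbol n_j,q)_e$, $q\in\mathbb P_{\ell-2}(e)$, all edges $e$, $i,j=1,2$; (4) $(\boldsymbol n_i^{\intercal}\boldsymbol\tau\boldsymbol t,q)_e$, $q\in\mathbb P_{\ell-1}(e)$, all edges $e$, $i=1,2$; (5) $(\boldsymbol n_2^{\intercal}(\operatorname{curl}\boldsymbol\tau)\boldsymbol n_1+\partial_t(\boldsymbol t^{\intercal}\boldsymbol\tau\boldsymbol t),q)_e$, $q\in\mathbb P_\ell(e)$, all edges $e$; (6) $(\boldsymbol n\times\operatorname{sym}(\boldsymbol\tau\times\boldsymbol n)\times\boldsymbol n,\boldsymbol\varsigma)_F$, $\boldsymbol\varsigma\in(\nabla_F^\perp)^2\mathbb P_{\ell-1}(F)\oplus\operatorname{sym}(\boldsymbol x\otimes\mathbb P_{\ell-1}(F;\mathbb R^2))$, all faces $F$; (7) $(\boldsymbol n\cdot\boldsymbol\tau\times\boldsymbol n,\boldsymbol q)_F$, $\boldsymbol q\in\nabla_F\mathbb P_{\ell-3}(F)\oplus\boldsymbol x^\perp\mathbb P_{\ell-1}(F)$, all faces $F$; (8) $(\boldsymbol\tau,\boldsymbol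 q)_K$, $\boldsymbol q\in\boldsymbol B_{\ell+1}(\operatorname{sym}\operatorname{curl},K;\mathbb T)$. Their number equals $\dim\mathbb P_{\ell+1}(K;\mathbb T)=\frac43(\ell+4)(\ell+3)(\ell+2)$.
   Context: $\mathbb T$: real trace-free $3\times3$ matrices; $\mathbb P_m$ polynomials of degree $\le m$ ($\{0\}$ if $m<0$). $\operatorname{curl}$ acts row-wise on matrix fields; $\operatorname{sym}\boldsymbol A=(\boldsymbol A+\boldsymbol A^{\intercal})/2$. For vectors $\boldsymbol b$ and matrices $\boldsymbol A$: $\boldsymbol A\times\boldsymbol b$ has $i$-th row (row $i$ of $\boldsymbol A$)$\times\boldsymbol b$; $\boldsymbol b\times\boldsymbol A$ has $j$-th column $\boldsymbol b\times$(column $j$ of $\boldsymbol A$); $\boldsymbol b\cdot\boldsymbol A=\boldsymbol b^{\intercal}\boldsymbol A$. For each edge $e$: $\boldsymbol t$ is a fixed unit tangent, and $\boldsymbol n_1,\boldsymbol n_2$ are orthonormal vectors orthogonal to $e$ with $\boldsymbol n_2=\boldsymbol t\times\boldsymbol n_1$, $\boldsymbol n_1=\boldsymbol n_2\times\boldsymbol t$; $\partial_t=\boldsymbol t\cdot\nabla$. On a face $F$ with unit outward normal $\boldsymbol n$: the face is identified with a planar region via orthonormal tangential coordinates, $\boldsymbol x$ denotes the tangential (2D) position vector in $F$, $\boldsymbol x^\perp$ its rotation by $90^\circ$ in $F$, $\nabla_F$ the surface gradient, $\nabla_F^\perp=\boldsymbol n\times\nabla$, and $(\nabla_F^\perp)^2q=\nabla_F^\perp(\nabla_F^\perp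 q)^{\intercal}$. $\boldsymbol B_{\ell+1}(\operatorname{sym}\operatorname{curl},K;\mathbb T)=\{\boldsymbol\tau\in\mathbb P_{\ell+1}(K;\mathbb T):(\boldsymbol n\cdot\boldsymbol\tau\times\boldsymbol n)|_F=\boldsymbol 0,\ (\boldsymbol n\times\operatorname{sym}(\boldsymbol\tau\times\boldsymbol n)\times\boldsymbol n)|_F=\boldsymbol 0\ \forall F\}$. *)

(* Defs.v *)
From HB Require Import structures.
From mathcomp Require Import all_boot all_order all_algebra.
From mathcomp Require Import all_classical all_reals all_analysis.
Set Implicit Arguments. Unset Strict Implicit. Unset Printing Implicit Defensive.
Import Order.TTheory GRing.Theory Num.Theory.
Import numFieldNormedType.Exports.
Local Open Scope classical_set_scope.
Local Open Scope ring_scope.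

Definition dot (R : realType) n (u w : 'rV[R]_n) : R := \sum_(k < n) u 0 k * w 0 k.
Definition norm3 (R : realType) (u : 'rV[R]_3) : R := Num.sqrt (dot u u).
Definition cross (R : realType) (u w : 'rV[R]_3) : 'rV[R]_3 :=
  \row_(k < 3) (u 0 (k + 1)%R * w 0 (k + 1 + 1)%R - u 0 (k + 1 + 1)%R * w 0 (k + 1)%R).
Definition mxcrossr (R : realType) (A : 'M[R]_3) (b : 'rV[R]_3) : 'M[R]_3 :=
  \matrix_(i < 3, j < 3) cross (row i A) b 0 j.
Definition mxcrossl (R : realType) (b : 'rV[R]_3) (A : 'M[R]_3) : 'M[R]_3 :=
  \matrix_(i < 3, j < 3) cross b (col j A)^T 0 i.
Definition symm (R : realType) n (A : 'M[R]_n) : 'M[R]_n := (2%:R)^-1 *: (A + A^T).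
Definition frob (R : realType) n (A B : 'M[R]_n) : R := \sum_(i < n) \sum_(j < n) A i j * B i j.
Definition bil (R : realType) (u : 'rV[R]_3) (A : 'M[R]_3) (w : 'rV[R]_3) : R := (u *m A *m w^T) 0 0.

Definition polyfun (R : realType) n (m : nat) (f : 'rV[R]_n -> R) : Prop :=
  exists c : {ffun 'I_n -> 'I_m.+1} -> R, forall x,
    f x = \sum_(a : {ffun 'I_n -> 'I_m.+1} | (\sum_(i < n) (a i : nat) <= m)%N)
            c a * \prod_(i < n) x 0 i ^+ a i.
Definition pd (R : realType) n (i : 'I_n) (f : 'rV[R]_n -> R) (x : 'rV[R]_n) : R :=
  derive f x (delta_mx 0 i).
Definition curlm (R : realType) (tau : 'rV[R]_3 -> 'M[R]_3) (x : 'rV[R]_3) : 'M[R]_3 :=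
  \matrix_(i < 3, k < 3)
     (pd (k + 1)%R (fun y => tau y i (k + 1 + 1)%R) x - pd (k + 1 + 1)%R (fun y => tau y i (k + 1)%R) x).

Definition PT (R : realType) (m : nat) (tau : 'rV[R]_3 -> 'M[R]_3) : Prop :=
  (forall i j, polyfun m (fun x => tau x i j)) /\ (forall x, \tr (tau x) = 0).

Definition tetra (R : realType) (v : 'I_4 -> 'rV[R]_3) : Prop :=
  \det (\matrix_(i < 3) (v (lift ord0 i) - v ord0)) != 0.
(* face f = face opposite to vertex f, with vertices fv v f 0, 1, 2 *)
Definition fv (R : realType) (v : 'I_4 -> 'rV[R]_3) (f : 'I_4) (k : 'I_3) := v (lift f k).
Definition fpt (R : realType) (v : 'I_4 -> 'rV[R]_3) (f : 'I_4) (s t : R) : 'rV[R]_3 :=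
  fv v f 0 + s *: (fv v f 1 - fv v f 0) + t *: (fv v f 2 - fv v f 0).
Definition in_face (R : realType) (v : 'I_4 -> 'rV[R]_3) (f : 'I_4) (X : 'rV[R]_3) : Prop :=
  exists s t : R, [/\ 0 <= s, 0 <= t, s + t <= 1 & X = fpt v f s t].
Definition outward_normal (R : realType) (v : 'I_4 -> 'rV[R]_3) (f : 'I_4) (n : 'rV[R]_3) : Prop :=
  [/\ dot n n = 1, dot n (fv v f 1 - fv v f 0) = 0, dot n (fv v f 2 - fv v f 0) = 0
    & dot n (v f - fv v f 0) < 0].
(* (o, e 0, e 1): origin in the plane of face f and orthonormal tangential frame,
   identifying F with a planar region *)
Definition face_frame (R : realType) (v : 'I_4 -> 'rV[R]_3) (f : 'I_4) (n : 'rV[R]_3)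
  (o : 'rV[R]_3) (e : 'I_2 -> 'rV[R]_3) : Prop :=
  [/\ forall k l, dot (e k) (e l) = (k == l)%:R, forall k, dot (e k) n = 0
    & dot (o - fv v f 0) n = 0].
Definition fcoord (R : realType) (o : 'rV[R]_3) (e : 'I_2 -> 'rV[R]_3) (X : 'rV[R]_3) : 'rV[R]_2 :=
  \row_(k < 2) dot (X - o) (e k).
Definition etan (R : realType) (v : 'I_4 -> 'rV[R]_3) (i j : 'I_4) : 'rV[R]_3 :=
  (norm3 (v j - v i))^-1 *: (v j - v i).

Definition rint (R : realType) (a b : R) (g : R -> R) : R :=
  Rintegral (@lebesgue_measure R) `[a, b] g.
Definition eint (R : realType) (v : 'I_4 -> 'rV[R]_3) (i j : 'I_4) (g : 'rV[R]_3 -> R) (q : {poly R}) : R :=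
  norm3 (v j - v i) * rint 0 1 (fun s => g (v i + s *: (v j - v i)) * q.[s]).
Definition fint (R : realType) (v : 'I_4 -> 'rV[R]_3) (f : 'I_4) (g : 'rV[R]_3 -> R) : R :=
  norm3 (cross (fv v f 1 - fv v f 0) (fv v f 2 - fv v f 0)) *
  rint 0 1 (fun s => rint 0 (1 - s) (fun t => g (fpt v f s t))).
Definition kint (R : realType) (v : 'I_4 -> 'rV[R]_3) (g : 'rV[R]_3 -> R) : R :=
  `|\det (\matrix_(i < 3) (v (lift ord0 i) - v ord0))| *
  rint 0 1 (fun s => rint 0 (1 - s) (fun t => rint 0 (1 - s - t) (fun u =>
     g (v ord0 + s *: (v 1 - v ord0) + t *: (v 2 - v ord0) + u *: (v 3 - v ord0))))).

Definition trace1 (R : realType) (n : 'rV[R]_3) (A : 'M[R]_3) : 'rV[R]_3 := n *m mxcrossr A n.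
Definition trace2 (R : realType) (n : 'rV[R]_3) (A : 'M[R]_3) : 'M[R]_3 :=
  mxcrossr (mxcrossl n (symm (mxcrossr A n))) n.

Definition Bspace (R : realType) (v : 'I_4 -> 'rV[R]_3) (nF : 'I_4 -> 'rV[R]_3) (l : nat)
  (q : 'rV[R]_3 -> 'M[R]_3) : Prop :=
  PT l.+1 q /\ forall f X, in_face v f X ->
     trace1 (nF f) (q X) = 0 /\ trace2 (nF f) (q X) = 0.

Definition rotd (R : realType) (k : 'I_2) (p : 'rV[R]_2 -> R) : 'rV[R]_2 -> R :=
  if k == 0 then (fun y => - pd 1 p y) else pd 0 p.
Definition hperp (R : realType) (p : 'rV[R]_2 -> R) (y : 'rV[R]_2) : 'M[R]_2 :=
  \matrix_(k < 2, l < 2) rotd k (rotd l p) y.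
Definition grad2 (R : realType) (p : 'rV[R]_2 -> R) (y : 'rV[R]_2) : 'rV[R]_2 :=
  \row_(k < 2) pd k p y.
Definition perp2 (R : realType) (y : 'rV[R]_2) : 'rV[R]_2 :=
  \row_(k < 2) (if k == 0 then - y 0 1 else y 0 0).
Definition V6 (R : realType) (l : nat) (s : 'rV[R]_2 -> 'M[R]_2) : Prop :=
  exists (p : 'rV[R]_2 -> R) (w : 'rV[R]_2 -> 'rV[R]_2),
    [/\ polyfun (l - 1) p, forall k, polyfun (l - 1) (fun y => w y 0 k)
      & forall y, s y = hperp p y + symm (y^T *m w y)].
Definition V7 (R : realType) (l : nat) (q : 'rV[R]_2 -> 'rV[R]_2) : Prop :=
  exists (p r : 'rV[R]_2 -> R),
    [/\ polyfun (l - 3) p, polyfun (l - 1) r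
      & forall y, q y = grad2 p y + r y *: perp2 y].

Definition has_dim (R : realType) (V : lmodType R) (S : V -> Prop) (d : nat) : Prop :=
  exists b : 'I_d -> V,
    [/\ forall i, S (b i),
        forall c : 'I_d -> R, \sum_(i < d) c i *: b i = 0 -> forall i, c i = 0
      & forall w, S w -> exists c : 'I_d -> R, w = \sum_(i < d) c i *: b i].

Definition enorm (R : realType) (v : 'I_4 -> 'rV[R]_3) (n1 : 'I_4 -> 'I_4 -> 'rV[R]_3)
  (i j : 'I_4) (a : 'I_2) : 'rV[R]_3 :=
  if a == 0 then n1 i j else cross (etan v i j) (n1 i j).

Definition dofs_vanish (R : realType) (l : nat) (v : 'I_4 -> 'rV[R]_3)
  (nF o : 'I_4 -> 'rV[R]_3) (e : 'I_4 -> 'I_2 -> 'rV[R]_3) (n1 : 'I_4 -> 'I_4 -> 'rV[R]_3)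
  (tau : 'rV[R]_3 -> 'M[R]_3) : Prop :=
  (* (1) *) (forall d, tau (v d) = 0) /\
  (* (2) *) (forall d, symm (curlm tau (v d)) = 0) /\
  (* (3) *) (forall i j : 'I_4, (i < j)%N -> forall a b (q : {poly R}), (size q <= l - 1)%N ->
       eint v i j (fun X => bil (enorm v n1 i j a) (symm (curlm tau X)) (enorm v n1 i j b)) q = 0) /\
  (* (4) *) (forall i j : 'I_4, (i < j)%N -> forall a (q : {poly R}), (size q <= l)%N ->
       eint v i j (fun X => bil (enorm v n1 i j a) (tau X) (etan v i j)) q = 0) /\
  (* (5) *) (forall i j : 'I_4, (i < j)%N -> forall (q : {poly R}), (size q <= l.+1)%N ->
       eint v i j (fun X => bil (enorm v n1 i j 1) (curlm tau X) (enorm v n1 i j 0)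
                   + derive (fun Y => bil (etan v i j) (tau Y) (etan v i j)) X (etan v i j)) q = 0) /\
  (* (6) *) (forall f (s : 'rV[R]_2 -> 'M[R]_2), V6 l s ->
       fint v f (fun X => \sum_(k < 2) \sum_(k' < 2)
          bil (e f k) (trace2 (nF f) (tau X)) (e f k') * s (fcoord (o f) (e f) X) k k') = 0) /\
  (* (7) *) (forall f (q : 'rV[R]_2 -> 'rV[R]_2), V7 l q ->
       fint v f (fun X => \sum_(k < 2)
          dot (trace1 (nF f) (tau X)) (e f k) * q (fcoord (o f) (e f) X) 0 k) = 0) /\
  (* (8) *) (forall q, Bspace v nF l q -> kint v (fun X => frob (tau X) (q X)) = 0).

(* Main.v *)
(* A field annihilated by the vertex and edge functionals carries, on each face, a tangential field
   n . tau x n whose divergence is divisible by the face bubble, and a symmetric field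
   n x sym (tau x n) x n whose rot rot has degree at most l - 1. Testing against gradients (resp.
   second derivatives) kills these, so that both fields derive from a potential that is divisible by
   the bubble; testing against position fields kills the potential. Hence tau is a bubble, and the
   interior functional at q = tau gives the integral of |tau|^2 = 0.

   For the count, the traces decouple in the Bernstein basis: the coefficients of a bubble are
   arbitrary trace-free matrices at interior indices, deviators of u^T n_F at indices interior to a
   face F, and zero elsewhere. The sums of face test spaces are direct because the divergence (resp.
   rotation) turns a relation between the summands into (E + k) w = 0 for the Euler operator E, which
   has only the zero solution. *)
Require Import Defs.
From HB Require Import structures.
From mathcomp Require Import all_boot all_order all_algebra.
From mathcomp Require Import all_classical all_reals all_analysis.
From mathcomp Require Import ring lra zify.
Set Implicit Arguments. Unset Strict Implicit. Unset Printing Implicit Defensive.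
Import Order.TTheory GRing.Theory Num.Theory.
Import numFieldNormedType.Exports.
Local Open Scope classical_set_scope.
Local Open Scope ring_scope.

(** * Polynomial functions *)

(** The obstacle is the passage from edges to faces. The argument on a face needs, on each of its
    edges, a relation between first derivatives that involves the conormal m of the edge in that
    face: D_m(m.tau t) - D_t(m.tau m) + D_t(t.tau t) = 0. Functional (5) knows only one pair n_1,
    n_2, while m changes from face to face. It serves all faces around the edge because (2) and (3)
    make the curl skew on the normal plane of the edge, and a skew form in a plane looks the same in
    every rotated frame. The position fields are measured from an arbitrary origin in the plane of
    the face, so x has no sign on the triangle. Instead of a positivity argument, an equation (E +
    k) r = f is solved for a polynomial weight r of the same degree as f. Faces are treated in the
    affine coordinates of two edge vectors; a linear change of coordinates keeps the form of both
    families of test fields. Only polynomials are integrated, so the divergence theorem follows from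
    polynomial antiderivatives and the fundamental theorem in one variable. *)

Lemma forall_ord2 (P : 'I_2 -> Prop) : P 0 -> P 1 -> forall i, P i.
Proof. by move=> P0 P1 [[|[|//]] hi]; [move: P0 | move: P1]; congr P; apply: val_inj. Qed.

Lemma forall_ord3 (P : 'I_3 -> Prop) : P 0 -> P 1 -> P 2 -> forall i, P i.
Proof.
move=> P0 P1 P2 [[|[|[|//]]] hi]; [move: P0 | move: P1 | move: P2];
  by congr P; apply: val_inj.
Qed.

Section Polyfun.
Context {R : realType} {n : nat}.
Implicit Types (f g : 'rV[R]_n -> R) (m : nat).

Lemma polyfun_eq m f g : f =1 g -> polyfun m f -> polyfun m g.
Proof. by move=> /funext ->. Qed.

Lemma polyfun0 m : polyfun m (fun _ : 'rV[R]_n => 0).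
Proof. by exists (fun=> 0) => x; rewrite big1 // => a _; rewrite mul0r. Qed.

Lemma polyfunD m f g : polyfun m f -> polyfun m g -> polyfun m (fun x => f x + g x).
Proof.
move=> [c fE] [c' gE]; exists (fun a => c a + c' a) => x.
by rewrite fE gE -big_split; apply: eq_bigr => a _; rewrite mulrDl.
Qed.

Lemma polyfunZ m k f : polyfun m f -> polyfun m (fun x => k * f x).
Proof.
move=> [c fE]; exists (fun a => k * c a) => x.
by rewrite fE mulr_sumr; apply: eq_bigr => a _; rewrite mulrA.
Qed.

Lemma polyfun_monomial m (k : 'I_n -> nat) : (\sum_i k i <= m)%N ->
  polyfun m (fun x : 'rV[R]_n => \prod_i x 0 i ^+ k i).
Proof.
move=> km; have klt i : (k i < m.+1)%N.
  by rewrite ltnS (leq_trans _ km) // (bigD1 i) //= leq_addr.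
pose a0 : {ffun 'I_n -> 'I_m.+1} := [ffun i => Ordinal (klt i)].
exists (fun a => (a == a0)%:R) => x.
rewrite (bigD1 a0) /=; last by rewrite (eq_bigr k) // => i _; rewrite ffunE.
rewrite eqxx mul1r [X in _ + X]big1 ?addr0; first by apply: eq_bigr => i _; rewrite ffunE.
by move=> a /andP[_ /negbTE ->]; rewrite mul0r.
Qed.

Lemma polyfun_span (P : ('rV[R]_n -> R) -> Prop) m :
  P (fun=> 0) -> (forall f g, P f -> P g -> P (fun x => f x + g x)) ->
  (forall c (k : 'I_n -> nat), (\sum_i k i <= m)%N -> P (fun x => c * \prod_i x 0 i ^+ k i)) ->
  forall f, polyfun m f -> P f.
Proof.
move=> P0 PD PM f [c fE]; rewrite (funext fE).
elim: (index_enum _) => [|a s IH].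
  by rewrite (_ : (fun x => _) = fun=> 0) //; apply/funext => x; rewrite big_nil.
have [am|am] := boolP (\sum_i (a i : nat) <= m)%N; last first.
  by move: IH; congr (P _); apply/funext => x; rewrite big_cons (negbTE am).
move: (PD _ _ (PM (c a) (fun i => a i : nat) am) IH); congr (P _); apply/funext => x.
by rewrite big_cons am.
Qed.

Lemma polyfun_mono m m' f : (m <= m')%N -> polyfun m f -> polyfun m' f.
Proof.
move=> mm'; apply: polyfun_span; [exact: polyfun0 | exact: polyfunD |].
by move=> c k km; apply/polyfunZ/polyfun_monomial/(leq_trans km).
Qed.

Lemma polyfunM m1 m2 f g :
  polyfun m1 f -> polyfun m2 g -> polyfun (m1 + m2) (fun x => f x * g x).
Proof.
move=> pf pg; apply: (@polyfun_span (fun f => polyfun (m1 + m2) (fun x => f x * g x)) m1) pf.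
- by apply: polyfun_eq (polyfun0 _) => x; rewrite mul0r.
- by move=> f1 f2 p1 p2; apply: polyfun_eq (polyfunD p1 p2) => x; rewrite mulrDl.
move=> c k km.
apply: (@polyfun_span (fun g => polyfun (m1 + m2)
  (fun x => c * (\prod_i x 0 i ^+ k i) * g x)) m2) pg.
- by apply: polyfun_eq (polyfun0 _) => x; rewrite mulr0.
- by move=> f1 f2 p1 p2; apply: polyfun_eq (polyfunD p1 p2) => x; rewrite mulrDr.
move=> c' k' km'.
apply: (@polyfun_eq _ (fun x => c * c' * \prod_i x 0 i ^+ (k i + k' i))).
  by move=> x; under eq_bigr do rewrite exprD; rewrite big_split /= mulrACA.
by apply/polyfunZ/polyfun_monomial; rewrite big_split leq_add.
Qed.

Lemma polyfun_cst m (c : R) : polyfun m (fun _ : 'rV[R]_n => c).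
Proof.
apply: (@polyfun_eq _ (fun x => c * \prod_i x 0 i ^+ 0)).
  by move=> x; rewrite big1 ?mulr1.
by apply/polyfunZ/polyfun_monomial; rewrite big1.
Qed.

Lemma polyfun_coord m (i : 'I_n) : (0 < m)%N -> polyfun m (fun x : 'rV[R]_n => x 0 i).
Proof.
move=> m0; apply: (@polyfun_eq _ (fun x => \prod_j x 0 j ^+ (j == i))).
  by move=> x; rewrite (bigD1 i) //= eqxx expr1 big1 ?mulr1 // => j /negbTE ->.
by apply: polyfun_monomial; rewrite (bigD1 i) //= eqxx big1 // => j /negbTE ->.
Qed.

Lemma polyfun_sum m (I : Type) (r : seq I) (P : pred I) (F : I -> 'rV[R]_n -> R) :
  (forall i, P i -> polyfun m (F i)) -> polyfun m (fun x => \sum_(i <- r | P i) F i x).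
Proof.
move=> pF; elim: r => [|i r IH].
  by apply: polyfun_eq (polyfun0 m) => x; rewrite big_nil.
have [Pi|nPi] := boolP (P i).
  by apply: polyfun_eq (polyfunD (pF i Pi) IH) => x; rewrite big_cons Pi.
by apply: polyfun_eq IH => x; rewrite big_cons (negbTE nPi).
Qed.

Lemma polyfunN m f : polyfun m f -> polyfun m (fun x => - f x).
Proof. by move=> /(polyfunZ (-1)); apply: polyfun_eq => x; rewrite mulN1r. Qed.

Lemma polyfunB m f g : polyfun m f -> polyfun m g -> polyfun m (fun x => f x - g x).
Proof. by move=> pf /polyfunN; apply: polyfunD. Qed.

Lemma polyfunX m k f : polyfun m f -> polyfun (k * m) (fun x => f x ^+ k).
Proof.
move=> pf; elim: k => [|k IH]; first by apply: polyfun_eq (polyfun_cst _ 1) => x.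
by rewrite mulSn; apply: polyfun_eq (polyfunM pf IH) => x; rewrite exprS.
Qed.

(** Constants, sums, weakening of the degree and multiplication by one coordinate generate all
    polynomial functions. Facts on derivatives, antiderivatives, Euler equations and Bernstein
    expansions are proved through this principle, without handling exponents. *)
Lemma polyfun_rec (P : nat -> ('rV[R]_n -> R) -> Prop) :
  (forall c, P 0%N (fun=> c)) -> (forall m f g, P m f -> P m g -> P m (fun x => f x + g x)) ->
  (forall m f, P m f -> P m.+1 f) ->
  (forall m i f, P m f -> P m.+1 (fun x => x 0 i * f x)) ->
  forall m f, polyfun m f -> P m f.
Proof.
move=> Pc PD PS PX m f; apply: polyfun_span.
- by elim: m => // m; apply: PS.
- exact: PD.
move=> c k; elim: m k => [|m IH] k km.
  rewrite (_ : (fun x => _) = fun=> c) //; apply/funext => x.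
  rewrite big1 ?mulr1 // => i _.
  by rewrite (_ : k i = 0%N) //; move: km; rewrite (bigD1 i) //=; lia.
have [k0|] := boolP (\sum_i k i <= m)%N; first exact/PS/IH.
move=> kbig; have [i ki] : exists i, (0 < k i)%N.
  have [/forallP k0|/forallPn[i]] := boolP [forall i, k i == 0%N]; last by rewrite -lt0n; exists i.
  by move: kbig; rewrite big1 // => i _; apply/eqP.
have /(PX _ i) : P m (fun x => c * \prod_j x 0 j ^+ (k j - (j == i))).
  apply: IH; rewrite (bigD1 i) //= eqxx.
  under eq_bigr => j /negbTE -> do rewrite subn0.
  by move: km; rewrite (bigD1 i) //=; lia.
congr (P _ _); apply/funext => x; rewrite mulrCA; congr (_ * _).
rewrite (bigD1 i) // [RHS](bigD1 i) //= eqxx mulrA -exprS subn1 prednK //; congr (_ * _).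
by apply: eq_bigr => j /negbTE ->; rewrite subn0.
Qed.

End Polyfun.

Lemma polyfun_comp (R : realType) n p m (f : 'rV[R]_n -> R) (A : 'rV[R]_p -> 'rV[R]_n) :
  (forall i, polyfun 1 (fun x => A x 0 i)) -> polyfun m f -> polyfun m (fun x => f (A x)).
Proof.
move=> pA; move: m f; apply: polyfun_rec.
- by move=> c; apply: polyfun_cst.
- by move=> m f g; apply: polyfunD.
- by move=> m f; apply: polyfun_mono.
- by move=> m i f pf; rewrite -[m.+1]add1n; apply: polyfunM.
Qed.

(** * Derivatives of polynomial functions *)

Section Derivatives.
Context {R : realType} {n : nat}.
Implicit Types (f g : 'rV[R]_n.+1 -> R) (m : nat) (v w x : 'rV[R]_n.+1).

Lemma derive_affine f v x c : (forall h, f (h *: v + x) = f x + h * c) -> 'D_v f x = c.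
Proof.
move=> fE; apply: cvg_lim => //.
apply: (@cvg_trans _ (c @[h --> (0 : R)^'])); last exact: cvg_cst.
apply: near_eq_cvg; near=> h.
rewrite /= fE [f x + _]addrC addrK /GRing.scale /= mulKf //; near: h; exact: nbhs_dnbhs_neq.
Unshelve. all: by end_near. Qed.

Lemma derive_coord v i x : 'D_v (fun y : 'rV[R]_n.+1 => y 0 i) x = v 0 i.
Proof. by apply: derive_affine => h; rewrite !mxE addrC. Qed.

Lemma polyfun_differentiable m f : polyfun m f -> forall x, differentiable f x.
Proof.
move: m f; apply: polyfun_rec => //.
- by move=> m f g pf pg x; apply: differentiableD.
- by move=> m i f pf x; apply: differentiableM => //; exact: differentiable_coord.
Qed.

Lemma polyfun_derivable m f v x : polyfun m f -> derivable f x v.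
Proof. by move=> /polyfun_differentiable df; apply: diff_derivable. Qed.

Lemma derive_linear m f v w a b x : polyfun m f ->
  'D_(a *: v + b *: w) f x = a * 'D_v f x + b * 'D_w f x.
Proof.
by move=> /polyfun_differentiable df; rewrite !deriveE // linearD !linearZ.
Qed.

Lemma derive_pd m f v x : polyfun m f -> 'D_v f x = \sum_i v 0 i * pd i f x.
Proof.
move=> /polyfun_differentiable df; rewrite /pd deriveE // {1}(row_sum_delta v) linear_sum.
by apply: eq_bigr => i _; rewrite linearZ deriveE.
Qed.

Lemma derive_polyD m1 m2 f g v x : polyfun m1 f -> polyfun m2 g ->
  'D_v (fun y => f y + g y) x = 'D_v f x + 'D_v g x.
Proof. by move=> pf pg; apply: deriveD; apply: polyfun_derivable; eassumption. Qed.

Lemma derive_polyM m1 m2 f g v x : polyfun m1 f -> polyfun m2 g ->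
  'D_v (fun y => f y * g y) x = 'D_v f x * g x + f x * 'D_v g x.
Proof.
move=> pf pg; rewrite [LHS]deriveM; try by apply: polyfun_derivable; eassumption.
by rewrite addrC /GRing.scale /= [g x * _]mulrC.
Qed.

Lemma derive_polyZ m f k v x : polyfun m f -> 'D_v (fun y => k * f y) x = k * 'D_v f x.
Proof.
move=> pf; rewrite (derive_polyM _ _ (polyfun_cst 0 k) pf).
by rewrite derive_cst mul0r add0r.
Qed.

Lemma polyfun_derive_const f v x : polyfun 0 f -> 'D_v f x = 0.
Proof.
case=> c fE; apply: derive_affine => h; rewrite mulr0 addr0 !fE; apply: eq_bigr => a.
rewrite leqn0 sum_nat_eq0 => /forallP a0; congr (_ * _); apply: eq_bigr => i _.
by rewrite (eqP (a0 i)) !expr0.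
Qed.

Lemma polyfun_derive m f v : polyfun m f -> polyfun m.-1 (fun x => 'D_v f x).
Proof.
move=> pf; suff [] : [/\ polyfun m f & forall v, polyfun m.-1 (fun x => 'D_v f x)] by [].
move: m f pf; apply: polyfun_rec.
- move=> c; split; first exact: polyfun_cst.
  by move=> w; apply: polyfun_eq (polyfun0 _) => x; rewrite derive_cst.
- move=> m f g [pf df] [pg dg]; split=> [|w]; first exact: polyfunD.
  by apply: polyfun_eq (polyfunD (df w) (dg w)) => x; rewrite (derive_polyD _ _ pf pg).
- move=> m f [pf df]; split=> [|w]; first exact: polyfun_mono pf.
  by apply: polyfun_mono (df w); exact: leq_pred.
move=> m i f [pf df]; split=> [|w].
  by rewrite -[m.+1]add1n; apply: polyfunM => //; exact: polyfun_coord.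
apply: (@polyfun_eq _ _ _ (fun x => w 0 i * f x + x 0 i * 'D_w f x)).
  by move=> x; rewrite (derive_polyM _ _ (@polyfun_coord _ _ 1 i isT) pf) derive_coord.
apply: polyfunD; first exact: polyfunZ.
(* For [m = 0] the degree bound of a product would give degree 1; the derivative of a constant is
   zero, which restores degree 0. *)
case: m pf df => [|m] pf df.
  apply: polyfun_eq (polyfun0 _) => x.
  by rewrite polyfun_derive_const // mulr0.
by rewrite -[m.+1]add1n; apply: polyfunM => //; exact: polyfun_coord.
Qed.

Lemma derive_schwarz m f v w x : polyfun m f ->
  'D_v (fun y => 'D_w f y) x = 'D_w (fun y => 'D_v f y) x.
Proof.
move=> pf; suff [] : polyfun m f /\
  forall v w x, 'D_v (fun y => 'D_w f y) x = 'D_w (fun y => 'D_v f y) x by [].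
move: m f pf {v w x}; apply: polyfun_rec.
- move=> c; split; first exact: polyfun_cst.
  move=> v w x.
  have E u : (fun y => 'D_u (fun=> c) y) = (fun=> 0) :> ('rV[R]_n.+1 -> R).
    by apply/funext => y; rewrite derive_cst.
  by rewrite !E !derive_cst.
- move=> m f g [pf df] [pg dg]; split=> [|v w x]; first exact: polyfunD.
  have E u : (fun y => 'D_u (fun y => f y + g y) y) = (fun y => 'D_u f y + 'D_u g y).
    by apply/funext => y; rewrite (derive_polyD _ _ pf pg).
  rewrite !E (derive_polyD _ _ (polyfun_derive w pf) (polyfun_derive w pg)).
  by rewrite (derive_polyD _ _ (polyfun_derive v pf) (polyfun_derive v pg)) df dg.
- by move=> m f [pf df]; split=> //; exact: polyfun_mono pf.
move=> m i f [pf df].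
have pX := @polyfun_coord R n.+1 1 i isT.
split=> [|v w x]; first by rewrite -[m.+1]add1n; apply: polyfunM.
have E u : (fun y => 'D_u (fun y : 'rV[R]_n.+1 => y 0 i * f y) y) =
           (fun y : 'rV[R]_n.+1 => u 0 i * f y + y 0 i * 'D_u f y).
  by apply/funext => y; rewrite (derive_polyM _ _ pX pf) derive_coord.
(* Apart from the second derivative of [f], which the induction hypothesis handles, this expression
   is symmetric in [u] and [u']. *)
have F (u u' : 'rV[R]_n.+1) : 'D_u (fun y : 'rV[R]_n.+1 => u' 0 i * f y + y 0 i * 'D_u' f y) x =
   u' 0 i * 'D_u f x + (u 0 i * 'D_u' f x + x 0 i * 'D_u (fun y => 'D_u' f y) x).
  have pd' := polyfun_derive u' pf.
  rewrite (derive_polyD _ _ (polyfunZ (u' 0 i) pf) (polyfunM pX pd')).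
  by rewrite (derive_polyZ _ _ _ pf) (derive_polyM _ _ pX pd') derive_coord.
by rewrite !E !F df; ring.
Qed.

Lemma polyfun_pd m f i : polyfun m f -> polyfun m.-1 (pd i f).
Proof. exact: polyfun_derive. Qed.

Lemma pd_coord i j x : pd i (fun y : 'rV[R]_n.+1 => y 0 j) x = (i == j)%:R.
Proof. by rewrite /pd derive_coord mxE eqxx eq_sym. Qed.

Lemma pd_cst i (k : R) x : pd i (fun _ : 'rV[R]_n.+1 => k) x = 0.
Proof. by rewrite /pd derive_cst. Qed.

Lemma pdD m1 m2 f g i x : polyfun m1 f -> polyfun m2 g ->
  pd i (fun y => f y + g y) x = pd i f x + pd i g x.
Proof. exact: derive_polyD. Qed.

Lemma pdZ m f k i x : polyfun m f -> pd i (fun y => k * f y) x = k * pd i f x.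
Proof. exact: derive_polyZ. Qed.

Lemma pdN m f i x : polyfun m f -> pd i (fun y => - f y) x = - pd i f x.
Proof.
by move=> pf; rewrite -mulN1r -(pdZ _ _ _ pf); congr pd; apply/funext => y; rewrite mulN1r.
Qed.

Lemma pdB m1 m2 f g i x : polyfun m1 f -> polyfun m2 g ->
  pd i (fun y => f y - g y) x = pd i f x - pd i g x.
Proof. by move=> pf pg; rewrite (pdD _ _ pf (polyfunN pg)) (pdN _ _ pg). Qed.

Lemma pdM m1 m2 f g i x : polyfun m1 f -> polyfun m2 g ->
  pd i (fun y => f y * g y) x = pd i f x * g x + f x * pd i g x.
Proof. exact: derive_polyM. Qed.

Lemma pd_schwarz m f i j : polyfun m f -> pd i (pd j f) = pd j (pd i f).
Proof. by move=> pf; apply/funext => x; exact: (derive_schwarz _ _ _ pf). Qed.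

End Derivatives.

Lemma derive_comp_affine (R : realType) n p (f : 'rV[R]_n.+1 -> R)
    (A : 'rV[R]_p.+1 -> 'rV[R]_n.+1) v v' x :
  (forall h, A (h *: v + x) = h *: v' + A x) -> 'D_v (fun y => f (A y)) x = 'D_v' f (A x).
Proof. by move=> AE; rewrite /derive /= /shift /=; under eq_fun do rewrite AE. Qed.

(** Restriction to a line turns questions on zeros, integrals and derivatives into questions on
    [{poly R}], where roots can be counted and factored out. *)
Lemma polyfun_line (R : realType) n m (f : 'rV[R]_n.+1 -> R) (x d : 'rV[R]_n.+1) : polyfun m f ->
  exists p : {poly R}, [/\ (size p <= m.+1)%N, forall s, p.[s] = f (x + s *: d)
    & forall s, p^`().[s] = 'D_d f (x + s *: d)].
Proof.
move=> pf; suff [] : polyfun m f /\ exists p : {poly R}, [/\ (size p <= m.+1)%N,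
  forall s, p.[s] = f (x + s *: d) & forall s, p^`().[s] = 'D_d f (x + s *: d)] by [].
move: m f pf; apply: polyfun_rec.
- move=> c; split; first exact: polyfun_cst.
  exists c%:P; split=> [|s|s]; rewrite ?size_polyC_leq1 ?hornerC //.
  by rewrite derivC horner0 derive_cst.
- move=> m f g [pf [p [sp pE dp]]] [pg [q [sq qE dq]]]; split; first exact: polyfunD.
  exists (p + q); split=> [|s|s]; rewrite ?derivD ?hornerD ?pE ?qE ?dp ?dq //.
    by rewrite (leq_trans (size_polyD _ _)) // geq_max sp.
  by rewrite (derive_polyD _ _ pf pg).
- move=> m f [pf [p [sp pE dp]]]; split; first exact: polyfun_mono pf.
  by exists p; split=> //; rewrite ltnW.
move=> m i f [pf [p [sp pE dp]]].
have pX := @polyfun_coord R n.+1 1 i isT.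
split; first by rewrite -[m.+1]add1n; apply: polyfunM.
exists (((x 0 i)%:P + (d 0 i) *: 'X) * p); split=> [|s|s].
- rewrite (leq_trans (size_polyMleq _ _)) //.
  have : (size ((x 0 i)%:P + d 0 i *: 'X)%R <= 2)%N.
    rewrite (leq_trans (size_polyD _ _)) // geq_max (leq_trans (size_polyC_leq1 _)) //=.
    by rewrite (leq_trans (size_scale_leq _ _)) // size_polyX.
  lia.
- by rewrite !hornerE pE !mxE [d 0 i * s]mulrC.
- rewrite derivM derivD derivC derivZ derivX !hornerE pE dp (derive_polyM _ _ pX pf) derive_coord !mxE.
  by rewrite [s * _]mulrC.
Qed.

(** * Integrals over segments and simplices *)
Section PolyIntegral.
Context {R : realType}.
Implicit Types (p q : {poly R}) (a b s : R).

Lemma eq_rint a b (f g : R -> R) : (forall s, a <= s <= b -> f s = g s) ->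
  rint a b f = rint a b g.
Proof. by move=> fg; apply: eq_Rintegral => s; rewrite inE /= in_itv; exact: fg. Qed.

Lemma rint_deriv p a b : a <= b -> rint a b (horner p^`()) = p.[b] - p.[a].
Proof.
rewrite le_eqVlt => /predU1P[->|ab].
  by rewrite /rint set_itv1 Rintegral_set1 subrr.
rewrite /rint /Rintegral (@continuous_FTC2 _ _ (horner p)) //.
- exact/continuous_subspaceT/continuous_horner.
- split; first by move=> x _; exact: derivable_horner.
  + exact/cvg_at_right_filter/continuous_horner.
  + exact/cvg_at_left_filter/continuous_horner.
- by move=> x _; rewrite derivE.
Qed.

Lemma poly_antideriv p : exists q, q^`() = p.
Proof.
exists (\poly_(i < (size p).+1) (p`_i.-1 / i%:R)); apply/polyP => i.
rewrite coef_deriv coef_poly ltnS /=; case: ltnP => [ip|ip].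
  by rewrite -[LHS]mulr_natr divfK // pnatr_eq0.
by rewrite mul0rn nth_default.
Qed.

Lemma rintD a b f g p q : a <= b -> f =1 horner p -> g =1 horner q ->
  rint a b (fun s => f s + g s) = rint a b f + rint a b g.
Proof.
move=> ab /funext -> /funext ->.
have [P <-] := poly_antideriv p; have [Q <-] := poly_antideriv q.
rewrite !rint_deriv //.
transitivity ((P + Q).[b] - (P + Q).[a]); last by rewrite !hornerD opprD addrACA.
by rewrite -rint_deriv //; apply: eq_rint => s _; rewrite derivD hornerD.
Qed.

Lemma rintZ a b k f p : a <= b -> f =1 horner p ->
  rint a b (fun s => k * f s) = k * rint a b f.
Proof.
move=> ab /funext ->; have [P <-] := poly_antideriv p.
rewrite !rint_deriv // mulrBr -!hornerZ -rint_deriv //.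
by apply: eq_rint => s _; rewrite derivZ hornerZ.
Qed.

Lemma rint_ge0 a b (f : R -> R) : (forall s, a <= s <= b -> 0 <= f s) -> 0 <= rint a b f.
Proof.
move=> f0; apply: Rintegral_ge0 => s /=; rewrite in_itv; exact: f0.
Qed.

Lemma poly_eq0_near p a b : a < b -> (forall s, a < s < b -> p.[s] = 0) -> p = 0.
Proof.
move=> ab p0; apply/eqP; apply: contraT => pn0.
(* These are [size p] distinct points strictly between [a] and [b]; the denominators start at 2 to
   avoid [b]. *)
pose rs := [seq a + (b - a) / k.+2%:R | k <- iota 0 (size p)].
have inj : injective (fun k : nat => a + (b - a) / k.+2%:R).
  move=> i j /addrI /mulfI; rewrite subr_eq0 gt_eqF // => /(_ isT) /invr_inj.
  by move=> /eqP; rewrite eqr_nat !eqSS => /eqP.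
have := max_poly_roots pn0 (rs := rs); rewrite map_inj_uniq // iota_uniq size_map size_iota ltnn.
apply=> //; apply/allP => _ /mapP[k _ ->]; apply/rootP/p0.
have k0 : 0 < (k.+2%:R : R) by rewrite ltr0n.
rewrite ltrDl divr_gt0 ?subr_gt0 //= -ltrBrDl ltr_pdivrMr //.
by rewrite ltr_pMr ?subr_gt0 // ltr1n.
Qed.

(** An antiderivative is nondecreasing with equal values at both ends, hence constant on the
    interval, hence a constant polynomial. *)
Lemma poly_ge0_rint_eq0 p a b : a < b -> (forall s, a <= s <= b -> 0 <= p.[s]) ->
  rint a b (horner p) = 0 -> p = 0.
Proof.
move=> ab p0; have [P PE] := poly_antideriv p; rewrite -PE in p0 *.
rewrite rint_deriv ?ltW // => /eqP; rewrite subr_eq0 => /eqP Pab.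
have Pconst s : a <= s <= b -> P.[s] = P.[a].
  move=> /andP[as' sb]; apply/eqP; rewrite eq_le -{1}Pab -subr_ge0 -[X in _ && X]subr_ge0.
  rewrite -!rint_deriv // !rint_ge0 // => r /andP[ar rb]; apply: p0.
    by rewrite ar (le_trans rb).
  by rewrite rb (le_trans as').
have : P - P.[a]%:P = 0.
  apply: (@poly_eq0_near _ a b) => // s /andP[as' sb].
  by rewrite !hornerE Pconst ?subrr // !ltW.
by move=> /eqP; rewrite subr_eq0 => /eqP ->; rewrite derivC.
Qed.

Lemma poly_moments_eq0 k p : (size p <= k)%N ->
  (forall q, (size q <= k)%N -> rint 0 1 (fun s => p.[s] * q.[s]) = 0) -> p = 0.
Proof.
move=> sp /(_ p sp) I0; apply/eqP; rewrite -sqrf_eq0; apply/eqP.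
apply: (@poly_ge0_rint_eq0 _ 0 1); rewrite ?ltr01 //.
  by move=> s _; rewrite horner_exp sqr_ge0.
by rewrite -[RHS]I0; apply: eq_rint => s _; rewrite horner_exp.
Qed.

(** The zeros at both ends give p = q (X - 1) X with [q] of size at most [k]; testing with [q]
    itself makes the integral of X (1 - X) q^2 vanish. Two end values thus replace two moments. *)
Lemma poly_bubble_moments_eq0 k p : (size p <= k.+2)%N -> p.[0] = 0 -> p.[1] = 0 ->
  (forall q, (size q <= k)%N -> rint 0 1 (fun s => p.[s] * q.[s]) = 0) -> p = 0.
Proof.
move=> sp /rootP /factor_theorem[p1 pE].
rewrite pE subr0 hornerM hornerX mulr1 => /rootP /factor_theorem[q qE].
move: pE sp; rewrite {}qE subr0 => -> {p p1} sp I0.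
have [->|qn0] := eqVneq q 0; first by rewrite !mul0r.
have sq : (size q <= k)%N.
  by move: sp; rewrite size_mulX ?mulf_neq0 ?polyXsubC_eq0 // size_Mmonic ?monicXsubC // size_XsubC addn2.
have /eqP : (1 - 'X) * 'X * q ^+ 2 = 0 :> {poly R}.
  apply: (@poly_ge0_rint_eq0 _ 0 1); rewrite ?ltr01 //.
    move=> s /andP[s0 s1]; rewrite hornerM hornerM horner_exp.
    by rewrite mulr_ge0 ?sqr_ge0 // !hornerE mulr_ge0 ?subr_ge0.
  have -> : horner ((1 - 'X) * 'X * q ^+ 2) =
     (fun s => -1 * (q * ('X - 1%:P) * 'X * q).[s]).
    by apply/funext => s; rewrite !(hornerM, horner_exp, hornerD, hornerN, hornerX, hornerC); ring.
  rewrite (rintZ _ ler01 (p := q * ('X - 1%:P) * 'X * q)) //.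
  rewrite (_ : horner _ = fun s => (q * ('X - 1%:P) * 'X).[s] * q.[s]) ?I0 ?mulr0 //.
  by apply/funext => s; exact: hornerM.
by rewrite mulf_eq0 sqrf_eq0 (negbTE qn0) orbF mulf_eq0 polyX_eq0 orbF -opprB oppr_eq0
  -polyC1 polyXsubC_eq0.
Qed.

Lemma rint_0 a b : rint a b (fun=> 0) = 0 :> R.
Proof. by rewrite /rint /Rintegral integral0. Qed.

End PolyIntegral.

Section LineRestriction.
Context {R : realType} {n : nat}.
Implicit Types (f g : 'rV[R]_n.+1 -> R) (x d : 'rV[R]_n.+1).

Lemma rint_line m f x d a b : a <= b -> polyfun m f ->
  rint a b (fun s => 'D_d f (x + s *: d)) = f (x + b *: d) - f (x + a *: d).
Proof.
move=> ab pf; have [p [_ pE dp]] := polyfun_line x d pf.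
by rewrite -!pE -rint_deriv //; apply: eq_rint => s _; rewrite dp.
Qed.

Lemma polyfun_mul_eq0 m1 m2 f g : polyfun m1 f -> polyfun m2 g ->
  (forall x, f x * g x = 0) -> (exists x, f x != 0) -> forall x, g x = 0.
Proof.
move=> pf pg fg [x0 fx0] x.
have [p [_ pE _]] := polyfun_line x0 (x - x0) pf.
have [q [_ qE _]] := polyfun_line x0 (x - x0) pg.
have : p * q = 0.
  by apply: (@poly_eq0_near _ _ 0 1) => // s _; rewrite hornerM pE qE fg.
move=> /eqP; rewrite mulf_eq0 => /orP[/eqP p0|/eqP q0].
  by move: (pE 0) fx0; rewrite p0 horner0 scale0r addr0 => <-; rewrite eqxx.
by have := qE 1; rewrite q0 horner0 scale1r addrC subrK.
Qed.

(** The induction integrates [x 0 i ^+ k * f x] for all [k] at once: multiplying [f] by the variable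
    of integration only raises [k], while any other coordinate passes through [pd i]. *)
Lemma polyfun_antideriv m f i : polyfun m f ->
  exists2 g, polyfun m.+1 g & forall x, pd i g x = f x.
Proof.
move=> pf; suff [_ /(_ 0%N) [g pg gE]] : polyfun m f /\ forall k, exists2 g,
    polyfun (k + m).+1 g & forall x, pd i g x = x 0 i ^+ k * f x.
  by exists g => // x; rewrite gE mul1r.
move: m f pf; apply: polyfun_rec.
- move=> c; split=> [|k]; first exact: polyfun_cst.
  exists (fun x => c / k.+1%:R * x 0 i ^+ k.+1).
    rewrite addn0; apply: polyfunZ; rewrite -[X in polyfun X]muln1; apply: polyfunX.
    exact: polyfun_coord.
  move=> x; rewrite /pd (derive_polyZ _ _ _ (polyfunX k.+1 (@polyfun_coord _ _ 1 i isT))).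
  have -> : 'D_(delta_mx 0 i) (fun y : 'rV[R]_n.+1 => y 0 i ^+ k.+1) x =
            k.+1%:R * x 0 i ^+ k.
    elim: k => [|k IH]; first by rewrite derive_coord mxE !eqxx mul1r expr0.
    under eq_fun do rewrite exprS.
    have pX := @polyfun_coord R n.+1 1 i isT.
    rewrite (derive_polyM _ _ pX (polyfunX k.+1 pX)) IH derive_coord mxE !eqxx.
    by rewrite mul1r mulrCA -exprS -[in RHS]natr1 mulrDl mul1r addrC.
  by rewrite mulrA divfK ?pnatr_eq0 // mulrC.
- move=> m f g [pf If] [pg Ig]; split=> [|k]; first exact: polyfunD.
  have [F pF FE] := If k; have [G pG GE] := Ig k.
  exists (fun x => F x + G x); first exact: polyfunD.
  by move=> x; rewrite /pd (derive_polyD _ _ pF pG) -/(pd i F x) FE -/(pd i G x) GE mulrDr.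
- move=> m f [pf If]; split=> [|k]; first exact: polyfun_mono pf.
  by have [F pF FE] := If k; exists F => //; apply: polyfun_mono pF; rewrite addnS.
move=> m j f [pf If]; have pX := @polyfun_coord R n.+1 1 j isT.
split=> [|k]; first by rewrite -[m.+1]add1n; apply: polyfunM.
have [->|ij] := eqVneq j i.
  have [F pF FE] := If k.+1; exists F; first by rewrite addnS -addSn.
  by move=> x; rewrite FE exprSr mulrA.
have [F pF FE] := If k; exists (fun x => x 0 j * F x).
  by rewrite addnS -[X in polyfun X]add1n; apply: polyfunM.
move=> x; rewrite /pd (derive_polyM _ _ pX pF) derive_coord mxE eqxx (negbTE ij) mul0r add0r.
by rewrite -/(pd i F x) FE mulrCA.
Qed.

End LineRestriction.

Local Opaque rint.

(** * Iterated integrals over a right triangle and the divergence theorem *)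

Section TriangleIntegral.
Context {R : realType}.
Local Notation V := 'rV[R]_2.
Implicit Types (f g : V -> R) (c x : V) (s t : R).

Definition e0 : V := delta_mx 0 0.
Definition e1 : V := delta_mx 0 1.
(** The corner [c] stays a parameter because the test fields contain the position vector, whose
    origin is not a vertex of the triangle in general. *)
Definition tint c f := rint 0 1 (fun s => rint 0 (1 - s) (fun t => f (c + s *: e0 + t *: e1))).

Lemma tint_inner m f c s : polyfun m f -> 0 <= s <= 1 ->
  rint 0 (1 - s) (fun t => pd 1 f (c + s *: e0 + t *: e1)) =
  f (c + e1 + s *: (e0 - e1)) - f (c + s *: e0).
Proof.
move=> pf /andP[s0 s1]; rewrite (rint_line _ _ _ pf) ?subr_ge0 //; congr (f _ - f _).
  by apply/rowP => i; rewrite !mxE; ring.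
by rewrite scale0r addr0.
Qed.

Lemma tint_pd1 m f c : polyfun m f ->
  tint c (pd 1 f) = rint 0 1 (fun s => f (c + e1 + s *: (e0 - e1)) - f (c + s *: e0)).
Proof. by move=> pf; apply: eq_rint => s s01; apply: tint_inner pf s01. Qed.

Lemma rintD_line m1 m2 f g x x' d d' : polyfun m1 f -> polyfun m2 g ->
  rint 0 1 (fun s => f (x + s *: d) + g (x' + s *: d')) =
  rint 0 1 (fun s => f (x + s *: d)) + rint 0 1 (fun s => g (x' + s *: d')).
Proof.
move=> pf pg; have [p [_ pE _]] := polyfun_line x d pf.
have [q [_ qE _]] := polyfun_line x' d' pg.
by apply: (rintD ler01 (p := p) (q := q)) => s; rewrite ?pE ?qE.
Qed.

Lemma rintB_line m1 m2 f g x x' d d' : polyfun m1 f -> polyfun m2 g ->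
  rint 0 1 (fun s => f (x + s *: d) - g (x' + s *: d')) =
  rint 0 1 (fun s => f (x + s *: d)) - rint 0 1 (fun s => g (x' + s *: d')).
Proof.
move=> pf pg; rewrite (rintD_line x x' d d' pf (polyfunN pg)); congr (_ + _).
have [q [_ qE _]] := polyfun_line x' d' pg.
by rewrite -mulN1r -(rintZ _ ler01 (p := q)) //; apply: eq_rint => s _; rewrite mulN1r.
Qed.

(** Once the integrands are written as [pd 1] of polynomials, the inner integrals are differences of
    edge values, polynomial in the outer variable, and only the additivity of [rint] on polynomials
    is used. *)
Lemma tintD m1 m2 f g c : polyfun m1 f -> polyfun m2 g ->
  tint c (fun x => f x + g x) = tint c f + tint c g.
Proof.
move=> /(polyfun_mono (leq_maxl m1 m2)) /(polyfun_antideriv 1)[F pF /funext <-].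
move=> /(polyfun_mono (leq_maxr m1 m2)) /(polyfun_antideriv 1)[G pG /funext <-].
rewrite (_ : (fun x => _) = pd 1 (fun x => F x + G x)); last first.
  by apply/funext => x; rewrite (pdD _ _ pF pG).
rewrite (tint_pd1 _ (polyfunD pF pG)) (tint_pd1 _ pF) (tint_pd1 _ pG).
rewrite (rintB_line _ _ _ _ pF pF) (rintB_line _ _ _ _ pG pG).
rewrite (rintB_line _ _ _ _ (polyfunD pF pG) (polyfunD pF pG)).
by rewrite !(rintD_line _ _ _ _ pF pG); ring.
Qed.

Lemma tintZ m f c k : polyfun m f -> tint c (fun x => k * f x) = k * tint c f.
Proof.
move=> /(polyfun_antideriv 1)[F pF /funext <-].
rewrite (_ : (fun x => _) = pd 1 (fun x => k * F x)); last first.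
  by apply/funext => x; rewrite /pd (derive_polyZ _ _ _ pF).
rewrite (tint_pd1 _ (polyfunZ k pF)) (tint_pd1 _ pF).
have [p [_ pE _]] := polyfun_line (c + e1) (e0 - e1) pF.
have [q [_ qE _]] := polyfun_line c e0 pF.
rewrite -(rintZ k ler01 (p := p - q)) => [|s]; last by rewrite hornerD hornerN pE qE.
by apply: eq_rint => s _; rewrite mulrBr.
Qed.

(** This replaces an exchange of the order of integration. With f = [pd 1 G], the two derivatives
    commute and the inner integral is explicit; on the hypotenuse [pd 0 G - pd 1 G] is a tangential
    derivative, so the vertex values of [G] cancel and the edge integrals of [pd 1 G] remain. *)
Lemma tint_pd0 m f c : polyfun m f ->
  tint c (pd 0 f) = rint 0 1 (fun s => f (c + e1 + s *: (e0 - e1)))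
                  - rint 0 1 (fun s => f (c + s *: e1)).
Proof.
move=> /(polyfun_antideriv 1)[G pG /funext <-].
rewrite (pd_schwarz _ _ pG).
have aux (A B a b d : R) : A - B = a - b -> A - (a - d) = B - (b - d) by lra.
have pG0 := polyfun_pd 0 pG; have pG1 := polyfun_pd 1 pG.
have L0 : rint 0 1 (fun s => pd 0 G (c + s *: e0)) = G (c + 1 *: e0) - G (c + 0 *: e0).
  exact: (rint_line _ _ ler01 pG).
have L1 : rint 0 1 (fun s => pd 1 G (c + s *: e1)) = G (c + 1 *: e1) - G (c + 0 *: e1).
  exact: (rint_line _ _ ler01 pG).
rewrite (tint_pd1 _ pG0) (rintB_line _ _ _ _ pG0 pG0) L0 L1.
have L2 : rint 0 1 (fun s => pd 0 G (c + e1 + s *: (e0 - e1)) - pd 1 G (c + e1 + s *: (e0 - e1)))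
    = G (c + e1 + 1 *: (e0 - e1)) - G (c + e1 + 0 *: (e0 - e1)).
  rewrite -(rint_line _ _ ler01 pG); apply: eq_rint => s _.
  have := derive_linear e0 e1 1 (-1) (c + e1 + s *: (e0 - e1)) pG.
  by rewrite scale1r scaleN1r mul1r mulN1r => ->.
move: L2; rewrite (rintB_line _ _ _ _ pG0 pG1) !scale0r !scale1r !addr0.
rewrite [c + e1 + (e0 - e1)](_ : _ = c + e0); last by apply/rowP => i; rewrite !mxE; ring.
exact: aux.
Qed.

Lemma tint_div m1 m2 f g c : polyfun m1 f -> polyfun m2 g ->
  tint c (fun x => pd 0 f x + pd 1 g x) =
  rint 0 1 (fun s => f (c + e1 + s *: (e0 - e1)) + g (c + e1 + s *: (e0 - e1)))
  - rint 0 1 (fun s => f (c + s *: e1)) - rint 0 1 (fun s => g (c + s *: e0)).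
Proof.
move=> pf pg; rewrite (tintD _ (polyfun_pd 0 pf) (polyfun_pd 1 pg)).
rewrite (tint_pd0 _ pf) (tint_pd1 _ pg) (rintB_line _ _ _ _ pg pg) (rintD_line _ _ _ _ pf pg).
by ring.
Qed.

(** The inner integral is a nonnegative polynomial with zero integral, hence zero. So [f] vanishes
    on every line in direction [e1] that meets the open triangle, and then on every line in
    direction [e0]. *)
Lemma tint_ge0_eq0 m f c : polyfun m f ->
  (forall s t, 0 <= s -> 0 <= t -> s + t <= 1 -> 0 <= f (c + s *: e0 + t *: e1)) ->
  tint c f = 0 -> forall x, f x = 0.
Proof.
move=> pf f0; have [F pF FE] := polyfun_antideriv 1 pf.
have inner s : 0 <= s <= 1 -> rint 0 (1 - s) (fun t => f (c + s *: e0 + t *: e1)) =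
    F (c + e1 + s *: (e0 - e1)) - F (c + s *: e0).
  by move=> s01; rewrite -(tint_inner _ pF) //; apply: eq_rint => t _; rewrite FE.
have [p [_ pE _]] := polyfun_line (c + e1) (e0 - e1) pF.
have [q [_ qE _]] := polyfun_line c e0 pF.
rewrite /tint => If; have pq0 : p - q = 0.
  apply: (@poly_ge0_rint_eq0 _ _ 0 1); first exact: ltr01.
    move=> s /andP[s0 s1]; rewrite hornerD hornerN pE qE -inner ?s0 //; apply: rint_ge0 => t /andP[t0 ts].
    by apply: f0; rewrite // -lerBrDl.
  by rewrite -[RHS]If; apply: eq_rint => s s01; rewrite inner // hornerD hornerN pE qE.
have f_strip s t : 0 < s < 1 -> f (c + s *: e0 + t *: e1) = 0.
  move=> /andP[s0 s1]; have [r [_ rE _]] := polyfun_line (c + s *: e0) e1 pf.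
  rewrite -rE (@poly_ge0_rint_eq0 _ r 0 (1 - s)) ?horner0 ?subr_gt0 //.
    by move=> u /andP[u0 us]; rewrite rE; apply: f0; rewrite ?(ltW s0) // -lerBrDl.
  rewrite (funext rE) inner ?(ltW s0) ?ltW // -pE -qE.
  by move: pq0 => /eqP; rewrite subr_eq0 => /eqP ->; rewrite subrr.
move=> x; have [r [_ rE _]] := polyfun_line (c + (x - c) 0 1 *: e1) e0 pf.
have r0 : r = 0.
  apply: (@poly_eq0_near _ _ 0 1) => // s s01; rewrite rE addrAC; exact: f_strip.
have := rE ((x - c) 0 0); rewrite r0 horner0 => ->; congr f.
apply/rowP; apply: forall_ord2; rewrite !mxE /=; ring.
Qed.

End TriangleIntegral.

(** The innermost integral is a polynomial [G] on the triangle, to which the planar result applies.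
    Vanishing of [f] then spreads one coordinate at a time: to all u when s, t > 0 and s + t < 1, to
    all t when 0 < s < 1/2, and finally to all s. *)
Lemma tet_rint_ge0_eq0 (R : realType) m (f : 'rV[R]_3 -> R) : polyfun m f ->
  (forall x, 0 <= f x) ->
  rint 0 1 (fun s => rint 0 (1 - s) (fun t => rint 0 (1 - s - t) (fun u =>
     f (s *: delta_mx 0 0 + t *: delta_mx 0 1 + u *: delta_mx 0 2)))) = 0 ->
  forall x, f x = 0.
Proof.
move=> pf f0; have [F pF FE] := polyfun_antideriv 2 pf.
pose A0 (y : 'rV[R]_2) : 'rV[R]_3 := y 0 0 *: delta_mx 0 0 + y 0 1 *: delta_mx 0 1.
pose A1 (y : 'rV[R]_2) : 'rV[R]_3 := A0 y + (1 - y 0 0 - y 0 1) *: delta_mx 0 2.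
pose G y := F (A1 y) - F (A0 y).
have pA0 i : polyfun 1 (fun y => A0 y 0 i).
  apply: polyfun_eq (polyfunD (polyfunZ (delta_mx 0 0 0 i) (@polyfun_coord R 2 1 0 isT))
                              (polyfunZ (delta_mx 0 1 0 i) (@polyfun_coord R 2 1 1 isT))).
  by move=> y; rewrite !mxE; ring.
have pA1 i : polyfun 1 (fun y => A1 y 0 i).
  have pl := polyfunB (polyfunB (polyfun_cst 1 1) (@polyfun_coord R 2 1 0 isT))
                      (@polyfun_coord R 2 1 1 isT).
  apply: polyfun_eq (polyfunD (pA0 i) (polyfunZ (delta_mx 0 2 0 i) pl)).
  by move=> y; rewrite !mxE; ring.
have pG : polyfun m.+1 G by apply: polyfunB; apply: polyfun_comp pF.
have inner s t : 0 <= s -> 0 <= t -> s + t <= 1 ->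
    rint 0 (1 - s - t) (fun u => f (s *: delta_mx 0 0 + t *: delta_mx 0 1 + u *: delta_mx 0 2))
    = G (0 + s *: e0 + t *: e1).
  move=> s0 t0 st; have st' : 0 <= 1 - s - t by lra.
  have -> : G (0 + s *: e0 + t *: e1) =
     F (s *: delta_mx 0 0 + t *: delta_mx 0 1 + (1 - s - t) *: delta_mx 0 2) -
     F (s *: delta_mx 0 0 + t *: delta_mx 0 1 + 0 *: delta_mx 0 2).
    rewrite /G /A1 /A0; congr (F _ - F _); apply/rowP => i; rewrite !mxE /=; ring.
  by rewrite -(rint_line _ _ st' pF); apply: eq_rint => u _; exact/esym/FE.
move=> If; have G0 : forall y, G y = 0.
  apply: (tint_ge0_eq0 (c := 0) pG).
    by move=> s t s0 t0 st; rewrite -inner //; apply: rint_ge0 => u _; apply: f0.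
  rewrite -[RHS]If; apply: eq_rint => s /andP[s0 s1]; apply: eq_rint => t /andP[t0 ts].
  by rewrite inner //; lra.
have f_strip s t u : 0 < s -> 0 < t -> s + t < 1 ->
    f (s *: delta_mx 0 0 + t *: delta_mx 0 1 + u *: delta_mx 0 2) = 0.
  move=> s0 t0 st.
  have [r [_ rE _]] := polyfun_line (s *: delta_mx 0 0 + t *: delta_mx 0 1) (delta_mx 0 2) pf.
  rewrite -rE (@poly_ge0_rint_eq0 _ r 0 (1 - s - t)) ?horner0 //; first lra.
    by move=> v _; rewrite rE; apply: f0.
  by rewrite (funext rE) inner ?G0 //; lra.
have f_slab s t u : 0 < s < 2^-1 ->
    f (s *: delta_mx 0 0 + t *: delta_mx 0 1 + u *: delta_mx 0 2) = 0.
  move=> /andP[s0 s1].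
  have [r [_ rE _]] := polyfun_line (s *: delta_mx 0 0 + u *: delta_mx 0 2) (delta_mx 0 1) pf.
  have r0 : r = 0.
    apply: (@poly_eq0_near _ _ 0 2^-1); first by lra.
    by move=> v /andP[v0 v1]; rewrite rE addrAC f_strip //; lra.
  by have := rE t; rewrite r0 horner0 addrAC.
move=> x.
have [r [_ rE _]] := polyfun_line (x 0 1 *: delta_mx 0 1 + x 0 2 *: delta_mx 0 2) (delta_mx 0 0) pf.
have r0 : r = 0.
  apply: (@poly_eq0_near _ _ 0 2^-1); first by lra.
  by move=> v v01; rewrite rE addrC addrA f_slab.
have := rE (x 0 0); rewrite r0 horner0 => ->; congr f.
by apply/rowP; apply: forall_ord3; rewrite !mxE /=; ring.
Qed.

(** * Euler operator and Bernstein expansions *)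
Section Euler.
Context {R : realType} {n : nat}.
Implicit Types (f g : 'rV[R]_n.+1 -> R) (x : 'rV[R]_n.+1).

Lemma pd_polyfun0 f i x : polyfun 0 f -> pd i f x = 0.
Proof. exact: polyfun_derive_const. Qed.

Definition euler f x := \sum_i x 0 i * pd i f x.

Lemma polyfun_euler m f : polyfun m f -> polyfun m (euler f).
Proof.
move=> pf; apply: polyfun_sum => i _; case: m pf => [|m] pf.
  apply: polyfun_eq (polyfun0 _) => x; rewrite pd_polyfun0 //.
  by rewrite mulr0.
rewrite -[m.+1]add1n; apply: polyfunM; first exact: polyfun_coord.
exact: (polyfun_pd i pf).
Qed.

Lemma euler_coordM m f i x : polyfun m f ->
  euler (fun y => y 0 i * f y) x = x 0 i * f x + x 0 i * euler f x.
Proof.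
move=> pf; rewrite /euler.
under eq_bigr do rewrite (pdM _ _ (@polyfun_coord _ _ 1 i isT) pf) pd_coord mulrDr.
rewrite big_split /=; congr (_ + _); last first.
  by rewrite mulr_sumr; apply: eq_bigr => j _; rewrite mulrCA.
rewrite (bigD1 i) //= eqxx mul1r big1 ?addr0 // => j /negbTE ->.
by rewrite mul0r mulr0.
Qed.

Lemma eulerD m1 m2 f g x : polyfun m1 f -> polyfun m2 g ->
  euler (fun y => f y + g y) x = euler f x + euler g x.
Proof.
move=> pf pg; rewrite -big_split; apply: eq_bigr => i _ /=.
by rewrite (pdD _ _ pf pg) mulrDr.
Qed.

(** On homogeneous polynomials of degree d the left side is multiplication by d + k + 1, which is
    positive. The induction needs no homogeneous parts: if (E + k + 2) F = f then (E + k + 1)(x_i F)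
    = x_i f, which is why [k] is universally quantified. *)
Lemma euler_solve m f k : polyfun m f ->
  exists2 g, polyfun m g & forall x, euler g x + k.+1%:R * g x = f x.
Proof.
move=> pf; suff [_ /(_ k)] : polyfun m f /\ forall k, exists2 g, polyfun m g &
  forall x, euler g x + k.+1%:R * g x = f x by [].
move: m f pf {k}; apply: polyfun_rec.
- move=> c; split=> [|k]; first exact: polyfun_cst.
  exists (fun=> c / k.+1%:R); first exact: polyfun_cst.
  move=> x; rewrite /euler big1 ?add0r => [|i _]; last by rewrite pd_cst mulr0.
  by rewrite mulrC divfK // pnatr_eq0.
- move=> m f g [pf If] [pg Ig]; split=> [|k]; first exact: polyfunD.
  have [F pF FE] := If k; have [G pG GE] := Ig k.
  exists (fun x => F x + G x); first exact: polyfunD.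
  by move=> x; rewrite (eulerD _ pF pG) -FE -GE; ring.
- move=> m f [pf If]; split=> [|k]; first exact: polyfun_mono pf.
  by have [F pF FE] := If k; exists F => //; exact: polyfun_mono pF.
move=> m i f [pf If]; have pX := @polyfun_coord R n.+1 1 i isT.
split=> [|k]; first by rewrite -[m.+1]add1n; apply: polyfunM.
have [F pF FE] := If k.+1; exists (fun x => x 0 i * F x).
  by rewrite -[m.+1]add1n; apply: polyfunM.
by move=> x; rewrite (euler_coordM _ _ pF) -FE -[in RHS]natr1; ring.
Qed.

(** On the ray from 0 through [x] the equation becomes s p' + (k + 1) p = 0, so each coefficient
    satisfies (i + k + 1) p_i = 0. *)
Lemma euler_inj m g k : polyfun m g ->
  (forall x, euler g x + k.+1%:R * g x = 0) -> forall x, g x = 0.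
Proof.
move=> pg g0 x; have [p [_ pE dpE]] := polyfun_line 0 x pg.
have : 'X * p^`() + k.+1%:R *: p = 0.
  apply: (@poly_eq0_near _ _ 0 1) => // s _.
  rewrite hornerD hornerM hornerX hornerZ pE dpE (derive_pd _ _ pg) -[RHS](g0 (0 + s *: x)).
  rewrite /euler mulr_sumr; congr (_ + _); apply: eq_bigr => i _.
  by rewrite add0r mxE mulrA.
move=> /polyP E; have := pE 1; rewrite scale1r add0r => <-.
suff -> : p = 0 by rewrite horner0.
apply/polyP => i; have := E i; rewrite coefD coefXM coefZ !coef0.
case: i => [|i] /=; rewrite ?add0r ?coef_deriv => /eqP.
  by rewrite mulf_eq0 pnatr_eq0 => /eqP.
rewrite -[_ *+ _]mulr_natl -mulrDl mulf_eq0 -natrD pnatr_eq0 addnS /= => /eqP; exact.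
Qed.

End Euler.

Lemma digits_inj n M (a b : nat -> nat) : (forall i, a i < M)%N -> (forall i, b i < M)%N ->
  (\sum_(i < n) a i * M ^ i = \sum_(i < n) b i * M ^ i)%N ->
  forall i, (i < n)%N -> a i = b i.
Proof.
elim: n a b => [//|n IH] a b aM bM; rewrite !big_ord_recl !expn0 !muln1.
have E c : (\sum_(i < n) c (bump 0 i) * M ^ bump 0 i = M * \sum_(i < n) c i.+1 * M ^ i)%N.
  by rewrite big_distrr; apply: eq_bigr => i _ /=; rewrite /bump add1n expnS mulnCA.
rewrite !E; have M0 : (0 < M)%N by apply: leq_ltn_trans (aM 0%N).
move=> ab; have ab0 : a 0%N = b 0%N.
  have /(congr1 (fun k => k %% M)%N) := ab.
  by rewrite ![(M * _)%N]mulnC ![(_ + _ * M)%N]addnC !modnMDl !modn_small.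
move: ab; rewrite ab0 => /addnI/eqP; rewrite eqn_pmul2l // => /eqP ab.
by case=> [//|i]; rewrite ltnS => /(IH (fun i => a i.+1) (fun i => b i.+1)) -> //.
Qed.

(* Kronecker substitution: distinct exponents a give distinct powers of t. *)
Lemma kronecker_indep (R : realType) n m (c : {ffun 'I_n -> 'I_m.+1} -> R) :
  (forall t : R, 0 < t < 1 -> \sum_a c a * \prod_(i < n) (t ^+ (m.+1 ^ i)) ^+ a i = 0) -> forall a, c a = 0.
Proof.
move=> c0 a; pose N (b : {ffun 'I_n -> 'I_m.+1}) := (\sum_i b i * m.+1 ^ i)%N.
have N_inj : injective N.
  move=> b b' bb'; apply/ffunP => i; apply/val_inj.
  pose d (b : {ffun 'I_n -> 'I_m.+1}) (k : nat) : nat := if insub k is Some j then b j else 0.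
  have dE e (k : 'I_n) : d e k = e k by rewrite /d insubT //= => kn; congr (e _ : nat); apply: val_inj.
  rewrite /= -(dE b) -(dE b'); apply: (@digits_inj n m.+1 (d b) (d b')) => // [k|k|].
  - by rewrite /d; case: insub.
  - by rewrite /d; case: insub.
  transitivity (N b); first by apply: eq_bigr => k _; rewrite dE.
  by rewrite bb'; apply: eq_bigr => k _; rewrite dE.
pose p : {poly R} := \sum_b c b *: 'X^(N b).
have p0 : p = 0.
  apply: (@poly_eq0_near _ _ 0 1) => // t /c0 <-; rewrite horner_sum; apply: eq_bigr => b _.
  rewrite hornerZ hornerXn /N -prodrXr; congr (_ * _); apply: eq_bigr => i _.
  by rewrite -exprM mulnC.
have /polyP/(_ (N a)) := p0; rewrite /p coef_sum coef0 (bigD1 a) //=.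
rewrite coefZ coefXn eqxx mulr1 big1 ?addr0 // => b ba.
by rewrite coefZ coefXn (inj_eq N_inj) eq_sym (negbTE ba) mulr0.
Qed.

Lemma monomial_indep (R : realType) n m (c : {ffun 'I_n -> 'I_m.+1} -> R) :
  (forall x : 'rV[R]_n, \sum_a c a * \prod_i x 0 i ^+ a i = 0) -> forall a, c a = 0.
Proof.
move=> c0; apply: kronecker_indep => t _; rewrite -[RHS](c0 (\row_(i < n) t ^+ (m.+1 ^ i))).
by apply: eq_bigr => a _; congr (_ * _); apply: eq_bigr => i _; rewrite mxE.
Qed.

Section Bernstein.
Context {R : realType} {n : nat}.
Implicit Types (lam : 'I_n.+1 -> 'rV[R]_n -> R) (m : nat).

(** These four facts are all that the expansions use, so that the reference triangle and the
    tetrahedron share them. In [bary_point] the weights may be negative: the whole affine space is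
    covered. *)
Record barycentric lam : Prop := Barycentric {
  bary_poly : forall i, polyfun 1 (lam i);
  bary_sum : forall x, \sum_i lam i x = 1;
  bary_coord : forall j, exists k : 'I_n.+1 -> R, forall x : 'rV[R]_n, x 0 j = \sum_i k i * lam i x;
  bary_point : forall mu : 'I_n.+1 -> R, \sum_i mu i = 1 -> exists x : 'rV[R]_n, forall i, lam i x = mu i }.

Definition hindex m := [pred a : {ffun 'I_n.+1 -> 'I_m.+1} | (\sum_i (a i : nat) == m)%N].
(** The Bernstein form without multinomial factors: a homogeneous polynomial of degree [m] in the
    barycentric coordinates. *)
Definition bern lam m (c : {ffun 'I_n.+1 -> 'I_m.+1} -> R) x :=
  \sum_(a | hindex m a) c a * \prod_i lam i x ^+ a i.

Lemma bern_monomial lam (k : 'I_n.+1 -> nat) m : (\sum_i k i = m)%N ->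
  exists c, forall x, \prod_i lam i x ^+ k i = bern lam (m := m) c x.
Proof.
move=> km; have klt i : (k i < m.+1)%N.
  by rewrite ltnS -km (bigD1 i) //= leq_addr.
pose a0 : {ffun 'I_n.+1 -> 'I_m.+1} := [ffun i => Ordinal (klt i)].
exists (fun a => (a == a0)%:R) => x.
rewrite /bern (bigD1 a0) /=; last first.
  by rewrite -[X in _ == X]km; apply/eqP; apply: eq_bigr => i _; rewrite ffunE.
rewrite eqxx mul1r [X in _ + X]big1 ?addr0; first by apply: eq_bigr => i _; rewrite ffunE.
by move=> a /andP[_ /negbTE ->]; rewrite mul0r.
Qed.

Lemma bernD lam m (c c' : {ffun 'I_n.+1 -> 'I_m.+1} -> R) x :
  bern lam c x + bern lam c' x = bern lam (fun a => c a + c' a) x.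
Proof. by rewrite -big_split; apply: eq_bigr => a _; rewrite mulrDl. Qed.

Lemma bernZ lam m k (c : {ffun 'I_n.+1 -> 'I_m.+1} -> R) x :
  k * bern lam c x = bern lam (fun a => k * c a) x.
Proof. by rewrite mulr_sumr; apply: eq_bigr => a _; rewrite mulrA. Qed.

Lemma bern_sum lam m (I : Type) (r : seq I) (P : pred I) (F : I -> 'rV[R]_n -> R) :
  (forall i, P i -> exists c, forall x, F i x = bern lam (m := m) c x) ->
  exists c, forall x, \sum_(i <- r | P i) F i x = bern lam (m := m) c x.
Proof.
move=> pF; elim: r => [|i r [c IH]].
  by exists (fun=> 0) => x; rewrite big_nil /bern big1 // => a _; rewrite mul0r.
have [/[dup] Pi /pF[c' E]|nPi] := boolP (P i).
  by exists (fun a => c' a + c a) => x; rewrite big_cons Pi E IH bernD.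
by exists c => x; rewrite big_cons (negbTE nPi).
Qed.

Lemma bern_lamM lam m j (c : {ffun 'I_n.+1 -> 'I_m.+1} -> R) :
  exists c', forall x, lam j x * bern lam c x = bern lam (m := m.+1) c' x.
Proof.
have [a /eqP am|c' c'E] := bern_sum (lam := lam) (m := m.+1) (index_enum _) (P := hindex m)
    (F := fun a x => c a * (lam j x * \prod_i lam i x ^+ a i)).
  have [|c' c'E] := @bern_monomial lam (fun i => a i + (i == j))%N m.+1.
    rewrite big_split /= am (bigD1 j) //= eqxx big1 ?addn0 ?addn1 // => i /negbTE -> //.
  exists (fun b => c a * c' b) => x; rewrite -bernZ -c'E; congr (_ * _).
  rewrite (bigD1 j) // [RHS](bigD1 j) //= eqxx addn1 exprS mulrA; congr (_ * _).
  by apply: eq_bigr => i /negbTE ->; rewrite addn0.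
exists c' => x; rewrite -c'E mulr_sumr; apply: eq_bigr => a _.
by rewrite mulrCA.
Qed.

Lemma bern_repr lam m (f : 'rV[R]_n -> R) : barycentric lam -> polyfun m f ->
  exists c, forall x, f x = bern lam (m := m) c x.
Proof.
move=> B; move: m f; apply: polyfun_rec.
- move=> k; have [|c cE] := @bern_monomial lam (fun=> 0%N) 0; first by rewrite big1.
  exists (fun a => k * c a) => x; rewrite -bernZ -cE big1 ?mulr1 // => i _; exact: expr0.
- by move=> m f g [c fE] [c' gE]; exists (fun a => c a + c' a) => x; rewrite -bernD fE gE.
- move=> m f [c fE].
  (* Degree raising: the expansion is multiplied by the sum of the barycentric coordinates, which is
     1. *)
  have [j _|c' c'E] := bern_sum (lam := lam) (m := m.+1) (index_enum _)
     (P := xpredT) (F := fun j x => lam j x * bern lam c x); first exact: bern_lamM.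
  by exists c' => x; rewrite -c'E -mulr_suml (bary_sum B) mul1r fE.
move=> m i f [c fE]; have [k kE] := bary_coord B i.
have [j _|c' c'E] := bern_sum (lam := lam) (m := m.+1) (index_enum _)
     (P := xpredT) (F := fun j x => k j * lam j x * bern lam c x).
  have [d dE] := bern_lamM lam j c; exists (fun a => k j * d a) => x.
  by rewrite -bernZ -dE mulrA.
by exists c' => x; rewrite -c'E -mulr_suml -kE fE.
Qed.

(** The coefficients supported on the face where the coordinates in [Z] vanish are determined by the
    values on that face. On it the other coordinates are set to t^((m+1)^i) / S with S their
    normalizing sum; homogeneity of degree [m] clears S, and distinct exponents become distinct
    powers of t. *)
Lemma bern_eq0 lam m (c : {ffun 'I_n.+1 -> 'I_m.+1} -> R) (Z : pred 'I_n.+1) :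
  barycentric lam -> (exists j, ~~ Z j) ->
  (forall x, (forall i, 0 <= lam i x) -> (forall i, Z i -> lam i x = 0) -> bern lam c x = 0) ->
  forall a, hindex m a -> (forall i, Z i -> a i = 0) -> c a = 0.
Proof.
move=> B [j0 Zj0] c0 a am aZ.
pose face b := [&& hindex m b & [forall i, Z i ==> (b i == 0)]].
suff : (if face a then c a else 0) = 0.
  by rewrite /face am ifT //; apply/forallP => i; apply/implyP => /aZ ->.
move: a {am aZ}; apply: kronecker_indep => t /andP[t0 _].
pose y (i : 'I_n.+1) : R := if Z i then 0 else t ^+ (m.+1 ^ i).
pose S := \sum_i y i.
have y0 i : 0 <= y i by rewrite /y; case: ifP => // _; rewrite exprn_ge0 // ltW.
have S0 : 0 < S.
  by rewrite /S (bigD1 j0) //= ltr_wpDr ?sumr_ge0 // /y (negbTE Zj0) exprn_gt0.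
have [|x xE] := bary_point B (mu := fun i => y i / S).
  by rewrite -mulr_suml divff // gt_eqF.
transitivity (S ^+ m * bern lam c x); last first.
  rewrite c0 ?mulr0 // => i; first by rewrite xE divr_ge0 // ltW.
  by move=> Zi; rewrite xE /y Zi mul0r.
rewrite /bern mulr_sumr.
rewrite [RHS](bigID (fun b : {ffun 'I_n.+1 -> 'I_m.+1} => [forall i, Z i ==> (b i == 0)])) /=.
rewrite [X in _ = _ + X]big1 ?addr0 => [|b /andP[_ /forallPn[i]]]; last first.
  rewrite negb_imply => /andP[Zi bi]; rewrite (bigD1 i) //= xE /y Zi mul0r expr0n.
  by rewrite (negbTE (_ : (b i : nat) != 0%N)) ?mul0r ?mulr0.
rewrite (bigID face) /= [X in _ + X]big1 ?addr0 => [|b /negbTE ->]; last by rewrite mul0r.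
apply: eq_bigr => b fb; rewrite fb; move: fb => /andP[bm /forallP bZ].
rewrite mulrCA; congr (_ * _).
have -> : S ^+ m = \prod_i S ^+ b i by rewrite prodrXr (eqP bm).
rewrite -big_split /=; apply: eq_bigr => i _.
rewrite xE exprMn exprVn mulrCA mulfV ?expf_neq0 ?gt_eqF // mulr1.
by rewrite /y; case: ifP => // Zi; move: (bZ i); rewrite Zi => /eqP ->; rewrite !expr0.
Qed.

Lemma polyfun_bmono lam (k : 'I_n.+1 -> nat) : barycentric lam ->
  polyfun (\sum_i k i) (fun x => \prod_i lam i x ^+ k i).
Proof.
move=> B; have -> : (\sum_i k i = \sum_i k i * 1)%N by apply: eq_bigr => i _; rewrite muln1.
elim: (index_enum _) => [|i r IH].
  by rewrite big_nil; apply: polyfun_eq (polyfun_cst 0 1) => x; rewrite big_nil.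
rewrite big_cons; apply: polyfun_eq (polyfunM (polyfunX (k i) (bary_poly B i)) IH) => x.
by rewrite big_cons.
Qed.

(** Vanishing on the hyperplane [lam i = 0] kills every coefficient whose index is zero at [i]. Only
    indices positive everywhere remain, and their monomials are divisible by the product; below
    degree [n.+1] there are none and the function is zero. *)
Lemma bubble_factor lam m (f : 'rV[R]_n -> R) : (0 < n)%N -> barycentric lam -> polyfun m f ->
  (forall i x, lam i x = 0 -> f x = 0) ->
  exists2 g, polyfun (m - n.+1) g & forall x, f x = (\prod_i lam i x) * g x.
Proof.
move=> n0 B pf f0; have [c fE] := bern_repr B pf.
have c0 a i : hindex m a -> a i = 0 -> c a = 0.
  move=> am ai; apply: (bern_eq0 (Z := pred1 i) B) am _.
  (* Some index different from [i]; it exists because [n] is positive. *)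
  - exists (if i == 0 then ord_max else 0) => /=; case: ifP => [/eqP ->|] //=.
      by rewrite -val_eqE /= -lt0n.
    by rewrite eq_sym => /negbT.
  - by move=> x _ /(_ i) /=; rewrite eqxx => /(_ isT) /f0; rewrite -fE.
  by move=> j /eqP ->.
pose pos (a : {ffun 'I_n.+1 -> 'I_m.+1}) := [forall i, a i != 0].
exists (fun x => \sum_(a | hindex m a && pos a) c a * \prod_i lam i x ^+ (a i).-1).
  apply: polyfun_sum => a /andP[/eqP am /forallP apos]; apply: polyfunZ.
  have -> : (m - n.+1 = \sum_i (a i).-1)%N.
    rewrite -[X in (X - _)%N]am -[X in (_ - X)%N]card_ord -sum1_card -sumnB.
      by apply: eq_bigr => i _; rewrite subn1.
    by move=> i _; rewrite lt0n; exact: apos.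
  exact: (polyfun_bmono (fun i => (a i).-1) B).
move=> x; rewrite fE /bern (bigID pos) /= [X in _ + X]big1 ?addr0 => [|a].
  rewrite mulr_sumr; apply: eq_bigr => a /andP[_ /forallP apos].
  rewrite mulrCA -big_split; congr (_ * _); apply: eq_bigr => i _.
  by rewrite /= -exprS prednK // lt0n; exact: apos.
by move=> /andP[am /forallPn[i]]; rewrite negbK => /eqP ai; rewrite (c0 a i) ?mul0r.
Qed.

End Bernstein.

(** * Moment problems on the reference triangle *)
Local Opaque rint.

Section Polynomial.
Context {R : realType} {n : nat}.
Implicit Types (f g : 'rV[R]_n.+1 -> R) (x d : 'rV[R]_n.+1).

Definition is_polyfun f := exists m, polyfun m f.

Lemma is_polyfun_fun m f : polyfun m f -> is_polyfun f.
Proof. by exists m. Qed.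

Lemma is_polyfun_common f g : is_polyfun f -> is_polyfun g ->
  exists m, polyfun m f /\ polyfun m g.
Proof.
move=> [a pf] [b pg]; exists (maxn a b).
by split; [apply: polyfun_mono pf; exact: leq_maxl | apply: polyfun_mono pg; exact: leq_maxr].
Qed.

Lemma is_polyfun_cst (c : R) : is_polyfun (fun=> c).
Proof. by exists 0%N; exact: polyfun_cst. Qed.

Lemma is_polyfun_coord i : is_polyfun (fun x => x 0 i).
Proof. by exists 1%N; exact: polyfun_coord. Qed.

Lemma is_polyfunD f g : is_polyfun f -> is_polyfun g -> is_polyfun (fun x => f x + g x).
Proof.
by move=> pf pg; have [m [mf mg]] := is_polyfun_common pf pg; exists m; apply: polyfunD.
Qed.

Lemma is_polyfunN f : is_polyfun f -> is_polyfun (fun x => - f x).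
Proof. by move=> [m pf]; exists m; exact: polyfunN. Qed.

Lemma is_polyfunM f g : is_polyfun f -> is_polyfun g -> is_polyfun (fun x => f x * g x).
Proof. by move=> [a pf] [b pg]; exists (a + b)%N; exact: polyfunM. Qed.

Lemma is_polyfunX f k : is_polyfun f -> is_polyfun (fun x => f x ^+ k).
Proof. by move=> [m pf]; exists (k * m)%N; exact: polyfunX. Qed.

Lemma is_polyfun_pd f i : is_polyfun f -> is_polyfun (pd i f).
Proof. by move=> [m pf]; exists m.-1; exact: polyfun_pd. Qed.

Lemma pderD f g i x : is_polyfun f -> is_polyfun g ->
  pd i (fun y => f y + g y) x = pd i f x + pd i g x.
Proof. by move=> [a pf] [b pg]; exact: pdD pf pg. Qed.

Lemma pderN f i x : is_polyfun f -> pd i (fun y => - f y) x = - pd i f x.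
Proof. by move=> [a pf]; exact: pdN pf. Qed.

Lemma pderM f g i x : is_polyfun f -> is_polyfun g ->
  pd i (fun y => f y * g y) x = pd i f x * g x + f x * pd i g x.
Proof. by move=> [a pf] [b pg]; exact: pdM pf pg. Qed.

Lemma derive_along_eq0 f x d : is_polyfun f -> (forall s, 'D_d f (x + s *: d) = 0) ->
  forall s, f (x + s *: d) = f x.
Proof.
move=> [m pf] d0 s; have [p [_ pE dpE]] := polyfun_line x d pf.
have p'0 : p^`() = 0 by apply: (@poly_eq0_near _ _ 0 1) => // t _; rewrite dpE.
have -> : f x = p.[0] by rewrite pE scale0r addr0.
rewrite -pE; have [->|pn0] := eqVneq p 0; first by rewrite !horner0.
suff /size1_polyC -> : (size p <= 1)%N by rewrite !hornerC.
rewrite leqNgt; apply/negP => sp; have /polyP/(_ (size p).-2) := p'0.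
rewrite coef_deriv coef0 => /eqP; rewrite -mulr_natl mulf_eq0 pnatr_eq0 /=.
move: pn0; rewrite -lead_coef_eq0 /lead_coef => /negbTE.
have -> : (size p).-2.+1 = (size p).-1 by case: (size p) sp => [|[|k]].
by move=> ->.
Qed.

Lemma derive2_along_eq0 f x d : is_polyfun f ->
  (forall s, 'D_d (fun y => 'D_d f y) (x + s *: d) = 0) ->
  f x = 0 -> f (x + d) = 0 -> forall s, f (x + s *: d) = 0.
Proof.
move=> [m pf] d0 f0 f1; have pdf := is_polyfun_fun (polyfun_derive d pf).
have := derive_along_eq0 pdf d0; set k := 'D_d f x => dk s.
have [p [_ pE dpE]] := polyfun_line x d pf.
have : p = k *: 'X.
  have : (p - k *: 'X)^`() = 0.
    apply: (@poly_eq0_near _ _ 0 1) => // t _.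
    by rewrite derivB derivZ derivX hornerD hornerN hornerZ hornerC mulr1 dpE dk subrr.
  move=> q0; apply/polyP => -[|i].
    by rewrite coefZ coefX mulr0 -horner_coef0 pE scale0r addr0.
  move/polyP/(_ i): q0; rewrite coef_deriv coef0 coefB => /eqP.
  by rewrite -mulr_natl mulf_eq0 pnatr_eq0 /= subr_eq0 => /eqP.
move=> pk; have := pE 1; rewrite scale1r f1 pk hornerZ hornerX mulr1 => k0.
by rewrite -pE pk k0 scale0r horner0.
Qed.

End Polynomial.

Lemma derive_e0 (R : realType) (f : 'rV[R]_2 -> R) x : 'D_e0 f x = pd 0 f x.
Proof. by []. Qed.

Lemma derive_e1 (R : realType) (f : 'rV[R]_2 -> R) x : 'D_e1 f x = pd 1 f x.
Proof. by []. Qed.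

Lemma derive_e0Be1 (R : realType) (f : 'rV[R]_2 -> R) x : is_polyfun f ->
  'D_(e0 - e1) f x = pd 0 f x - pd 1 f x.
Proof.
by move=> [m pf]; have := derive_linear e0 e1 1 (-1) x pf; rewrite scale1r scaleN1r mul1r mulN1r.
Qed.

Local Opaque pd.

(** The rules for sums and products of derivatives hold only for polynomial operands; this tactic
    discharges such conditions by syntax for [pd_tac]. *)
Ltac pf_tac := lazymatch goal with
  | |- is_polyfun (fun _ => ?k) => exact (is_polyfun_cst k)
  | |- is_polyfun (fun y => fun_of_matrix y _ ?i) => exact (is_polyfun_coord i)
  | |- is_polyfun (fun y => @?a y + @?b y) => apply (@is_polyfunD _ _ a b); pf_tac
  | |- is_polyfun (fun y => - @?a y) => apply (@is_polyfunN _ _ a); pf_tac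
  | |- is_polyfun (fun y => @?a y * @?b y) => apply (@is_polyfunM _ _ a b); pf_tac
  | |- is_polyfun (fun y => @?a y ^+ ?k) => apply (@is_polyfunX _ _ a k); pf_tac
  | |- is_polyfun (fun y => pd ?i ?a y) => apply (@is_polyfun_pd _ _ a i); pf_tac
  | |- is_polyfun (pd ?i ?a) => apply (@is_polyfun_pd _ _ a i); pf_tac
  | |- is_polyfun (fun y => ?a y) => change (is_polyfun a); pf_tac
  | |- _ => assumption
  end.

Ltac pd_tac := repeat match goal with
  | |- context [pd ?i (fun _ => ?k) ?x] => rewrite (pd_cst i k x)
  | |- context [pd ?i (fun y => fun_of_matrix y _ ?j) ?x] => rewrite (pd_coord i j x)
  | |- context [pd ?i (fun y => @?a y + @?b y) ?x] =>
      rewrite (@pderD _ _ a b i x); [cbv beta | solve [cbv beta; pf_tac] | solve [cbv beta; pf_tac]]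
  | |- context [pd ?i (fun y => - @?a y) ?x] =>
      rewrite (@pderN _ _ a i x); [cbv beta | solve [cbv beta; pf_tac]]
  | |- context [pd ?i (fun y => @?a y * @?b y) ?x] =>
      rewrite (@pderM _ _ a b i x); [cbv beta | solve [cbv beta; pf_tac] | solve [cbv beta; pf_tac]]
  | |- context [pd ?i (fun y => ?a y) ?x] => change (pd i (fun y => a y) x) with (pd i a x)
  end.

(* The ring tactic compares atoms up to conversion, which is costly on derivatives: abstract them. *)
Ltac pd_ring := repeat match goal with
  | |- context [pd ?i ?f ?x] => let h := fresh "d" in generalize (pd i f x) => h
  end; repeat match goal with
  | |- context [fun_of_matrix ?x ?i ?j] => let h := fresh "d" in generalize (fun_of_matrix x i j) => h
  end; ring.

(** * Potentials of plane polynomial fields *)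

Section PlanePotentials.
Context {R : realType}.
Implicit Types (f g w : 'rV[R]_2 -> R) (x : 'rV[R]_2).

Lemma euler2 f x : euler f x = x 0 0 * pd 0 f x + x 0 1 * pd 1 f x.
Proof. by rewrite /euler big_ord_recl big_ord1; congr (_ + x 0 _ * pd _ f x); apply: val_inj. Qed.

Lemma pd_euler f i x : is_polyfun f -> pd i (euler f) x = pd i f x + euler (pd i f) x.
Proof.
move=> pf; have -> : euler f = fun y => y 0 0 * pd 0 f y + y 0 1 * pd 1 f y.
  by apply/funext => y; exact: euler2.
case: (pf) => m mf; pd_tac; rewrite euler2 (pd_schwarz 0 i mf) (pd_schwarz 1 i mf).
by move: i; apply: forall_ord2; rewrite /=; pd_ring.
Qed.

(** The Poincare lemma with a polynomial homotopy. Solve (E + 1) W_i = w_i; then (E + 2) rot W = rot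
    w = 0, so rot W = 0, and the derivative of x . W in direction i is W_i + E W_i = w_i. *)
Lemma grad_potential m w0 w1 : polyfun m w0 -> polyfun m w1 ->
  (forall x, pd 1 w0 x = pd 0 w1 x) ->
  exists f, [/\ polyfun m.+1 f, forall x, pd 0 f x = w0 x & forall x, pd 1 f x = w1 x].
Proof.
move=> pw0 pw1 rot0.
have [W0 pW0 W0E] := euler_solve 0 pw0; have [W1 pW1 W1E] := euler_solve 0 pw1.
have [Z0 Z1] := (is_polyfun_fun pW0, is_polyfun_fun pW1).
have [y0 y1] := (is_polyfun_fun (polyfun_euler pW0), is_polyfun_fun (polyfun_euler pW1)).
have rotW x : pd 1 W0 x - pd 0 W1 x = 0.
  apply: (@euler_inj _ _ m.-1 (fun x => pd 1 W0 x - pd 0 W1 x) 1%N).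
    by apply: polyfunB; exact: polyfun_pd.
  move=> y; have := rot0 y.
  rewrite -(funext W0E) -(funext W1E); pd_tac; rewrite !pd_euler //.
  rewrite !euler2; pd_tac => /eqP; rewrite -subr_eq0 => /eqP E; rewrite -[RHS]E.
  by pd_ring.
exists (fun x => x 0 0 * W0 x + x 0 1 * W1 x); split.
- by apply: polyfunD; rewrite -[X in polyfun X]add1n; apply: polyfunM => //; exact: polyfun_coord.
- move=> x; pd_tac; rewrite -W0E euler2; have := rotW x => /eqP; rewrite subr_eq0 => /eqP ->.
  by rewrite /=; pd_ring.
- move=> x; pd_tac; rewrite -W1E euler2; have := rotW x => /eqP; rewrite subr_eq0 => /eqP <-.
  by rewrite /=; pd_ring.
Qed.

End PlanePotentials.

Section ReferenceTriangle.
Context {R : realType}.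
Variable c : 'rV[R]_2.
Implicit Types (f g p q r w : 'rV[R]_2 -> R) (x : 'rV[R]_2).

Definition tri_lam (i : 'I_3) x : R :=
  if i == 0 then 1 - (x 0 0 - c 0 0) - (x 0 1 - c 0 1)
  else if i == 1 then x 0 0 - c 0 0 else x 0 1 - c 0 1.

Lemma tri_lam_poly i : polyfun 1 (tri_lam i).
Proof.
have p0 := polyfunB (@polyfun_coord R 2 1 0 isT) (polyfun_cst 1 (c 0 0)).
have p1 := polyfunB (@polyfun_coord R 2 1 1 isT) (polyfun_cst 1 (c 0 1)).
by move: i; apply: forall_ord3 => //; exact: polyfunB (polyfunB (polyfun_cst 1 1) p0) p1.
Qed.

Lemma big_ord3 (F : 'I_3 -> R) : \sum_i F i = F 0 + F 1 + F 2.
Proof.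
rewrite !big_ord_recl big_ord0 addr0 addrA.
by congr (F _ + F _ + F _); apply: val_inj.
Qed.

Lemma tri_lam_barycentric : barycentric tri_lam.
Proof.
split.
- exact: tri_lam_poly.
- by move=> x; rewrite big_ord3 /tri_lam /=; ring.
- move=> j; exists (fun i => c 0 j + (i == 1)%:R * (j == 0)%:R + (i == 2)%:R * (j == 1)%:R) => x.
  by rewrite big_ord3 /tri_lam /=; move: j; apply: forall_ord2; rewrite /=; ring.
- move=> mu; rewrite big_ord3 => mu1.
  exists (\row_j (c 0 j + (if j == 0 then mu 1 else mu 2))).
  by apply: forall_ord3; rewrite /tri_lam /= !mxE /=; lra.
Qed.

Definition bubble x := tri_lam 0 x * tri_lam 1 x * tri_lam 2 x.

Lemma bubble_is_polyfun : is_polyfun bubble.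
Proof.
have p i := is_polyfun_fun (tri_lam_poly i).
by apply: is_polyfunM => //; apply: is_polyfunM.
Qed.

Lemma bubble_eq0 i x : tri_lam i x = 0 -> bubble x = 0.
Proof.
by rewrite /bubble; move: i; apply: forall_ord3 => ->; rewrite ?(mul0r, mulr0).
Qed.

Lemma bubble_factor2 m f : polyfun m f -> (forall i x, tri_lam i x = 0 -> f x = 0) ->
  exists2 g, polyfun (m - 3) g & forall x, f x = bubble x * g x.
Proof.
move=> pf f0; have [g pg gE] := bubble_factor (ltn0Sn 1) tri_lam_barycentric pf f0.
exists g => // x; rewrite gE /bubble !big_ord_recl big_ord0 mulr1 mulrA.
by congr (tri_lam _ x * tri_lam _ x * tri_lam _ x * _); apply: val_inj.
Qed.

Lemma bubble_moment_eq0 q : is_polyfun q -> (forall x, 0 <= q x) ->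
  tint c (fun x => bubble x * q x) = 0 -> forall x, q x = 0.
Proof.
move=> [m pq] q0 I0; have [mb pb] := bubble_is_polyfun.
have bq0 : forall x, bubble x * q x = 0.
  apply: (tint_ge0_eq0 (c := c) (polyfunM pb pq)) I0 => s t s0 t0 st.
  rewrite mulr_ge0 // /bubble /tri_lam /= !mxE /= !mulr_ge0 //; lra.
apply: (polyfun_mul_eq0 pb pq bq0).
(* At this interior point the barycentric coordinates are 1/2, 1/4, 1/4, so the bubble is not
   zero. *)
exists (\row_j (c 0 j + 4^-1)); rewrite /bubble /tri_lam /= !mxE !mulf_neq0 // gt_eqF //; lra.
Qed.

Lemma tint_add f g : is_polyfun f -> is_polyfun g ->
  tint c (fun x => f x + g x) = tint c f + tint c g.
Proof. by move=> [a pf] [b pg]; exact: tintD pf pg. Qed.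

Lemma tint_opp f : is_polyfun f -> tint c (fun x => - f x) = - tint c f.
Proof.
move=> [a pf]; rewrite -mulN1r -(tintZ _ _ pf); congr tint.
by apply/funext => x; rewrite mulN1r.
Qed.

Lemma tri_lam_edge0 s : tri_lam 0 (c + e1 + s *: (e0 - e1)) = 0.
Proof. by rewrite /tri_lam /= !mxE /=; ring. Qed.
Lemma tri_lam_edge1 s : tri_lam 1 (c + s *: e1) = 0.
Proof. by rewrite /tri_lam /= !mxE /=; ring. Qed.
Lemma tri_lam_edge2 s : tri_lam 2 (c + s *: e0) = 0.
Proof. by rewrite /tri_lam /= !mxE /=; ring. Qed.

Lemma tri_edgeP i x : tri_lam i x = 0 ->
  exists s, x = [:: c + e1 + s *: (e0 - e1); c + s *: e1; c + s *: e0]`_i.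
Proof.
move: i; apply: forall_ord3; rewrite /tri_lam /= => E.
- exists (x 0 0 - c 0 0); apply/rowP; apply: forall_ord2; rewrite !mxE /=; lra.
- exists (x 0 1 - c 0 1); apply/rowP; apply: forall_ord2; rewrite !mxE /=; lra.
- exists (x 0 0 - c 0 0); apply/rowP; apply: forall_ord2; rewrite !mxE /=; lra.
Qed.

Lemma tint_div_eq0 f g : is_polyfun f -> is_polyfun g ->
  (forall x, tri_lam 1 x = 0 -> f x = 0) -> (forall x, tri_lam 2 x = 0 -> g x = 0) ->
  (forall x, tri_lam 0 x = 0 -> f x + g x = 0) ->
  tint c (fun x => pd 0 f x + pd 1 g x) = 0.
Proof.
move=> [a pf] [b pg] f0 g0 fg0; rewrite (tint_div _ pf pg).
do 3 (rewrite (@eq_rint _ _ _ _ (fun=> 0)); last by move=> s _; first [apply: f0 | apply: g0 | apply: fg0]; rewrite ?tri_lam_edge0 ?tri_lam_edge1 ?tri_lam_edge2).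
by rewrite rint_0 !subr0.
Qed.

Lemma rint_derive_eq0 f u x d : is_polyfun u ->
  (forall s, f (x + s *: d) = 'D_d u (x + s *: d)) -> u x = 0 -> u (x + d) = 0 ->
  rint 0 1 (fun s => f (x + s *: d)) = 0.
Proof.
move=> [m pu] fE u0 u1; rewrite (eq_rint (g := fun s => 'D_d u (x + s *: d))) => [|s _] //.
by rewrite (rint_line _ _ ler01 pu) scale0r scale1r addr0 u0 u1 subrr.
Qed.

Lemma rot_moments_eq0 l g0 g1 : (3 <= l)%N -> polyfun l.+1 g0 -> polyfun l.+1 g1 ->
  (forall x, tri_lam 1 x = 0 -> g0 x = 0) -> (forall x, tri_lam 2 x = 0 -> g1 x = 0) ->
  (forall x, tri_lam 0 x = 0 -> g0 x + g1 x = 0) ->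
  (forall i x, tri_lam i x = 0 -> pd 0 g0 x + pd 1 g1 x = 0) ->
  (forall p, polyfun (l - 3) p -> tint c (fun x => g0 x * pd 0 p x + g1 x * pd 1 p x) = 0) ->
  (forall r, polyfun (l - 1) r -> tint c (fun x => (x 0 0 * g1 x - x 0 1 * g0 x) * r x) = 0) ->
  forall x, g0 x = 0 /\ g1 x = 0.
Proof.
move=> l3 pg0 pg1 g00 g10 g010 div0 I1 I2.
have G0 := is_polyfun_fun pg0; have G1 := is_polyfun_fun pg1; have B := bubble_is_polyfun.
have [q pq qE] : exists2 q, polyfun (l - 3) q & forall x, pd 0 g0 x + pd 1 g1 x = bubble x * q x.
  by apply: bubble_factor2 div0; exact: polyfunD (polyfun_pd 0 pg0) (polyfun_pd 1 pg1).
have Q := is_polyfun_fun pq.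
have q0 x : q x ^+ 2 = 0.
  move: x; apply: bubble_moment_eq0 => [|x|]; [by pf_tac | exact: sqr_ge0 |].
  have <- : tint c (fun x => pd 0 (fun y => q y * g0 y) x + pd 1 (fun y => q y * g1 y) x) = 0.
    apply: tint_div_eq0 => [||x /g00 ->|x /g10 ->|x /g010 E]; rewrite ?mulr0 -?mulrDr ?E ?mulr0 //;
      by pf_tac.
  transitivity (tint c (fun x => (g0 x * pd 0 q x + g1 x * pd 1 q x) + bubble x * q x ^+ 2)).
    by rewrite tint_add ?I1 ?add0r //; pf_tac.
  congr tint; apply/funext => x; pd_tac; have := qE x => E.
  by rewrite expr2 mulrA -E; pd_ring.
have d0 x : pd 0 g0 x + pd 1 g1 x = 0.
  by rewrite qE; move/eqP: (q0 x); rewrite sqrf_eq0 => /eqP ->; rewrite mulr0.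
(* A stream function of the divergence-free field; zero flux through the edges makes it constant
   along the boundary. *)
have [|psi [ppsi psi0 psi1]] := grad_potential pg1 (polyfunN pg0).
  by move=> x; pd_tac; have := d0 x; rewrite addrC => /eqP; rewrite addr_eq0 => /eqP.
have PSI := is_polyfun_fun ppsi.
have edge1 s : psi (c + s *: e1) = psi c.
  apply: derive_along_eq0 => // t; rewrite derive_e1 psi1 g00 ?oppr0 //.
  exact: tri_lam_edge1.
have edge2 s : psi (c + s *: e0) = psi c.
  apply: derive_along_eq0 => // t; rewrite derive_e0 psi0 g10 //.
  exact: tri_lam_edge2.
have edge0 s : psi (c + e1 + s *: (e0 - e1)) = psi c.
  rewrite -(edge1 1) scale1r; apply: derive_along_eq0 => // t.
  by rewrite derive_e0Be1 // psi0 psi1 opprK addrC g010 // tri_lam_edge0.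
have [k pk kE] : exists2 k, polyfun (l.+2 - 3) k & forall x, psi x - psi c = bubble x * k x.
  apply: bubble_factor2; first by apply: polyfunB => //; exact: polyfun_cst.
  move=> i x /tri_edgeP[s ->]; apply/eqP; rewrite subr_eq0; apply/eqP.
  by move: i; apply: forall_ord3; [exact: edge0 | exact: edge1 | exact: edge2].
have K := is_polyfun_fun pk.
have k0 x : k x ^+ 2 = 0.
  move: x; apply: bubble_moment_eq0 => [|x|]; [by pf_tac | exact: sqr_ge0 |].
  (* The moment against [r] is the integral of (x . grad psi) r. Integration by parts turns it into
     minus the integral of (psi - psi(c)) (E + 2) r, where 2 is the divergence of x. Choosing (E +
     2) r = k leaves minus the integral of bubble k^2. *)
  have [r pr rE] := euler_solve 1 pk; have RR := is_polyfun_fun pr.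
  rewrite (_ : l.+2 - 3 = l - 1)%N in pr; last lia.
  pose F0 (x : 'rV[R]_2) := x 0 0 * ((psi x - psi c) * r x).
  pose F1 (x : 'rV[R]_2) := x 0 1 * ((psi x - psi c) * r x).
  have F_eq0 i x : tri_lam i x = 0 -> psi x - psi c = 0 by rewrite kE => /bubble_eq0 ->; rewrite mul0r.
  have : tint c (fun x => pd 0 F0 x + pd 1 F1 x) = 0.
    apply: tint_div_eq0; rewrite /F0 /F1; first by pf_tac.
    - by pf_tac.
    - by move=> x /F_eq0 ->; rewrite mul0r mulr0.
    - by move=> x /F_eq0 ->; rewrite mul0r mulr0.
    - by move=> x /F_eq0 ->; rewrite mul0r !mulr0 addr0.
  rewrite (_ : (fun x => _) = fun x => (x 0 0 * g1 x - x 0 1 * g0 x) * r x + bubble x * k x ^+ 2).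
    by rewrite tint_add ?I2 ?add0r //; pf_tac.
  apply/funext => x; rewrite /F0 /F1; pd_tac; rewrite psi0 psi1.
  have -> : bubble x * k x ^+ 2 = (psi x - psi c) * k x by rewrite kE expr2 mulrA.
  by rewrite -rE euler2 /=; pd_ring.
have psi_cst : psi = fun=> psi c.
  apply/funext => x; apply/eqP; rewrite -subr_eq0 kE.
  by move/eqP: (k0 x); rewrite sqrf_eq0 => /eqP ->; rewrite mulr0.
move=> x; have := psi0 x; have := psi1 x; rewrite psi_cst !pd_cst => /esym/eqP.
by rewrite oppr_eq0 => /eqP -> <-.
Qed.

(* Solves div (sym (x w)) = f / 2; taking the divergence first decouples the system into
   Euler equations for div w and then for each component of w. *)
Lemma div_sym_position_solve m f0 f1 : (0 < m)%N -> polyfun m f0 -> polyfun m f1 ->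
  exists w0 w1, [/\ polyfun m w0, polyfun m w1,
    forall x, 2 * pd 0 (fun y => y 0 0 * w0 y) x
              + pd 1 (fun y => y 0 0 * w1 y + y 0 1 * w0 y) x = f0 x
    & forall x, pd 0 (fun y => y 0 0 * w1 y + y 0 1 * w0 y) x
              + 2 * pd 1 (fun y => y 0 1 * w1 y) x = f1 x].
Proof.
move=> m0 pf0 pf1.
(* Expanded, the system is (E + 3) w_i + y_i div w = f_i, and its divergence is 2 (E + 3) div w =
   div f. So [u] is the prospective divergence of w. *)
have [u pu uE] := euler_solve 2 (polyfunZ 2^-1 (polyfunD (polyfun_pd 0 pf0) (polyfun_pd 1 pf1))).
have pXu i : polyfun m (fun x => x 0 i * u x).
  by rewrite -[X in polyfun X](prednK m0) -[X in polyfun X]add1n; apply: polyfunM => //; exact: polyfun_coord.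
have [w0 pw0 w0E] := euler_solve 2 (polyfunB pf0 (pXu 0)).
have [w1 pw1 w1E] := euler_solve 2 (polyfunB pf1 (pXu 1)).
have [F0 F1] := (is_polyfun_fun pf0, is_polyfun_fun pf1).
have [W0 W1] := (is_polyfun_fun pw0, is_polyfun_fun pw1); have U := is_polyfun_fun pu.
have EW0 := is_polyfun_fun (polyfun_euler pw0); have EW1 := is_polyfun_fun (polyfun_euler pw1).
(* The equations for w_i and [u] combine to (E + 4)(div w - u) = 0. *)
have divw x : pd 0 w0 x + pd 1 w1 x - u x = 0.
  move: x; apply: (@euler_inj _ _ m.-1 (fun x => pd 0 w0 x + pd 1 w1 x - u x) 3).
    exact: polyfunB (polyfunD (polyfun_pd 0 pw0) (polyfun_pd 1 pw1)) pu.
  move=> x; have := congr1 (fun h => pd 0 h x) (funext w0E).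
  have := congr1 (fun h => pd 1 h x) (funext w1E).
  pd_tac; rewrite !pd_euler // !euler2; pd_tac => E1 E0; have := uE x; rewrite !euler2.
  rewrite /= in E0 E1 *.
  move: E0 E1; do !(match goal with
    |- context [pd ?i ?f ?x] => let h := fresh "d" in generalize (pd i f x) => h end).
  by move: (x 0 0) (x 0 1) (u x) (w0 x) (w1 x) => a b v v0 v1 E0 E1 E2; lra.
exists w0, w1; split=> // x; have := divw x.
- have := w0E x; rewrite euler2; pd_tac; rewrite /=.
  do !(match goal with
    |- context [pd ?i ?f ?x] => let h := fresh "d" in generalize (pd i f x) => h end).
  move=> E /eqP; rewrite subr_eq0 => /eqP Eu; rewrite -Eu in E.
  by apply/eqP; rewrite -subr_eq0; move/eqP: E; rewrite -subr_eq0 => /eqP E; rewrite -[X in _ == X]E;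
    apply/eqP; ring.
- have := w1E x; rewrite euler2; pd_tac; rewrite /=.
  do !(match goal with
    |- context [pd ?i ?f ?x] => let h := fresh "d" in generalize (pd i f x) => h end).
  move=> E /eqP; rewrite subr_eq0 => /eqP Eu; rewrite -Eu in E.
  by apply/eqP; rewrite -subr_eq0; move/eqP: E; rewrite -subr_eq0 => /eqP E; rewrite -[X in _ == X]E;
    apply/eqP; ring.
Qed.

Section Symmetric.
Variables (l : nat) (N00 N01 N11 : 'rV[R]_2 -> R).
Hypotheses (l3 : (3 <= l)%N) (pN00 : polyfun l.+1 N00) (pN01 : polyfun l.+1 N01)
  (pN11 : polyfun l.+1 N11).
Hypothesis N_vertex : forall x, x \in [:: c; c + e0; c + e1] -> [/\ N00 x = 0, N01 x = 0 & N11 x = 0].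
(** On each edge, with t its tangent and a a transversal direction, the conditions are N(t, t) = 0
    and 2 D_t N(t, a) = D_a N(t, t). Here a is [e0] on edges 0 and 1 and [e1] on edge 2; adding a
    multiple of t to a changes nothing, since N(t, t) vanishes along the edge. *)
Hypothesis N_edge1 : forall x, tri_lam 1 x = 0 -> N11 x = 0 /\ 2 * pd 1 N01 x = pd 0 N11 x.
Hypothesis N_edge2 : forall x, tri_lam 2 x = 0 -> N00 x = 0 /\ 2 * pd 0 N01 x = pd 1 N00 x.
Hypothesis N_edge0 : forall x, tri_lam 0 x = 0 -> N00 x - 2 * N01 x + N11 x = 0 /\
  2 * (pd 0 N00 x - pd 0 N01 x - pd 1 N00 x + pd 1 N01 x) = pd 0 N00 x - 2 * pd 0 N01 x + pd 0 N11 x.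

Lemma rotrot_eq0 :
  (forall p, polyfun (l - 1) p -> tint c (fun x =>
     N11 x * pd 0 (pd 0 p) x - 2 * N01 x * pd 0 (pd 1 p) x + N00 x * pd 1 (pd 1 p) x) = 0) ->
  forall x, pd 0 (pd 0 N11) x - 2 * pd 0 (pd 1 N01) x + pd 1 (pd 1 N00) x = 0.
Proof.
move=> I1; pose rr (x : 'rV[R]_2) := pd 0 (pd 0 N11) x - 2 * pd 0 (pd 1 N01) x + pd 1 (pd 1 N00) x.
have prr : polyfun (l - 1) rr.
  have P2 i j (f : 'rV[R]_2 -> R) : polyfun l.+1 f -> polyfun (l - 1) (pd i (pd j f)).
    by rewrite subn1 => pf; exact: (polyfun_pd i (polyfun_pd j pf)).
  exact: polyfunD (polyfunB (P2 _ _ _ pN11) (polyfunZ 2 (P2 _ _ _ pN01))) (P2 _ _ _ pN00).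
have T0 := is_polyfun_fun pN00.
have T1 := is_polyfun_fun pN01; have T2 := is_polyfun_fun pN11.
suff rr0 : forall x, rr x ^+ 2 = 0 by move=> x; apply/eqP; rewrite -(sqrf_eq0 (rr x)) rr0.
have rrE x : pd 0 (pd 0 N11) x - 2 * pd 0 (pd 1 N01) x + pd 1 (pd 1 N00) x = rr x by [].
move: rr rrE prr => rr rrE prr; have RR := is_polyfun_fun prr.
have prr2 := polyfunX 2 prr.
apply: (tint_ge0_eq0 (c := c) prr2) => [s t _ _ _|]; first exact: sqr_ge0.
(* The flux of Green's formula for rot rot: its divergence is the contraction of N with the rotated
   second derivatives of [rr], minus [rr ^+ 2]. By the edge conditions its flux density on each edge
   is a tangential derivative of minus N(t, a) [rr] up to sign, which is zero at the vertices, so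
   the total flux vanishes. *)
pose h0 (x : 'rV[R]_2) := N11 x * pd 0 rr x - N01 x * pd 1 rr x - rr x * (pd 0 N11 x - pd 1 N01 x).
pose h1 (x : 'rV[R]_2) := N00 x * pd 1 rr x - N01 x * pd 0 rr x - rr x * (pd 1 N00 x - pd 0 N01 x).
have H0 : is_polyfun h0 by rewrite /h0; pf_tac.
have H1 : is_polyfun h1 by rewrite /h1; pf_tac.
have [v0 v1 v2] : [/\ c \in [:: c; c + e0; c + e1], c + e0 \in [:: c; c + e0; c + e1]
                    & c + e1 \in [:: c; c + e0; c + e1]].
  by rewrite !inE !eqxx !orbT.
have divh : tint c (fun x => pd 0 h0 x + pd 1 h1 x) = 0.
  have [[m0 ph0] [m1 ph1]] := (H0, H1); rewrite (tint_div _ ph0 ph1).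
  rewrite (rint_derive_eq0 (f := fun x => h0 x + h1 x) (u := fun x => - ((N00 x - N01 x) * rr x))).
  - rewrite (rint_derive_eq0 (f := h0) (u := fun x => - (N01 x * rr x))).
    + rewrite (rint_derive_eq0 (f := h1) (u := fun x => - (N01 x * rr x))); first by rewrite !subr0.
      * by pf_tac.
      * move=> s; have := N_edge2 (tri_lam_edge2 s); set y := c + s *: e0 => -[E0 E1].
        rewrite derive_e0 /h1; pd_tac; rewrite E0 -E1; pd_ring.
      * by case: (N_vertex v0) => _ -> _; rewrite mul0r oppr0.
      * by case: (N_vertex v1) => _ -> _; rewrite mul0r oppr0.
    + by pf_tac.
    + move=> s; have := N_edge1 (tri_lam_edge1 s); set y := c + s *: e1 => -[E0 E1].
      rewrite derive_e1 /h0; pd_tac; rewrite E0 -E1; pd_ring.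
    + by case: (N_vertex v0) => _ -> _; rewrite mul0r oppr0.
    + by case: (N_vertex v2) => _ -> _; rewrite mul0r oppr0.
  - by pf_tac.
  - move=> s; have := N_edge0 (tri_lam_edge0 s); set y := c + e1 + s *: (e0 - e1) => -[E0 E1].
    rewrite derive_e0Be1; last by pf_tac.
    rewrite /h0 /h1; pd_tac.
    have {E0} -> : N11 y = 2 * N01 y - N00 y by lra.
    have {E1} -> : pd 0 N11 y = 2 * (pd 0 N00 y - pd 0 N01 y - pd 1 N00 y + pd 1 N01 y)
       - pd 0 N00 y + 2 * pd 0 N01 y by rewrite E1; pd_ring.
    by pd_ring.
  - by case: (N_vertex v2) => -> -> _; rewrite subrr mul0r oppr0.
  - rewrite [c + e1 + _](_ : _ = c + e0); last by apply/rowP => i; rewrite !mxE; ring.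
    by case: (N_vertex v1) => -> -> _; rewrite subrr mul0r oppr0.
have S2 : tint c (fun x => pd 0 h0 x + pd 1 h1 x + rr x ^+ 2) = 0.
  rewrite -[RHS](I1 rr prr); congr tint; apply/funext => x; rewrite /h0 /h1; pd_tac.
  rewrite (pd_schwarz 1 0 prr) (pd_schwarz 1 0 pN01).
  have -> : rr x ^+ 2 = rr x * (pd 0 (pd 0 N11) x - 2 * pd 0 (pd 1 N01) x + pd 1 (pd 1 N00) x).
    by rewrite rrE expr2.
  by pd_ring.
by move: S2; rewrite tint_add ?divh ?add0r //; pf_tac.
Qed.

(** The construction is that of plane elasticity. A strain N with rot rot N = 0 has an infinitesimal
    rotation [om], and N plus the skew matrix of [om] is the gradient of a displacement [phi0],
    [phi1]. The edge conditions determine the displacement on the boundary up to a rigid motion. *)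
Lemma sym_moments_eq0 :
  (forall p, polyfun (l - 1) p -> tint c (fun x =>
     N11 x * pd 0 (pd 0 p) x - 2 * N01 x * pd 0 (pd 1 p) x + N00 x * pd 1 (pd 1 p) x) = 0) ->
  (forall w0 w1, polyfun (l - 1) w0 -> polyfun (l - 1) w1 -> tint c (fun x =>
     N00 x * (x 0 0 * w0 x) + N01 x * (x 0 0 * w1 x + x 0 1 * w0 x) + N11 x * (x 0 1 * w1 x)) = 0) ->
  forall x, [/\ N00 x = 0, N01 x = 0 & N11 x = 0].
Proof.
move=> I1 I2; have rr0 := rotrot_eq0 I1.
have T00 := is_polyfun_fun pN00; have T01 := is_polyfun_fun pN01.
have T11 := is_polyfun_fun pN11.
have [|om [pom om0 om1]] := grad_potential
    (w0 := fun x => pd 0 N01 x - pd 1 N00 x) (w1 := fun x => pd 0 N11 x - pd 1 N01 x)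
    (polyfunB (polyfun_pd 0 pN01) (polyfun_pd 1 pN00))
    (polyfunB (polyfun_pd 0 pN11) (polyfun_pd 1 pN01)).
  move=> x; pd_tac; rewrite (pd_schwarz 1 0 pN01); have := rr0 x.
  by move: (pd 0 (pd 0 N11) x) (pd 0 (pd 1 N01) x) (pd 1 (pd 1 N00) x) => A B C; lra.
have Om := is_polyfun_fun pom.
have [|phi0 [pphi0 f00 f01]] := grad_potential pN00 (polyfunB pN01 pom).
  by move=> x; pd_tac; rewrite om0 opprB addrC subrK.
have [|phi1 [pphi1 f10 f11]] := grad_potential (polyfunD pN01 pom) pN11.
  by move=> x; pd_tac; rewrite om1 addrC subrK.
have [Phi0 Phi1] := (is_polyfun_fun pphi0, is_polyfun_fun pphi1).
have phi0_edge2 s : phi0 (c + s *: e0) = phi0 c.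
  apply: derive_along_eq0 => // t; rewrite derive_e0 f00.
  by case: (N_edge2 (tri_lam_edge2 t)).
have phi1_edge1 s : phi1 (c + s *: e1) = phi1 c.
  apply: derive_along_eq0 => // t; rewrite derive_e1 f11.
  by case: (N_edge1 (tri_lam_edge1 t)).
have ce0 : c + e1 + (e0 - e1) = c + e0 by apply/rowP => i; rewrite !mxE; ring.
have diff_edge0 : phi0 (c + e0) - phi1 (c + e0) = phi0 (c + e1) - phi1 (c + e1).
  have D : is_polyfun (fun y => phi0 y - phi1 y) by pf_tac.
  rewrite -ce0 -[e0 - e1]scale1r; apply: (derive_along_eq0 D) => t.
  rewrite derive_e0Be1 //; pd_tac; rewrite f00 f01 f10 f11.
  by case: (N_edge0 (tri_lam_edge0 t)) => E _; rewrite -[RHS]E; ring.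
(* A rigid motion is subtracted: the translation makes chi vanish at [c], and the rotation rate [a]
   makes [chi0] vanish at [c + e1]. The remaining vertex values follow because N(t, t) = 0 keeps the
   component along t constant on each edge. *)
pose a := phi0 (c + e1) - phi0 c.
pose chi0 (x : 'rV[R]_2) := phi0 x + (- phi0 c + - (a * (x 0 1 - c 0 1))).
pose chi1 (x : 'rV[R]_2) := phi1 x + (- phi1 c + a * (x 0 0 - c 0 0)).
have pchi0 : polyfun l.+2 chi0.
  apply: polyfunD => //; apply: polyfunD; first exact: polyfun_cst.
  by apply/polyfunN/polyfunZ/polyfunB; [exact: polyfun_coord | exact: polyfun_cst].
have pchi1 : polyfun l.+2 chi1.
  apply: polyfunD => //; apply: polyfunD; first exact: polyfun_cst.
  by apply/polyfunZ/polyfunB; [exact: polyfun_coord | exact: polyfun_cst].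
have d00 : pd 0 chi0 = N00.
  by apply/funext => x; rewrite /chi0; pd_tac; rewrite f00 /=; ring.
have d01 : pd 1 chi0 = fun x => N01 x - om x - a.
  by apply/funext => x; rewrite /chi0; pd_tac; rewrite f01 /=; ring.
have d10 : pd 0 chi1 = fun x => N01 x + om x + a.
  by apply/funext => x; rewrite /chi1; pd_tac; rewrite f10 /=; ring.
have d11 : pd 1 chi1 = N11.
  by apply/funext => x; rewrite /chi1; pd_tac; rewrite f11 /=; ring.
have chi0_e1 : chi0 (c + e1) = 0 by rewrite /chi0 !mxE /a /=; ring.
have chi1_e0 : chi1 (c + e0) = 0.
  move: diff_edge0; have := phi0_edge2 1; have := phi1_edge1 1; rewrite !scale1r => -> ->.
  by rewrite /chi1 !mxE /a /=; move: (phi0 _) (phi0 _) (phi1 _) (phi1 _) => A B C D; lra.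
have chi0_edge2 s : chi0 (c + s *: e0) = 0.
  by rewrite /chi0 phi0_edge2 !mxE /=; ring.
have chi1_edge1 s : chi1 (c + s *: e1) = 0.
  by rewrite /chi1 phi1_edge1 !mxE /=; ring.
have [chi0_c chi1_c] : chi0 c = 0 /\ chi1 c = 0.
  by have := chi0_edge2 0; have := chi1_edge1 0; rewrite !scale0r addr0.
clearbody chi0 chi1.
have [Chi0 Chi1] := (is_polyfun_fun pchi0, is_polyfun_fun pchi1).
(* The component not controlled by N(t, t) has zero second derivative along the edge, by the
   derivative condition there; being affine and zero at both ends, it vanishes. *)
have chi1_edge2 s : chi1 (c + s *: e0) = 0.
  apply: derive2_along_eq0 => // t.
  rewrite (_ : (fun y => _) = fun x => N01 x + om x + a) ?derive_e0; last exact: d10.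
  pd_tac; rewrite om0; case: (N_edge2 (tri_lam_edge2 t)) => _ <-.
  by move: (pd 0 _ _) => A; ring.
have chi0_edge1 s : chi0 (c + s *: e1) = 0.
  apply: derive2_along_eq0 => // t.
  rewrite (_ : (fun y => _) = fun x => N01 x - om x - a) ?derive_e1; last exact: d01.
  pd_tac; rewrite om1; case: (N_edge1 (tri_lam_edge1 t)) => _ <-.
  by move: (pd 1 _ _) => A; ring.
have chi0_edge0 s : chi0 (c + e1 + s *: (e0 - e1)) = 0.
  apply: derive2_along_eq0 => //; last by rewrite ce0; have := chi0_edge2 1; rewrite scale1r.
  move=> t; rewrite (_ : (fun y => _) = fun x => N00 x - (N01 x - om x - a)); last first.
    by apply/funext => y; rewrite derive_e0Be1 // d00 d01.
  rewrite derive_e0Be1; last by pf_tac.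
  pd_tac; rewrite om0 om1; case: (N_edge0 (tri_lam_edge0 t)) => _.
  move: (pd 0 N00 _) (pd 1 N00 _) (pd 0 N01 _) (pd 1 N01 _) (pd 0 N11 _) => A B C D E; lra.
have chi1_edge0 s : chi1 (c + e1 + s *: (e0 - e1)) = 0.
  have D : is_polyfun (fun y => chi0 y - chi1 y) by pf_tac.
  have := derive_along_eq0 D (x := c + e1) (d := e0 - e1).
  have := chi1_edge1 1; rewrite scale1r chi0_e1 => -> E.
  have /E/(_ s) : forall t, 'D_(e0 - e1) (fun y => chi0 y - chi1 y) (c + e1 + t *: (e0 - e1)) = 0;
    last by rewrite chi0_edge0 sub0r subr0 => /eqP; rewrite oppr_eq0 => /eqP.
  move=> t; rewrite derive_e0Be1 //; pd_tac; rewrite d00 d01 d10 d11.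
  by case: (N_edge0 (tri_lam_edge0 t)) => F _; rewrite -[RHS]F; ring.
have factor chi : polyfun l.+2 chi -> (forall s, chi (c + e1 + s *: (e0 - e1)) = 0) ->
    (forall s, chi (c + s *: e1) = 0) -> (forall s, chi (c + s *: e0) = 0) ->
    exists2 k, polyfun (l - 1) k & forall x, chi x = bubble x * k x.
  move=> pchi c0 c1 c2; rewrite (_ : l - 1 = l.+2 - 3)%N; last by lia.
  apply: bubble_factor2 => // i x /tri_edgeP[s ->].
  by move: i; apply: forall_ord3; [exact: c0 | exact: c1 | exact: c2].
have [k0 pk0 k0E] := factor _ pchi0 chi0_edge0 chi0_edge1 chi0_edge2.
have [k1 pk1 k1E] := factor _ pchi1 chi1_edge0 chi1_edge1 chi1_edge2.
(* With 2 div sym(x w) = k, integration by parts turns twice the moment of N against sym(x w) into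
   minus the integral of chi . k = bubble |k|^2. The entry [s01] below is twice the off-diagonal
   entry of sym(x w). *)
have [|w0 [w1 [pw0 pw1 W0 W1]]] := div_sym_position_solve _ pk0 pk1; first by lia.
have [[K0 K1] [V0 V1]] := (is_polyfun_fun pk0, is_polyfun_fun pk1,
                           (is_polyfun_fun pw0, is_polyfun_fun pw1)).
have B := bubble_is_polyfun.
have chi_eq0 i x : tri_lam i x = 0 -> chi0 x = 0 /\ chi1 x = 0.
  by rewrite k0E k1E => /bubble_eq0 ->; rewrite !mul0r.
pose s00 (x : 'rV[R]_2) := x 0 0 * w0 x.
pose s01 (x : 'rV[R]_2) := x 0 0 * w1 x + x 0 1 * w0 x.
pose s11 (x : 'rV[R]_2) := x 0 1 * w1 x.
have [S00 S01 S11] : [/\ is_polyfun s00, is_polyfun s01 & is_polyfun s11].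
  by split; rewrite /s00 /s01 /s11; pf_tac.
have {}W0 x : 2 * pd 0 s00 x + pd 1 s01 x = k0 x := W0 x.
have {}W1 x : pd 0 s01 x + 2 * pd 1 s11 x = k1 x := W1 x.
have {}I2 : tint c (fun x => N00 x * s00 x + N01 x * s01 x + N11 x * s11 x) = 0 by exact: I2.
clearbody s00 s01 s11.
have kk x : k0 x ^+ 2 + k1 x ^+ 2 = 0.
  move: x; apply: bubble_moment_eq0; first by pf_tac.
    by move=> x; rewrite addr_ge0 // sqr_ge0.
  pose F0 (x : 'rV[R]_2) := 2 * (chi0 x * s00 x) + chi1 x * s01 x.
  pose F1 (x : 'rV[R]_2) := chi0 x * s01 x + 2 * (chi1 x * s11 x).
  have divF : tint c (fun x => pd 0 F0 x + pd 1 F1 x) = 0.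
    apply: tint_div_eq0; rewrite /F0 /F1; first by pf_tac.
    - by pf_tac.
    - by move=> x /chi_eq0[-> ->]; ring.
    - by move=> x /chi_eq0[-> ->]; ring.
    - by move=> x /chi_eq0[-> ->]; ring.
  transitivity (tint c (fun x => (pd 0 F0 x + pd 1 F1 x) +
      - (2 * (N00 x * s00 x + N01 x * s01 x + N11 x * s11 x)))); last first.
    have PF0 : is_polyfun F0 by rewrite /F0; pf_tac.
    have PF1 : is_polyfun F1 by rewrite /F1; pf_tac.
    have [mI pI] : is_polyfun (fun x => N00 x * s00 x + N01 x * s01 x + N11 x * s11 x) by pf_tac.
    rewrite tint_add; [|by pf_tac|by pf_tac].
    by rewrite divF tint_opp ?(tintZ _ _ pI) ?I2 ?mulr0 ?subr0 //; pf_tac.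
  congr tint; apply/funext => x; rewrite /F0 /F1; pd_tac; rewrite d00 d01 d10 d11.
  have -> : bubble x * (k0 x ^+ 2 + k1 x ^+ 2) = chi0 x * k0 x + chi1 x * k1 x.
    by rewrite k0E k1E; ring.
  by rewrite -W0 -W1; pd_ring.
have {}kk x : chi0 x = 0 /\ chi1 x = 0.
  rewrite k0E k1E; move/eqP: (kk x); rewrite paddr_eq0 ?sqr_ge0 // !sqrf_eq0.
  by move=> /andP[/eqP -> /eqP ->]; rewrite mulr0.
have chi0_0 : chi0 = fun=> 0 by apply/funext => x; case: (kk x).
have chi1_0 : chi1 = fun=> 0 by apply/funext => x; case: (kk x).
move=> x; split; first by rewrite -d00 chi0_0 pd_cst.
  have := congr1 (fun f => f x) d01; have := congr1 (fun f => f x) d10.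
  by rewrite /= chi0_0 chi1_0 !pd_cst; move: (N01 x) (om x) => A C; lra.
by rewrite -d11 chi1_0 pd_cst.
Qed.

End Symmetric.

End ReferenceTriangle.

(** * Vectors and matrices in dimension three *)
Ltac mx_ring := repeat match goal with
  | |- context [fun_of_matrix ?x ?i ?j] => let h := fresh "d" in move: (fun_of_matrix x i j) => h
  end; ring.

Section Vectors.
Context {R : realType}.
Implicit Types (a b d n u w : 'rV[R]_3) (A : 'M[R]_3).

Lemma dotE u w : dot u w = u 0 0 * w 0 0 + u 0 1 * w 0 1 + u 0 2 * w 0 2.
Proof. exact: big_ord3. Qed.

Lemma cross0E u w : cross u w 0 0 = u 0 1 * w 0 2 - u 0 2 * w 0 1.
Proof. by rewrite mxE; congr (u 0 _ * w 0 _ - u 0 _ * w 0 _); apply: val_inj. Qed.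
Lemma cross1E u w : cross u w 0 1 = u 0 2 * w 0 0 - u 0 0 * w 0 2.
Proof. by rewrite mxE; congr (u 0 _ * w 0 _ - u 0 _ * w 0 _); apply: val_inj. Qed.
Lemma cross2E u w : cross u w 0 2 = u 0 0 * w 0 1 - u 0 1 * w 0 0.
Proof. by rewrite mxE; congr (u 0 _ * w 0 _ - u 0 _ * w 0 _); apply: val_inj. Qed.
Definition crossE := (cross0E, cross1E, cross2E).

Lemma bilE u A w : bil u A w = \sum_i \sum_j u 0 i * A i j * w 0 j.
Proof.
rewrite /bil mxE exchange_big; apply: eq_bigr => j _.
by rewrite !mxE mulr_suml; apply: eq_bigr.
Qed.

Lemma row3P u w : u 0 0 = w 0 0 -> u 0 1 = w 0 1 -> u 0 2 = w 0 2 -> u = w.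
Proof. by move=> *; apply/rowP; apply: forall_ord3. Qed.

Lemma dotC u w : dot u w = dot w u.
Proof. by rewrite !dotE; mx_ring. Qed.
Lemma dotDl u u' w : dot (u + u') w = dot u w + dot u' w.
Proof. by rewrite !dotE !mxE; mx_ring. Qed.
Lemma dotZl k u w : dot (k *: u) w = k * dot u w.
Proof. by rewrite !dotE !mxE; mx_ring. Qed.
Lemma dotDr u w w' : dot u (w + w') = dot u w + dot u w'.
Proof. by rewrite dotC dotDl !(dotC u). Qed.
Lemma dotZr k u w : dot u (k *: w) = k * dot u w.
Proof. by rewrite dotC dotZl dotC. Qed.
Lemma dotNl u w : dot (- u) w = - dot u w.
Proof. by rewrite !dotE !mxE; mx_ring. Qed.
Lemma dotBl u u' w : dot (u - u') w = dot u w - dot u' w.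
Proof. by rewrite dotDl dotNl. Qed.
Lemma dot_crossl u w : dot (cross u w) u = 0.
Proof. by rewrite dotE !crossE; mx_ring. Qed.
Lemma dot_crossr u w : dot (cross u w) w = 0.
Proof. by rewrite dotE !crossE; mx_ring. Qed.
Lemma crossC u w : cross u w = - cross w u.
Proof. by apply: row3P; rewrite [RHS]mxE !crossE; mx_ring. Qed.
Lemma cross0r u : cross u 0 = 0.
Proof. by apply: row3P; rewrite crossE !mxE; mx_ring. Qed.
Lemma cross_cross a b d : cross a (cross b d) = dot a d *: b - dot a b *: d.
Proof. by apply: row3P; rewrite crossE !crossE !dotE !mxE; mx_ring. Qed.
Lemma crossDr a b d : cross a (b + d) = cross a b + cross a d.
Proof. by apply: row3P; rewrite !crossE; rewrite [RHS]mxE !crossE !mxE; mx_ring. Qed.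
Lemma crossZr k a b : cross a (k *: b) = k *: cross a b.
Proof. by apply: row3P; rewrite !crossE; rewrite [RHS]mxE !crossE !mxE; mx_ring. Qed.
Lemma cross_dot a b d : dot a (cross b d) = dot b (cross d a).
Proof. by rewrite !dotE !crossE; mx_ring. Qed.
Lemma dot_cross_cross a b d u : dot (cross a b) (cross d u) = dot a d * dot b u - dot a u * dot b d.
Proof. by rewrite !dotE !crossE; mx_ring. Qed.

Lemma bilDl u u' A w : bil (u + u') A w = bil u A w + bil u' A w.
Proof. by rewrite /bil !mulmxDl mxE. Qed.
Lemma bilZl k u A w : bil (k *: u) A w = k * bil u A w.
Proof. by rewrite /bil -!scalemxAl mxE. Qed.
Lemma bilDr u A w w' : bil u A (w + w') = bil u A w + bil u A w'.
Proof. by rewrite /bil linearD mulmxDr mxE. Qed.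
Lemma bilZr k u A w : bil u A (k *: w) = k * bil u A w.
Proof. by rewrite /bil linearZ -scalemxAr mxE. Qed.
Lemma bilNl u A w : bil (- u) A w = - bil u A w.
Proof. by rewrite -scaleN1r bilZl mulN1r. Qed.
Lemma bilNr u A w : bil u A (- w) = - bil u A w.
Proof. by rewrite -scaleN1r bilZr mulN1r. Qed.
Lemma bil0m u w : bil u 0 w = 0.
Proof. by rewrite /bil mulmx0 mul0mx mxE. Qed.
Definition bil_lin := (bilDl, bilDr, bilZl, bilZr, bilNl, bilNr).

Lemma dot_delta u j : dot (delta_mx 0 j) u = u 0 j.
Proof.
rewrite /dot (bigD1 j) //= mxE !eqxx mul1r big1 ?addr0 // => i /negbTE ij.
by rewrite mxE eqxx ij mul0r.
Qed.

Lemma bil_delta A i j : bil (delta_mx 0 i) A (delta_mx 0 j) = A i j.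
Proof. by rewrite /bil -rowE trmx_delta -colE !mxE. Qed.

Lemma bil_symm u A w : bil u (symm A) w = 2^-1 * (bil u A w + bil w A u).
Proof.
rewrite /symm {1}/bil -scalemxAr -scalemxAl mxE mulmxDr mulmxDl mxE; congr (_ * (_ + _)).
by rewrite /bil -[LHS]trace_mx11 -mxtrace_tr trace_mx11 !trmx_mul !trmxK mulmxA.
Qed.

(** In the plane orthogonal to [n] the vectors [d] and n x d are orthogonal and of equal length; the
    factor [dot d d] avoids a division. *)
Lemma plane_decomp n d a : dot n n = 1 -> dot d n = 0 -> dot a n = 0 ->
  dot d d *: a = dot a d *: d + dot a (cross n d) *: cross n d.
Proof.
move=> n1 dn an.
have nd : dot n d = 0 by rewrite dotC.
have na : dot n a = 0 by rewrite dotC.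
have E : cross a d = dot n (cross a d) *: n.
  have := cross_cross n n (cross a d); rewrite [cross n (cross a d)]cross_cross nd na !scale0r subrr cross0r n1.
  by rewrite scale1r => /esym/eqP; rewrite subr_eq0 => /eqP.
have := cross_cross d a d; rewrite E crossZr cross_dot [cross d n]crossC => /eqP.
rewrite eq_sym subr_eq => /eqP ->.
by rewrite [dot a (- _)]dotC dotNl scaleNr scalerN opprK [dot d a]dotC [dot (cross _ _) _]dotC addrC.
Qed.

End Vectors.

Lemma derive_poly_sum (R : realType) n m (I : Type) (r : seq I) (F : I -> 'rV[R]_n.+1 -> R) d x :
  (forall i, polyfun m (F i)) ->
  'D_d (fun y => \sum_(i <- r) F i y) x = \sum_(i <- r) 'D_d (F i) x.
Proof.
move=> pF; elim: r => [|i r IH].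
  by rewrite big_nil (_ : (fun y => _) = fun=> 0) ?derive_cst //; apply/funext => y; rewrite big_nil.
rewrite big_cons -IH -(derive_polyD _ _ (pF i) (polyfun_sum r (P := xpredT) (fun i _ => pF i))).
by congr ('D_d _ x); apply/funext => y; rewrite big_cons.
Qed.

(** * Matrix fields, their curl, and restrictions to lines *)

Section MatrixFields.
Context {R : realType}.
Implicit Types (x a b d u w : 'rV[R]_3) (M tau : 'rV[R]_3 -> 'M[R]_3).

Lemma polyfun_bil k M u w : (forall i j, polyfun k (fun x => M x i j)) ->
  polyfun k (fun x => bil u (M x) w).
Proof.
move=> pM; apply: (@polyfun_eq _ _ _ (fun x => \sum_i \sum_j (u 0 i * w 0 j) * M x i j)).
  by move=> x; rewrite bilE; apply: eq_bigr => i _; apply: eq_bigr => j _; rewrite mulrAC.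
by apply: polyfun_sum => i _; apply: polyfun_sum => j _; apply: polyfunZ.
Qed.

Lemma polyfun_symm k M : (forall i j, polyfun k (fun x => M x i j)) ->
  forall i j, polyfun k (fun x => symm (M x) i j).
Proof.
move=> pM i j; apply: polyfun_eq (polyfunZ 2^-1 (polyfunD (pM i j) (pM j i))) => x.
by rewrite !mxE.
Qed.

Lemma polyfun_curlm k tau : (forall i j, polyfun k (fun x => tau x i j)) ->
  forall i j, polyfun k.-1 (fun x => curlm tau x i j).
Proof.
move=> ptau i j; apply: polyfun_eq (polyfunB (polyfun_pd (j + 1) (ptau i (j + 1 + 1)))
  (polyfun_pd (j + 1 + 1) (ptau i (j + 1)))) => x.
by rewrite !mxE.
Qed.

Lemma curlm0E tau x i : curlm tau x i 0 =
  pd 1 (fun y => tau y i 2) x - pd 2 (fun y => tau y i 1) x.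
Proof.
rewrite mxE (_ : 0 + 1 + 1 = 2 :> 'I_3); last exact: val_inj.
by rewrite (_ : 0 + 1 = 1 :> 'I_3); last exact: val_inj.
Qed.
Lemma curlm1E tau x i : curlm tau x i 1 =
  pd 2 (fun y => tau y i 0) x - pd 0 (fun y => tau y i 2) x.
Proof.
rewrite mxE (_ : 1 + 1 + 1 = 0 :> 'I_3); last exact: val_inj.
by rewrite (_ : 1 + 1 = 2 :> 'I_3); last exact: val_inj.
Qed.
Lemma curlm2E tau x i : curlm tau x i 2 =
  pd 0 (fun y => tau y i 1) x - pd 1 (fun y => tau y i 0) x.
Proof.
rewrite mxE (_ : 2 + 1 + 1 = 1 :> 'I_3); last exact: val_inj.
by rewrite (_ : 2 + 1 = 0 :> 'I_3); last exact: val_inj.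
Qed.

Lemma derive_bil k tau a u w x : (forall i j, polyfun k (fun x => tau x i j)) ->
  'D_a (fun y => bil u (tau y) w) x =
  \sum_i u 0 i * \sum_j w 0 j * 'D_a (fun y => tau y i j) x.
Proof.
move=> pt; rewrite (_ : (fun y => _) = fun y => \sum_i u 0 i * \sum_j w 0 j * tau y i j); last first.
  apply/funext => y; rewrite bilE; apply: eq_bigr => i _; rewrite mulr_sumr.
  by apply: eq_bigr => j _; rewrite mulrCA mulrC.
have pi i : polyfun k (fun y => \sum_j w 0 j * tau y i j).
  by apply: polyfun_sum => j _; exact: polyfunZ.
rewrite (derive_poly_sum _ _ _ (fun i => polyfunZ (u 0 i) (pi i))); apply: eq_bigr => i _.
rewrite (derive_polyZ _ _ _ (pi i)) (derive_poly_sum _ _ _ (fun j => polyfunZ (w 0 j) (pt i j))).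
by congr (_ * _); apply: eq_bigr => j _; rewrite (derive_polyZ _ _ _ (pt i j)).
Qed.

(** The frame-free form of the curl: contraction with a x b is the skew part of the directional
    derivative. Edge tangents and conormals can then be inserted directly. *)
Lemma bil_curl k tau a b u x : (forall i j, polyfun k (fun x => tau x i j)) ->
  bil u (curlm tau x) (cross a b) =
  'D_a (fun y => bil u (tau y) b) x - 'D_b (fun y => bil u (tau y) a) x.
Proof.
move=> pt; rewrite bilE !(derive_bil _ _ _ _ pt) -sumrB; apply: eq_bigr => i _.
rewrite !big_ord3 !(derive_pd _ _ (pt _ _)) !big_ord3 curlm0E curlm1E curlm2E !crossE.
do !(match goal with
  |- context [pd ?i ?f ?x] => let h := fresh "p" in move: (pd i f x) => h end).
by mx_ring.
Qed.

Lemma derive_bil_lin k tau a u w x r : (forall i j, polyfun k (fun x => tau x i j)) ->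
  'D_a (fun y => r * bil u (tau y) w) x = r * 'D_a (fun y => bil u (tau y) w) x.
Proof. by move=> pt; exact: derive_polyZ (polyfun_bil u w pt). Qed.

Lemma line_bubble_moments_eq0 k (G : 'rV[R]_3 -> R) x d : polyfun k.+1 G ->
  G x = 0 -> G (x + d) = 0 ->
  (forall q : {poly R}, (size q <= k)%N -> rint 0 1 (fun s => G (x + s *: d) * q.[s]) = 0) ->
  forall s, G (x + s *: d) = 0.
Proof.
move=> pG G0 G1 IG s; have [p [sp pE _]] := polyfun_line x d pG.
rewrite -pE (@poly_bubble_moments_eq0 _ k p) ?horner0 // ?pE ?scale0r ?scale1r ?addr0 //.
by move=> q sq; rewrite -[RHS](IG q sq); apply: eq_rint => t _; rewrite pE.
Qed.

Lemma line_moments_eq0 k (G : 'rV[R]_3 -> R) x d : polyfun k G ->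
  (forall q : {poly R}, (size q <= k.+1)%N -> rint 0 1 (fun s => G (x + s *: d) * q.[s]) = 0) ->
  forall s, G (x + s *: d) = 0.
Proof.
move=> pG IG s; have [p [sp pE _]] := polyfun_line x d pG.
rewrite -pE (@poly_moments_eq0 _ k.+1 p) ?horner0 // => q sq.
by rewrite -[RHS](IG q sq); apply: eq_rint => t _; rewrite pE.
Qed.

Lemma dot_ge0 u : 0 <= dot u u.
Proof. by apply: sumr_ge0 => i _; rewrite -expr2 sqr_ge0. Qed.

Lemma dot_eq0 u : (dot u u == 0) = (u == 0).
Proof.
apply/eqP/eqP => [/eqP|->]; last by rewrite dotE !mxE; ring.
rewrite psumr_eq0 => [/allP u0|i _]; last by rewrite -expr2 sqr_ge0.
apply/rowP => i; rewrite mxE; apply/eqP; have := u0 i (mem_index_enum i).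
by rewrite -expr2 sqrf_eq0.
Qed.

Lemma norm3_sqr u : norm3 u ^+ 2 = dot u u.
Proof. by rewrite sqr_sqrtr // dot_ge0. Qed.

Lemma norm3_eq0 u : (norm3 u == 0) = (u == 0).
Proof. by rewrite -sqrf_eq0 norm3_sqr dot_eq0. Qed.

(* What the vertex and edge degrees of freedom say on the line through x with direction d;
   the conditions are homogeneous in d, so that they do not depend on the orientation. *)
Definition edge_vanishing tau x d := forall s,
  [/\ forall u, dot u d = 0 -> bil u (tau (x + s *: d)) d = 0,
      forall u w, dot u d = 0 -> dot w d = 0 -> bil u (symm (curlm tau (x + s *: d))) w = 0
    & forall m, dot m d = 0 -> dot m m = dot d d ->
        'D_m (fun y => bil m (tau y) d) (x + s *: d)
        - 'D_d (fun y => bil m (tau y) m) (x + s *: d)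
        + 'D_d (fun y => bil d (tau y) d) (x + s *: d) = 0].

(** The functionals are attached to ordered pairs i < j, while a face may traverse its edges the
    other way. Under d -> -d the first and third conditions change sign and the second is
    unaffected. *)
Lemma edge_vanishing_rev k tau x d : (forall i j, polyfun k (fun x => tau x i j)) ->
  edge_vanishing tau x d -> edge_vanishing tau (x + d) (- d).
Proof.
move=> pt E s; have -> : x + d + s *: - d = x + (1 - s) *: d.
  by rewrite scalerBl scale1r scalerN addrA.
have dotN u : dot u (- d) = - dot u d by rewrite dotC dotNl dotC.
have [E1 E2 E3] := E (1 - s); split.
- by move=> u /eqP; rewrite dotN oppr_eq0 => /eqP ud; rewrite bilNr E1 ?oppr0.
- move=> u w /eqP; rewrite dotN oppr_eq0 => /eqP ud /eqP; rewrite dotN oppr_eq0 => /eqP.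
  exact: E2.
move=> m /eqP; rewrite dotN oppr_eq0 => /eqP md; rewrite dotN dotNl opprK => mm.
have DN f X : polyfun k f -> 'D_(- d) f X = - 'D_d f X.
  move=> pf; have := derive_linear d 0 (-1) 0 X pf.
  by rewrite scaleN1r scale0r addr0 mulN1r mul0r addr0.
rewrite !DN; try exact: polyfun_bil.
have -> : (fun y => bil m (tau y) (- d)) = fun y => -1 * bil m (tau y) d.
  by apply/funext => y; rewrite bilNr mulN1r.
have -> : (fun y => bil (- d) (tau y) (- d)) = fun y => bil d (tau y) d.
  by apply/funext => y; rewrite bilNl bilNr opprK.
rewrite (derive_bil_lin _ _ _ _ _ pt) mulN1r -!opprD -[RHS]oppr0 -(E3 m md mm); congr (- _).
Qed.

End MatrixFields.

(** * Edges *)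
Ltac bil_ring := repeat match goal with
  | |- context [bil ?u ?A ?w] => let h := fresh "b" in move: (bil u A w) => h
  end; try ring.

Section EdgeDofs.
Context {R : realType}.
Variables (l : nat) (tau : 'rV[R]_3 -> 'M[R]_3) (x d n0 : 'rV[R]_3).
Hypotheses (l_gt0 : (0 < l)%N) (ptau : forall i j, polyfun l.+1 (fun x => tau x i j)).
Let t := (norm3 d)^-1 *: d.
Let nn (a : 'I_2) := if a == 0 then n0 else cross t n0.
Hypotheses (d_neq0 : d != 0) (n0_unit : dot n0 n0 = 1) (n0t : dot n0 t = 0).
Hypotheses (tau0 : tau x = 0) (tau1 : tau (x + d) = 0).
Hypotheses (curl0 : symm (curlm tau x) = 0) (curl1 : symm (curlm tau (x + d)) = 0).
Hypothesis moments3 : forall a b (q : {poly R}), (size q <= l - 1)%N ->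
  rint 0 1 (fun s => bil (nn a) (symm (curlm tau (x + s *: d))) (nn b) * q.[s]) = 0.
Hypothesis moments4 : forall a (q : {poly R}), (size q <= l)%N ->
  rint 0 1 (fun s => bil (nn a) (tau (x + s *: d)) t * q.[s]) = 0.
Hypothesis moments5 : forall (q : {poly R}), (size q <= l.+1)%N ->
  rint 0 1 (fun s => (bil (nn 1) (curlm tau (x + s *: d)) (nn 0)
    + 'D_t (fun y => bil t (tau y) t) (x + s *: d)) * q.[s]) = 0.

(** For m of length |d| with components [al], [be] in the frame [nn], m x d = |d| (be nn_0 - al
    nn_1). The curl being skew on the normal plane, m . curl (m x d) = |d| (al^2 + be^2) nn_1 . curl
    nn_0 = |d|^3 nn_1 . curl nn_0. The derivative of d . tau d along d scales by |d|^3 as well, so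
    one functional gives the condition for every m. *)
Lemma edge_vanishing_dofs : edge_vanishing tau x d.
Proof.
have r0 : norm3 d != 0 by rewrite norm3_eq0.
have dE : d = norm3 d *: t by rewrite /t scalerA divff // scale1r.
have t1 : dot t t = 1.
  by rewrite /t dotZl dotC dotZl -norm3_sqr mulrA -invfM -expr2 mulVf // expf_neq0.
have decomp u : dot u d = 0 -> u = dot u n0 *: nn 0 + dot u (cross t n0) *: nn 1.
  move=> ud; have ut : dot u t = 0 by rewrite dotC /t dotZl dotC ud mulr0.
  by have := plane_decomp t1 n0t ut; rewrite n0_unit scale1r.
have v4 a s : bil (nn a) (tau (x + s *: d)) t = 0.
  apply: (line_bubble_moments_eq0 (k := l) (G := fun y => bil (nn a) (tau y) t)).
  - exact: polyfun_bil.
  - by rewrite tau0 bil0m.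
  - by rewrite tau1 bil0m.
  - exact: moments4.
have pS i j : polyfun l (fun y => symm (curlm tau y) i j).
  by apply: polyfun_symm; exact: (polyfun_curlm ptau).
have v3 a b s : bil (nn a) (symm (curlm tau (x + s *: d))) (nn b) = 0.
  apply: (line_bubble_moments_eq0 (k := l - 1) (G := fun y => bil (nn a) (symm (curlm tau y)) (nn b))).
  - by rewrite subn1 prednK //; exact: polyfun_bil.
  - by rewrite curl0 bil0m.
  - by rewrite curl1 bil0m.
  - exact: moments3.
(* No end values are known for this combination; its degree [l] is matched by moments against all
   polynomials of degree at most [l]. *)
have v5 s : bil (nn 1) (curlm tau (x + s *: d)) (nn 0)
    + 'D_t (fun y => bil t (tau y) t) (x + s *: d) = 0.
  apply: (line_moments_eq0 (k := l) (G := fun y => bil (nn 1) (curlm tau y) (nn 0)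
    + 'D_t (fun z => bil t (tau z) t) y)); last exact: moments5.
  apply: polyfunD; first by apply: polyfun_bil; exact: (polyfun_curlm ptau).
  exact: (polyfun_derive _ (polyfun_bil t t ptau)).
move=> s; split.
- move=> u /decomp ->; have bd w A : bil w A d = norm3 d * bil w A t by rewrite -bilZr -dE.
  by rewrite bd bilDl !bilZl !v4 !mulr0 addr0 mulr0.
- by move=> u w /decomp -> /decomp ->; rewrite !bil_lin !v3 !(mulr0, addr0).
move=> m md mm; set X := x + s *: d.
rewrite -(bil_curl _ _ _ _ ptau).
have -> : 'D_d (fun y => bil d (tau y) d) X =
    norm3 d ^+ 3 * 'D_t (fun y => bil t (tau y) t) X.
  rewrite (_ : (fun y => bil d (tau y) d) = fun y => norm3 d ^+ 2 * bil t (tau y) t); last first.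
    by apply/funext => y; rewrite {1 2}dE bilZl bilZr mulrA.
  rewrite (derive_bil_lin _ _ _ _ _ ptau).
  have := derive_linear t 0 (norm3 d) 0 X (polyfun_bil t t ptau).
  by rewrite scaler0 addr0 mul0r addr0 -dE => ->; rewrite mulrA -exprSr.
have := v5 s; rewrite -/X => /eqP; rewrite addrC addr_eq0 => /eqP ->.
have mE := decomp m md; set al := dot m n0 in mE; set be := dot m (cross t n0) in mE.
clearbody al be.
have n01 : dot n0 (cross t n0) = 0 by rewrite dotC dot_crossr.
have nn1 : dot (cross t n0) (cross t n0) = 1.
  by rewrite dot_cross_cross t1 n0_unit n0t mulr0 subr0 mulr1.
have mm' : al ^+ 2 + be ^+ 2 = norm3 d ^+ 2.
  rewrite norm3_sqr -mm mE /nn /= !(dotDl, dotDr, dotZl, dotZr) n0_unit nn1 n01.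
  by rewrite [dot (cross t n0) n0]dotC n01; ring.
have mdE : cross m d = norm3 d *: (be *: nn 0 - al *: nn 1).
  rewrite {1}dE crossZr; congr (_ *: _).
  rewrite crossC mE crossDr !crossZr /nn /= cross_cross t1 [dot t n0]dotC n0t.
  by rewrite scale0r sub0r scale1r scalerN opprD opprK addrC.
have S a b : bil (nn a) (curlm tau X) (nn b) = - bil (nn b) (curlm tau X) (nn a).
  apply/eqP; rewrite -addr_eq0; have := v3 a b s; rewrite bil_symm => /eqP.
  by rewrite mulf_eq0 invr_eq0 pnatr_eq0.
have S0 a : bil (nn a) (curlm tau X) (nn a) = 0 by have := S a a; lra.
rewrite mdE {1}mE !bil_lin !S0 (S 0 1).
rewrite [X in X + _ = 0](_ : _ = norm3 d * (al ^+ 2 + be ^+ 2) * bil (nn 1) (curlm tau X) (nn 0)).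
  by rewrite mm'; bil_ring.
by bil_ring.
Qed.

End EdgeDofs.

Section DirectionalDerivative.
Context {R : realType}.
Implicit Types (x a b d u w : 'rV[R]_3).
Variables (k : nat) (tau : 'rV[R]_3 -> 'M[R]_3).
Hypothesis ptau : forall i j, polyfun k (fun x => tau x i j).

Definition dirm a x : 'M[R]_3 := \matrix_(i, j) 'D_a (fun y => tau y i j) x.

Lemma derive_bilE a u w x : 'D_a (fun y => bil u (tau y) w) x = bil u (dirm a x) w.
Proof.
rewrite (derive_bil _ _ _ _ ptau) bilE; apply: eq_bigr => i _; rewrite mulr_sumr.
by apply: eq_bigr => j _; rewrite !mxE mulrAC mulrA.
Qed.

Lemma dirm_linear a b r s x : dirm (r *: a + s *: b) x = r *: dirm a x + s *: dirm b x.
Proof. by apply/matrixP => i j; rewrite !mxE (derive_linear _ _ _ _ _ (ptau i j)). Qed.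

Lemma bil_scalemx r u A w : bil u (r *: A) w = r * bil u A w.
Proof. by rewrite /bil -scalemxAr -scalemxAl mxE. Qed.

Lemma bil_addmx u A B w : bil u (A + B) w = bil u A w + bil u B w.
Proof. by rewrite /bil mulmxDr mulmxDl mxE. Qed.

Lemma bil_curlm_dirm a b u x :
  bil u (curlm tau x) (cross a b) = bil u (dirm a x) b - bil u (dirm b x) a.
Proof. by rewrite (bil_curl _ _ _ _ ptau) !derive_bilE. Qed.

(* In terms of the tangential-tangential trace, written as the quadratic form
   N(p, q) = (n x p) tau q + (n x q) tau p on the plane orthogonal to n. *)
Lemma edge_vanishing_trace2 x d n a s : dot n n = 1 -> dot d n = 0 -> dot a n = 0 -> d != 0 ->
  edge_vanishing tau x d ->
  bil (cross n d) (tau (x + s *: d)) d = 0 /\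
  bil (cross n d) (dirm d (x + s *: d)) a + bil (cross n a) (dirm d (x + s *: d)) d =
  bil (cross n d) (dirm a (x + s *: d)) d.
Proof.
move=> n1 dn an d0 E; have md : dot (cross n d) d = 0 by rewrite dot_crossr.
split; first by case: (E s) => E1 _ _; exact: E1.
have nd : dot n d = 0 by rewrite dotC.
have mm : dot (cross n d) (cross n d) = dot d d.
  by rewrite dot_cross_cross n1 nd mul1r mul0r subr0.
set X := x + s *: d; set m := cross n d in md mm *.
have nm : cross n m = - d by rewrite /m cross_cross nd n1 scale0r sub0r scale1r.
have dd0 : dot d d != 0 by rewrite dot_eq0.
have T0 : bil m (dirm d X) d = 0.
  have [p [_ pE dpE]] := polyfun_line x d (polyfun_bil m d ptau).
  rewrite -derive_bilE -dpE (_ : p = 0) ?deriv0 ?horner0 //.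
  by apply: (@poly_eq0_near _ _ 0 1) => // r _; rewrite pE; case: (E r) => E1 _ _; exact: E1.
have T3 : bil m (dirm m X) d - bil m (dirm d X) m + bil d (dirm d X) d = 0.
  by case: (E s) => _ _ /(_ m md mm); rewrite !derive_bilE.
(* The part of [a] along [d] contributes only derivatives of m . tau d along the edge, which vanish;
   the part along m is the third edge condition. *)
have aE : a = (dot a d / dot d d) *: d + (dot a m / dot d d) *: m.
  have := congr1 (fun z => (dot d d)^-1 *: z) (plane_decomp n1 dn an).
  by rewrite scalerA mulVf // scale1r scalerDr !scalerA ![_^-1 * _]mulrC.
move: (dot a d / _) (dot a m / _) aE => al be ->.
rewrite dirm_linear crossDr !crossZr -/m nm bil_addmx !bil_scalemx !bil_lin T0.
move: T3; move: (bil m (dirm m X) d) (bil m (dirm d X) m) (bil d (dirm d X) d) => A B C T3.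
have -> : A = B - C by lra.
by ring.
Qed.

End DirectionalDerivative.

(** * Face traces as bilinear forms *)

Section Traces.
Context {R : realType}.
Implicit Types (a b n u w : 'rV[R]_3) (A : 'M[R]_3).

Lemma ord3_succ : [/\ 0 + 1 = 1 :> 'I_3, 1 + 1 = 2 :> 'I_3 & 2 + 1 = 0 :> 'I_3].
Proof. by split; apply: val_inj. Qed.

Lemma bil_mxcrossr a A n b : bil a (mxcrossr A n) b = bil a A (cross n b).
Proof.
have [E0 E1 E2] := ord3_succ.
rewrite !bilE; apply: eq_bigr => i _; rewrite !big_ord3 !crossE !mxE !(E0, E1, E2).
by mx_ring.
Qed.

Lemma bil_mxcrossl a A n b : bil a (mxcrossl n A) b = bil (cross a n) A b.
Proof.
have [E0 E1 E2] := ord3_succ.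
rewrite !bilE exchange_big [RHS]exchange_big; apply: eq_bigr => j _.
rewrite !big_ord3 !crossE !mxE !(E0, E1, E2).
by mx_ring.
Qed.

Lemma dot_trace1 n A a : dot (trace1 n A) a = bil n A (cross n a).
Proof.
rewrite -bil_mxcrossr /trace1 /bil mxE; apply: eq_bigr => j _.
by rewrite [a^T _ _]mxE.
Qed.

Definition nform n A p q := bil (cross n p) A q + bil (cross n q) A p.

(** Since n x (n x a) is minus the tangential part of [a], the second trace is half of [nform] on
    tangential parts: the two signs cancel. *)
Lemma bil_trace2 n A a b : dot n n = 1 ->
  bil a (trace2 n A) b = 2^-1 * nform n A (cross n (cross n a)) (cross n (cross n b)).
Proof.
move=> n1; rewrite /trace2 bil_mxcrossr bil_mxcrossl bil_symm !bil_mxcrossr /nform.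
have nnn w : cross n (cross n (cross n w)) = - cross n w.
  by rewrite [LHS]cross_cross dotC dot_crossl n1 scale0r sub0r scale1r.
rewrite !nnn [cross a n]crossC -[in cross n (- _)]scaleN1r crossZr scaleN1r !bil_lin.
by [].
Qed.

End Traces.

(** * Faces *)
Lemma big_ord2 (R : realType) (F : 'I_2 -> R) : \sum_(k < 2) F k = F 0 + F 1.
Proof. by rewrite big_ord_recl big_ord1; congr (_ + F _); apply: val_inj. Qed.

Section Frame.
Context {R : realType}.
Variables (n : 'rV[R]_3) (e : 'I_2 -> 'rV[R]_3).
Hypotheses (n1 : dot n n = 1) (e_dot : forall k l, dot (e k) (e l) = (k == l)%:R)
  (e_n : forall k, dot (e k) n = 0).

(** [sg] is the orientation of the tangential frame relative to the normal; both values can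
    occur. *)
Lemma frame_rotation : exists sg, [/\ sg * sg = 1, cross n (e 0) = sg *: e 1
  & cross n (e 1) = - sg *: e 0].
Proof.
have en k : dot n (e k) = 0 by rewrite dotC.
have := plane_decomp n1 (e_n 0) (e_n 1); rewrite !e_dot /= scale1r scale0r add0r.
set sg := dot (e 1) _ => E1; exists sg.
have sg2 : sg * sg = 1.
  have : dot (cross n (e 0)) (cross n (e 0)) = 1.
    by rewrite dot_cross_cross n1 e_dot eqxx en mul0r subr0 mulr1.
  by have := e_dot 1 1; rewrite E1 dotZl dotC dotZl => + H; rewrite H mulr1.
split=> //; first by rewrite E1 scalerA sg2 scale1r.
by rewrite E1 crossZr cross_cross en n1 scale0r sub0r scale1r scalerN scaleNr.
Qed.

Lemma frame_decomp a : dot a n = 0 -> a = dot a (e 0) *: e 0 + dot a (e 1) *: e 1.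
Proof.
move=> an; have [sg [sg2 E0 _]] := frame_rotation.
have := plane_decomp n1 (e_n 0) an; rewrite e_dot eqxx scale1r E0 => {1}->.
by rewrite dotZr scalerA mulrAC sg2 mul1r.
Qed.

End Frame.

Section Face.
Context {R : realType}.
Variables (l : nat) (tau : 'rV[R]_3 -> 'M[R]_3) (F0 d1 d2 n o : 'rV[R]_3) (e : 'I_2 -> 'rV[R]_3).
Hypotheses (l3 : (3 <= l)%N) (ptau : forall i j, polyfun l.+1 (fun x => tau x i j)).
Hypotheses (n1 : dot n n = 1) (d1n : dot d1 n = 0) (d2n : dot d2 n = 0).
Hypotheses (e_dot : forall k l, dot (e k) (e l) = (k == l)%:R) (e_n : forall k, dot (e k) n = 0).
Hypothesis cross_neq0 : cross d1 d2 != 0.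
Hypotheses (tau0 : tau F0 = 0) (tau1 : tau (F0 + d1) = 0) (tau2 : tau (F0 + d2) = 0).
Hypotheses (edge1 : edge_vanishing tau F0 d1) (edge2 : edge_vanishing tau F0 d2)
  (edge0 : edge_vanishing tau (F0 + d2) (d1 - d2)).
Let X (s t : R) := F0 + s *: d1 + t *: d2.
Hypothesis moments6 : forall s, V6 l s -> rint 0 1 (fun u => rint 0 (1 - u) (fun t =>
   \sum_(k < 2) \sum_(k' < 2) bil (e k) (trace2 n (tau (X u t))) (e k') * s (fcoord o e (X u t)) k k')) = 0.
Hypothesis moments7 : forall q, V7 l q -> rint 0 1 (fun u => rint 0 (1 - u) (fun t =>
   \sum_(k < 2) dot (trace1 n (tau (X u t))) (e k) * q (fcoord o e (X u t)) 0 k)) = 0.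

Let a1 := dot d1 (e 0).
Let b1 := dot d1 (e 1).
Let a2 := dot d2 (e 0).
Let b2 := dot d2 (e 1).
Let D := a1 * b2 - b1 * a2.

Lemma face_d1E : d1 = a1 *: e 0 + b1 *: e 1. Proof. exact: frame_decomp d1n. Qed.
Lemma face_d2E : d2 = a2 *: e 0 + b2 *: e 1. Proof. exact: frame_decomp d2n. Qed.

Lemma face_det_neq0 : D != 0.
Proof.
apply: contra cross_neq0 => /eqP D0; rewrite face_d1E face_d2E; apply/eqP.
transitivity (D *: cross (e 0) (e 1)); last by rewrite D0 scale0r.
by rewrite /D; apply: row3P; rewrite [RHS]mxE !crossE !mxE; mx_ring.
Qed.

(* [face_coord] is inverse to [z |-> z_0 d1 + z_1 d2] in the coordinates of the frame e, so
   that [face_map] sends the reference triangle at [face_o] to the face and the position vector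
   to the position vector. *)
Definition face_coord (y : 'rV[R]_2) : 'rV[R]_2 :=
  \row_k (if k == 0 then (y 0 0 * b2 - y 0 1 * a2) / D else (y 0 1 * a1 - y 0 0 * b1) / D).
Definition face_o := face_coord (fcoord o e F0).
Definition face_map (z : 'rV[R]_2) := F0 + (z 0 0 - face_o 0 0) *: d1 + (z 0 1 - face_o 0 1) *: d2.

Lemma fcoord_face_map z : fcoord o e (face_map z) =
  \row_k (z 0 0 * (if k == 0 then a1 else b1) + z 0 1 * (if k == 0 then a2 else b2)).
Proof.
have D0 := face_det_neq0.
have E k : fcoord o e (face_map z) 0 k =
    fcoord o e F0 0 k + (z 0 0 - face_o 0 0) * dot d1 (e k) + (z 0 1 - face_o 0 1) * dot d2 (e k).
  by rewrite [LHS]mxE [fcoord _ _ F0 0 k]mxE /face_map !(dotDl, dotNl, dotZl); ring.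
apply/rowP; apply: forall_ord2; rewrite E [RHS]mxE /= -/a1 -/b1 -/a2 -/b2 /face_o /face_coord !mxE /=.
  by move: D0; rewrite /D => D0; field.
by move: D0; rewrite /D => D0; field.
Qed.

Lemma face_coordK z : face_coord (fcoord o e (face_map z)) = z.
Proof.
have := face_det_neq0; rewrite fcoord_face_map /D => D0.
by apply/rowP; apply: forall_ord2; rewrite /face_coord /D !mxE /=; field.
Qed.

Lemma face_mapE s t : X s t = face_map (face_o + s *: e0 + t *: e1).
Proof. by rewrite /face_map /X; congr (_ + _ *: _ + _ *: _); rewrite !mxE /=; ring. Qed.

Lemma polyfun_face_coord m p : polyfun m p -> polyfun m (fun y => p (face_coord y)).
Proof.
apply: polyfun_comp; have p0 := @polyfun_coord R 2 1 0 isT; have p1 := @polyfun_coord R 2 1 1 isT.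
apply: forall_ord2.
  apply: polyfun_eq (polyfunB (polyfunZ (b2 / D) p0) (polyfunZ (a2 / D) p1)) => y.
  by rewrite mxE /=; ring.
apply: polyfun_eq (polyfunB (polyfunZ (a1 / D) p1) (polyfunZ (b1 / D) p0)) => y.
by rewrite mxE /=; ring.
Qed.

Lemma pd_face_coord m p : polyfun m p ->
  pd 0 (fun y => p (face_coord y)) =
    (fun y => b2 / D * pd 0 p (face_coord y) - b1 / D * pd 1 p (face_coord y)) /\
  pd 1 (fun y => p (face_coord y)) =
    (fun y => a1 / D * pd 1 p (face_coord y) - a2 / D * pd 0 p (face_coord y)).
Proof.
move=> pp.
have E k (v : 'rV[R]_2) y : (forall h, face_coord (h *: delta_mx 0 k + y) = h *: v + face_coord y) ->
    pd k (fun y => p (face_coord y)) y = v 0 0 * pd 0 p (face_coord y) + v 0 1 * pd 1 p (face_coord y).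
  move=> vE; rewrite -[RHS](big_ord2 (fun i => v 0 i * pd i p (face_coord y))) -(derive_pd _ _ pp).
  exact: (derive_comp_affine _ vE).
split; apply/funext => y.
- rewrite (E 0 (\row_k (if k == 0 then b2 / D else - b1 / D))) ?mxE /=; first by ring.
  by move=> h; apply/rowP; apply: forall_ord2; rewrite !mxE /=; ring.
- rewrite (E 1 (\row_k (if k == 0 then - a2 / D else a1 / D))) ?mxE /=; first by ring.
  by move=> h; apply/rowP; apply: forall_ord2; rewrite !mxE /=; ring.
Qed.

Lemma polyfun_face_map m f : polyfun m f -> polyfun m (fun z => f (face_map z)).
Proof.
apply: polyfun_comp => i; have p0 := @polyfun_coord R 2 1 0 isT.
have p1 := @polyfun_coord R 2 1 1 isT.
apply: polyfun_eq (polyfunD (polyfunD (polyfun_cst 1 (F0 0 i))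
  (polyfunZ (d1 0 i) (polyfunB p0 (polyfun_cst 1 (face_o 0 0)))))
  (polyfunZ (d2 0 i) (polyfunB p1 (polyfun_cst 1 (face_o 0 1))))) => z.
by rewrite !mxE; ring.
Qed.

Lemma pd_face_map u w :
  pd 0 (fun z => bil u (tau (face_map z)) w) = (fun z => bil u (dirm tau d1 (face_map z)) w) /\
  pd 1 (fun z => bil u (tau (face_map z)) w) = (fun z => bil u (dirm tau d2 (face_map z)) w).
Proof.
split; apply/funext => z; rewrite -(derive_bilE ptau).
- apply: (derive_comp_affine (fun x => bil u (tau x) w)) => h.
  by apply/rowP => i; rewrite !mxE /=; ring.
- apply: (derive_comp_affine (fun x => bil u (tau x) w)) => h.
  by apply/rowP => i; rewrite !mxE /=; ring.
Qed.

(** Moments over the face become moments over the reference triangle at [face_o]; [k] collects the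
    constants produced by the change of coordinates. *)
Lemma tint_face (H : 'rV[R]_3 -> R) (F : 'rV[R]_2 -> R) (k : R) : k != 0 -> is_polyfun F ->
  (forall z, H (face_map z) = k * F z) ->
  rint 0 1 (fun u => rint 0 (1 - u) (fun t => H (X u t))) = 0 -> tint face_o F = 0.
Proof.
move=> k0 [m pF] HE I0; apply: (mulfI k0); rewrite mulr0 -(tintZ _ _ pF) -[RHS]I0.
by apply: eq_rint => s _; apply: eq_rint => t _; rewrite face_mapE HE.
Qed.

Lemma sum_trace2_face A (s : 'M[R]_2) : s 0 1 = s 1 0 ->
  \sum_(k < 2) \sum_(k' < 2) bil (e k) (trace2 n A) (e k') * s k k' =
  2^-1 * (nform n A (e 0) (e 0) * s 0 0 + 2 * nform n A (e 0) (e 1) * s 0 1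
          + nform n A (e 1) (e 1) * s 1 1).
Proof.
move=> s01; rewrite !big_ord2 !bil_trace2 //.
have ee k : cross n (cross n (e k)) = - e k.
  by rewrite cross_cross dotC e_n n1 scale0r sub0r scale1r.
have NN u w : nform n A (- u) (- w) = nform n A u w.
  rewrite /nform -[- u]scaleN1r -[- w]scaleN1r !crossZr !scaleN1r !bil_lin !opprK //.
have NC : nform n A (e 1) (e 0) = nform n A (e 0) (e 1) by rewrite /nform addrC.
rewrite !ee !NN NC s01; move: (nform _ _ _ _) (nform _ _ _ _) (nform _ _ _ _) => p q r.
by field.
Qed.

Lemma nform_lin A a b a' b' :
  nform n A (a *: e 0 + b *: e 1) (a' *: e 0 + b' *: e 1) =
  a * a' * nform n A (e 0) (e 0) + (a * b' + b * a') * nform n A (e 0) (e 1)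
  + b * b' * nform n A (e 1) (e 1).
Proof. by rewrite /nform !crossDr !crossZr !bil_lin; bil_ring. Qed.

(** Up to a constant factor [g0], [g1] are the components of [n . tau x n] in the basis [d1], [d2]:
    for a row u, (u . d2) d1 - (u . d1) d2 = u x (d1 x d2), and d1 x d2 is a multiple of [n]. *)
Let g0 z := bil n (tau (face_map z)) d2.
Let g1 z := - bil n (tau (face_map z)) d1.
Let N (p q : 'rV[R]_3) z := nform n (tau (face_map z)) p q.

Lemma polyfun_g p : polyfun l.+1 (fun z => bil n (tau (face_map z)) p).
Proof. exact: (polyfun_face_map (polyfun_bil n p ptau)). Qed.

Lemma polyfun_N p q : polyfun l.+1 (N p q).
Proof. by apply: polyfunD; exact: (polyfun_face_map (polyfun_bil _ _ ptau)). Qed.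

Lemma pd_N p q : pd 0 (N p q) = (fun z => nform n (dirm tau d1 (face_map z)) p q) /\
  pd 1 (N p q) = (fun z => nform n (dirm tau d2 (face_map z)) p q).
Proof.
have P u w := polyfun_face_map (polyfun_bil u w ptau).
split; apply/funext => z; rewrite /N /nform (pdD _ _ (P _ _) (P _ _)).
- by have [-> _] := pd_face_map (cross n p) q; have [-> _] := pd_face_map (cross n q) p.
- by have [_ ->] := pd_face_map (cross n p) q; have [_ ->] := pd_face_map (cross n q) p.
Qed.

Lemma face_map_edge0 s : face_map (face_o + e1 + s *: (e0 - e1)) = F0 + d2 + s *: (d1 - d2).
Proof. by apply/rowP => i; rewrite /face_map; move: face_o => c; rewrite !mxE /=; ring. Qed.
Lemma face_map_edge1 s : face_map (face_o + s *: e1) = F0 + s *: d2.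
Proof. by apply/rowP => i; rewrite /face_map; move: face_o => c; rewrite !mxE /=; ring. Qed.
Lemma face_map_edge2 s : face_map (face_o + s *: e0) = F0 + s *: d1.
Proof. by apply/rowP => i; rewrite /face_map; move: face_o => c; rewrite !mxE /=; ring. Qed.

Lemma face_edgeP (P : 'rV[R]_2 -> Prop) (i : 'I_3) :
  (forall s, P [:: face_o + e1 + s *: (e0 - e1); face_o + s *: e1; face_o + s *: e0]`_i) ->
  forall z, tri_lam face_o i z = 0 -> P z.
Proof. by move=> Ps z /tri_edgeP[s ->]. Qed.

(** For tangential [a], [b] the vector a x b is a multiple of [n], so the difference is a multiple
    of n . curl n; and [n] is orthogonal to the edge, where the symmetric part of the curl vanishes
    on such vectors. *)
Lemma bil_curl_normal a b s x d : dot d n = 0 -> edge_vanishing tau x d ->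
  dot a n = 0 -> dot b n = 0 ->
  bil n (dirm tau a (x + s *: d)) b - bil n (dirm tau b (x + s *: d)) a = 0.
Proof.
move=> dn E an bn; rewrite -(bil_curlm_dirm ptau).
have na : dot n a = 0 by rewrite dotC.
have nb : dot n b = 0 by rewrite dotC.
have -> : cross a b = dot n (cross a b) *: n.
  have := cross_cross n n (cross a b); rewrite [cross n (cross a b)]cross_cross na nb !scale0r.
  by rewrite subrr cross0r n1 scale1r => /esym/eqP; rewrite subr_eq0 => /eqP.
have [_ E2 _] := E s; have nd : dot n d = 0 by rewrite dotC.
rewrite bilZr (_ : bil n _ n = 0) ?mulr0 //.
by have := E2 n n nd nd; rewrite bil_symm; move: (bil n _ n) => C; lra.
Qed.

Lemma face_trace1_components z : g0 z = 0 /\ g1 z = 0.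
Proof.
have D0 := face_det_neq0; have [sg [sg2 R0 R1]] := frame_rotation n1 e_dot e_n.
have sg0 : sg != 0 by apply: contra_eq_neq sg2 => ->; rewrite mulr0 eq_sym oner_neq0.
have nd1 : dot n d1 = 0 by rewrite dotC.
have nd2 : dot n d2 = 0 by rewrite dotC.
have nd12 : dot n (d1 - d2) = 0 by rewrite dotC dotBl d1n d2n subrr.
have PG0 : polyfun l.+1 g0 by exact: polyfun_g.
have PG1 : polyfun l.+1 g1 by apply: polyfunN; exact: polyfun_g.
have div z' : pd 0 g0 z' + pd 1 g1 z' =
    bil n (dirm tau d1 (face_map z')) d2 - bil n (dirm tau d2 (face_map z')) d1.
  rewrite (pdN _ _ (polyfun_g d1)).
  by have [-> _] := pd_face_map n d2; have [_ ->] := pd_face_map n d1.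
have nAe A (y : 'rV[R]_2) : bil n A (y 0 0 *: d1 + y 0 1 *: d2) =
   (y 0 0 * a1 + y 0 1 * a2) * bil n A (e 0) + (y 0 0 * b1 + y 0 1 * b2) * bil n A (e 1).
  by rewrite {1}face_d1E {1}face_d2E !bil_lin; bil_ring.
move: z; apply: (rot_moments_eq0 (c := face_o) l3 PG0 PG1).
- apply: (@face_edgeP _ 1) => s /=; rewrite /g0 face_map_edge1.
  by case: (edge2 s) => E _ _; exact: E.
- apply: (@face_edgeP _ 2) => s /=; rewrite /g1 face_map_edge2.
  by case: (edge1 s) => E _ _; rewrite E ?oppr0.
- apply: (@face_edgeP _ 0) => s /=; rewrite /g1 /g0 face_map_edge0.
  case: (edge0 s) => /(_ n nd12) E _ _; rewrite -[RHS]oppr0 -[in RHS]E.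
  by rewrite bilDr bilNr opprD opprK addrC.
- apply: forall_ord3; [apply: (@face_edgeP _ 0) | apply: (@face_edgeP _ 1)
    | apply: (@face_edgeP _ 2)] => s /=; rewrite div ?(face_map_edge0, face_map_edge1, face_map_edge2).
  + by apply: bil_curl_normal => //; rewrite dotBl d1n d2n subrr.
  + exact: bil_curl_normal.
  + exact: bil_curl_normal.
- move=> p pp; have P := is_polyfun_fun pp; have G0 := is_polyfun_fun PG0.
  have G1 := is_polyfun_fun PG1.
  (* The factor 1 / D comes from the gradient in the coordinates of the face, and [sg] from the
     rotation n x e_k. *)
  apply: (tint_face (k := sg / D) (H := fun x => \sum_(k < 2) dot (trace1 n (tau x)) (e k) *
     (grad2 (fun y => p (face_coord y)) (fcoord o e x) + 0 *: perp2 (fcoord o e x)) 0 k)).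
  + by rewrite mulf_neq0 ?invr_eq0.
  + by pf_tac.
  + move=> z; rewrite big_ord2 !dot_trace1 R0 R1 !bil_lin scale0r addr0 !mxE.
    have [-> ->] := pd_face_coord pp; rewrite face_coordK /g0 /g1 {1}face_d1E {1}face_d2E !bil_lin.
    by bil_ring.
  + apply: (moments7 (q := fun y => grad2 (fun y => p (face_coord y)) y + 0 *: perp2 y)).
    exists (fun y => p (face_coord y)), (fun=> 0); split=> //.
      exact: polyfun_face_coord.
    exact: polyfun0.
- move=> r pr; have P := is_polyfun_fun pr; have G0 := is_polyfun_fun PG0.
  have G1 := is_polyfun_fun PG1.
  (* No determinant here: the linear map carries position vector to position vector. *)
  apply: (tint_face (k := sg) (H := fun x => \sum_(k < 2) dot (trace1 n (tau x)) (e k) *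
     (grad2 (fun=> 0) (fcoord o e x)
      + r (face_coord (fcoord o e x)) *: perp2 (fcoord o e x)) 0 k)) => //.
  + by pf_tac.
  + move=> z; rewrite big_ord2 !dot_trace1 R0 R1 !bil_lin face_coordK fcoord_face_map !mxE /=.
    rewrite !pd_cst /g0 /g1 {1}face_d1E {1}face_d2E !bil_lin.
    by bil_ring.
  + apply: (moments7 (q := fun y => grad2 (fun=> 0) y + r (face_coord y) *: perp2 y)).
    exists (fun=> 0), (fun y => r (face_coord y)); split=> //.
      exact: polyfun0.
    exact: polyfun_face_coord.
Qed.

Lemma pd2_face_coord m p : polyfun m p -> let q y := p (face_coord y) in forall y,
  [/\ pd 0 (pd 0 q) y = (b2 * b2 * pd 0 (pd 0 p) (face_coord y)
        - 2 * b1 * b2 * pd 0 (pd 1 p) (face_coord y) + b1 * b1 * pd 1 (pd 1 p) (face_coord y)) / D / D,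
      pd 1 (pd 0 q) y = ((a1 * b2 + a2 * b1) * pd 0 (pd 1 p) (face_coord y)
        - a2 * b2 * pd 0 (pd 0 p) (face_coord y) - a1 * b1 * pd 1 (pd 1 p) (face_coord y)) / D / D
    & pd 1 (pd 1 q) y = (a2 * a2 * pd 0 (pd 0 p) (face_coord y)
        - 2 * a1 * a2 * pd 0 (pd 1 p) (face_coord y) + a1 * a1 * pd 1 (pd 1 p) (face_coord y)) / D / D].
Proof.
move=> pp q y; have [q0 q1] := pd_face_coord pp.
have p0 := polyfun_face_coord (polyfun_pd 0 pp); have p1 := polyfun_face_coord (polyfun_pd 1 pp).
have [p00 p01] := pd_face_coord (polyfun_pd 0 pp).
have [p10 p11] := pd_face_coord (polyfun_pd 1 pp).
have S := pd_schwarz 1 0 pp.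
rewrite /q q0 q1; split.
- rewrite (pdB _ _ (polyfunZ _ p0) (polyfunZ _ p1)) (pdZ _ _ _ p0) (pdZ _ _ _ p1) p00 p10 S.
  by move: (pd _ _ _) (pd _ _ _) (pd _ _ _) => u v w; ring.
- rewrite (pdB _ _ (polyfunZ _ p0) (polyfunZ _ p1)) (pdZ _ _ _ p0) (pdZ _ _ _ p1) p01 p11 S.
  by move: (pd _ _ _) (pd _ _ _) (pd _ _ _) => u v w; ring.
- rewrite (pdB _ _ (polyfunZ _ p1) (polyfunZ _ p0)) (pdZ _ _ _ p0) (pdZ _ _ _ p1) p01 p11 S.
  by move: (pd _ _ _) (pd _ _ _) (pd _ _ _) => u v w; ring.
Qed.

Lemma hperpE m (p : 'rV[R]_2 -> R) y : polyfun m p -> [/\ hperp p y 0 0 = pd 1 (pd 1 p) y,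
  hperp p y 0 1 = - pd 1 (pd 0 p) y, hperp p y 1 0 = - pd 1 (pd 0 p) y
  & hperp p y 1 1 = pd 0 (pd 0 p) y].
Proof.
move=> pp; rewrite !mxE /rotd /=; split=> //.
- by rewrite (pdN _ _ (polyfun_pd 1 pp)) opprK.
- by rewrite (pdN _ _ (polyfun_pd 1 pp)) (pd_schwarz 0 1 pp).
Qed.

Lemma nform_plane A y0 y1 w0 w1 : nform n A (y0 *: d1 + y1 *: d2) (w0 *: d1 + w1 *: d2) =
  y0 * w0 * nform n A d1 d1 + (y0 * w1 + y1 * w0) * nform n A d1 d2 + y1 * w1 * nform n A d2 d2.
Proof. by rewrite /nform !crossDr !crossZr !bil_lin; bil_ring. Qed.

Lemma cross_self (u : 'rV[R]_3) : cross u u = 0.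
Proof. by apply: row3P; rewrite crossE !mxE; mx_ring. Qed.

Lemma face_trace2_components z : [/\ N d1 d1 z = 0, N d1 d2 z = 0 & N d2 d2 z = 0].
Proof.
have D0 := face_det_neq0.
have d1_neq0 : d1 != 0.
  by apply: contra_neq cross_neq0 => ->; rewrite crossC cross0r oppr0.
have d2_neq0 : d2 != 0 by apply: contra_neq cross_neq0 => ->; rewrite cross0r.
have d12_neq0 : d1 - d2 != 0.
  by apply: contra_neq cross_neq0 => /eqP; rewrite subr_eq0 => /eqP ->; exact: cross_self.
have d12n : dot (d1 - d2) n = 0 by rewrite dotBl d1n d2n subrr.
have [pN00 pN01 pN11] := And3 (polyfun_N d1 d1) (polyfun_N d1 d2) (polyfun_N d2 d2).
have [N00 N01 N11] := And3 (is_polyfun_fun pN00) (is_polyfun_fun pN01) (is_polyfun_fun pN11).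
have NE A : [/\ nform n A d1 d1 = a1 * a1 * nform n A (e 0) (e 0)
                 + 2 * a1 * b1 * nform n A (e 0) (e 1) + b1 * b1 * nform n A (e 1) (e 1),
  nform n A d1 d2 = a1 * a2 * nform n A (e 0) (e 0)
                 + (a1 * b2 + b1 * a2) * nform n A (e 0) (e 1) + b1 * b2 * nform n A (e 1) (e 1)
  & nform n A d2 d2 = a2 * a2 * nform n A (e 0) (e 0)
                 + 2 * a2 * b2 * nform n A (e 0) (e 1) + b2 * b2 * nform n A (e 1) (e 1)].
  rewrite face_d1E face_d2E !nform_lin; split=> //.
    by move: (nform _ _ _ _) (nform _ _ _ _) (nform _ _ _ _) => u v w; ring.
  by move: (nform _ _ _ _) (nform _ _ _ _) (nform _ _ _ _) => u v w; ring.
move: z; apply: (sym_moments_eq0 (c := face_o) l3 pN00 pN01 pN11).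
- move=> x; have tau_eq0 : tau (face_map x) = 0 -> [/\ N d1 d1 x = 0, N d1 d2 x = 0 & N d2 d2 x = 0].
    by rewrite /N /nform => ->; rewrite !bil0m addr0.
  rewrite !inE => /or3P[] /eqP E; apply: tau_eq0; rewrite E.
  + by have := face_map_edge1 0; rewrite !scale0r !addr0 => ->.
  + by have := face_map_edge2 1; rewrite !scale1r => ->.
  + by have := face_map_edge1 1; rewrite !scale1r => ->.
- apply: (@face_edgeP _ 1) => s /=.
  have [_ ->] := pd_N d1 d2; have [-> _] := pd_N d2 d2; rewrite /N face_map_edge1 /nform.
  have [-> E] := edge_vanishing_trace2 ptau s n1 d2n d1n d2_neq0 edge2.
  by rewrite addr0 -E; split=> //; bil_ring.
- apply: (@face_edgeP _ 2) => s /=.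
  have [-> _] := pd_N d1 d2; have [_ ->] := pd_N d1 d1; rewrite /N face_map_edge2 /nform.
  have [-> E] := edge_vanishing_trace2 ptau s n1 d1n d2n d1_neq0 edge1.
  by rewrite addr0 -E; split=> //; bil_ring.
- apply: (@face_edgeP _ 0) => s /=.
  have [-> ->] := pd_N d1 d1; have [-> ->] := pd_N d1 d2; have [-> _] := pd_N d2 d2.
  rewrite /N face_map_edge0 /nform.
  have := edge_vanishing_trace2 ptau s n1 d12n d1n d12_neq0 edge0.
  set Y := F0 + d2 + s *: (d1 - d2).
  have -> : dirm tau (d1 - d2) Y = dirm tau d1 Y + (-1) *: dirm tau d2 Y.
    by rewrite -[d1 in LHS]scale1r -[- d2]scaleN1r (dirm_linear ptau) scale1r.
  have -> : cross n (d1 - d2) = cross n d1 - cross n d2.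
    by rewrite crossDr -scaleN1r crossZr scaleN1r.
  rewrite !(bil_addmx, bil_scalemx, bilDl, bilDr, bilNl, bilNr).
  do !(match goal with |- context [bil ?u ?A ?w] =>
    let h := fresh "b" in move: (bil u A w) => h end).
  by move=> [E1 E2]; split; lra.
- move=> p pp; have P := is_polyfun_fun pp.
  pose q y := p (face_coord y).
  have pq : polyfun (l - 1) q by exact: polyfun_face_coord.
  pose sg y := hperp q y + symm (y^T *m (0 : 'rV[R]_2)).
  (* Two derivatives give two factors 1 / D; the half comes from the second trace. *)
  apply: (tint_face (k := 2^-1 / D / D) (H := fun x => \sum_(k < 2) \sum_(k' < 2)
     bil (e k) (trace2 n (tau x)) (e k') * sg (fcoord o e x) k k')).
  + by rewrite !mulf_neq0 ?invr_eq0 ?pnatr_eq0.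
  + by pf_tac.
  + move=> z; have sgE y k k' : sg y k k' = hperp q y k k'.
      by rewrite /sg mulmx0 /symm trmx0 addr0 scaler0 addr0.
    have [h0 h1 h2 h3] := hperpE (fcoord o e (face_map z)) pq.
    have [q00 q01 q11] := pd2_face_coord pp (fcoord o e (face_map z)).
    have {}h0 := etrans h0 q11; have {}h3 := etrans h3 q00.
    have {}h1 := etrans h1 (congr1 -%R q01); have {}h2 := etrans h2 (congr1 -%R q01).
    rewrite face_coordK in h0 h1 h2 h3; rewrite sum_trace2_face ?sgE ?h1 ?h2 // h0 h3.
    rewrite /N; have [-> -> ->] := NE (tau (face_map z)).
    do 3 (move: (nform _ _ _ _) => ?); do 3 (move: (pd _ _ _) => ?); ring.
  + apply: (moments6 (s := sg)); exists q, (fun=> 0); split=> // k.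
    by apply: polyfun_eq (polyfun0 _) => y; rewrite mxE.
- move=> w0 w1 pw0 pw1; have [W0 W1] := (is_polyfun_fun pw0, is_polyfun_fun pw1).
  (* The vector w0 d1 + w1 d2 in the frame [e]; since the position vector is z_0 d1 + z_1 d2, the
     contraction expands into the values of N on [d1], [d2]. *)
  pose w (y : 'rV[R]_2) : 'rV[R]_2 := \row_k (w0 (face_coord y) * (if k == 0 then a1 else b1)
    + w1 (face_coord y) * (if k == 0 then a2 else b2)).
  pose sg y := hperp (fun=> 0) y + symm (y^T *m w y).
  apply: (tint_face (k := 2^-1) (H := fun x => \sum_(k < 2) \sum_(k' < 2)
     bil (e k) (trace2 n (tau x)) (e k') * sg (fcoord o e x) k k')).
  + by rewrite invr_eq0 pnatr_eq0.
  + by pf_tac.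
  + move=> z; set y := fcoord o e (face_map z).
    have sgE k k' : sg y k k' = 2^-1 * (y 0 k * w y 0 k' + y 0 k' * w y 0 k).
      rewrite /sg mxE [X in X + _](_ : _ = 0) ?add0r; last first.
        have [h0 h1 h2 h3] := hperpE y (polyfun_cst 0 (0 : R)).
        have pd0 i : pd i (fun _ : 'rV[R]_2 => 0) = fun=> 0 by apply/funext => ?; exact: pd_cst.
        by move: k k'; do 2 apply: forall_ord2; rewrite ?h0 ?h1 ?h2 ?h3 !pd0 ?oppr0.
      by rewrite /symm !mxE !big_ord1 !mxE.
    rewrite sum_trace2_face ?sgE; last by rewrite addrC.
    rewrite !mxE /= -!/(fcoord o e _) /y face_coordK.
    have yE k := congr1 (fun r : 'rV[R]_2 => r 0 k) (fcoord_face_map z).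
    have := yE 0; have := yE 1; rewrite ![(\row__ _) _ _]mxE /= => -> ->.
    rewrite /N; have [-> -> ->] := NE (tau (face_map z)).
    do 3 (move: (nform _ _ _ _) => ?); by field.
  + apply: (moments6 (s := sg)); exists (fun=> 0), w; split=> // [|k]; first exact: polyfun0.
    apply: polyfun_eq (polyfunD (polyfunZ (if k == 0 then a1 else b1) (polyfun_face_coord pw0))
      (polyfunZ (if k == 0 then a2 else b2) (polyfun_face_coord pw1))) => y.
    by rewrite mxE; congr (_ + _); rewrite mulrC.
Qed.

Lemma face_traces_vanish s t : trace1 n (tau (X s t)) = 0 /\ trace2 n (tau (X s t)) = 0.
Proof.
rewrite face_mapE; set z := face_o + _ + _; have [gz0 gz1] := face_trace1_components z.
have [N00 N01 N11] := face_trace2_components z; move: gz0 gz1 N00 N01 N11.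
rewrite /g0 /g1 /N; set A := tau _ => gz0 /eqP; rewrite oppr_eq0 => /eqP gz1 N00 N01 N11.
have nd1 : dot n d1 = 0 by rewrite dotC.
have nd2 : dot n d2 = 0 by rewrite dotC.
have KE : cross d1 d2 = dot n (cross d1 d2) *: n.
  have := cross_cross n n (cross d1 d2); rewrite [cross n (cross d1 d2)]cross_cross nd1 nd2.
  by rewrite !scale0r subrr cross0r n1 scale1r => /esym/eqP; rewrite subr_eq0 => /eqP.
set K := dot n _ in KE.
have K0 : K != 0 by apply: contra_neq cross_neq0 => E; rewrite KE E scale0r.
(* Here [d1 x d2 = K n], and the double product a x (d1 x d2) lies in the span of [d1] and [d2]. So
   the values on these two vectors decide both traces. *)
have inplane a : cross n a = (- (dot a d2 / K)) *: d1 + (dot a d1 / K) *: d2.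
  apply: (scalerI K0); rewrite scalerDr !scalerA mulrN ![K * (_ / K)]mulrC !divfK //.
  rewrite crossC scalerN -crossZr -KE cross_cross opprB scaleNr addrC.
  by rewrite ![dot a _]dotC.
split.
  apply/rowP => j; rewrite -dot_delta dotC dot_trace1 inplane bilDr !bilZr gz0 gz1 !mulr0 addr0.
  by rewrite mxE.
apply/matrixP => i j; rewrite [RHS]mxE.
rewrite -bil_delta bil_trace2 // [cross n (cross n _)]inplane [X in nform _ _ _ X]inplane nform_plane.
by rewrite N00 N01 N11 !mulr0 !addr0 mulr0.
Qed.

End Face.

(** * Barycentric coordinates and unisolvence *)
Section Tetrahedron.
Context {R : realType}.
Variable v : 'I_4 -> 'rV[R]_3.
Hypothesis v_tetra : tetra v.
Implicit Types (x : 'rV[R]_3) (f i j : 'I_4).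

Let M : 'M[R]_3 := \matrix_(i < 3) (v (lift ord0 i) - v ord0).

Lemma tet_unit : M \in unitmx.
Proof. by rewrite unitmxE unitfE. Qed.

Definition tet_coord x : 'rV[R]_3 := (x - v ord0) *m invmx M.
Definition tet_lam i x : R :=
  if unlift ord0 i is Some k then tet_coord x 0 k else 1 - \sum_k tet_coord x 0 k.

Lemma mul_rows (c : 'rV[R]_3) :
  c *m M = \sum_k c 0 k *: v (lift ord0 k) - (\sum_k c 0 k) *: v ord0.
Proof.
rewrite mulmx_sum_row scaler_suml -sumrB; apply: eq_bigr => k _.
by rewrite rowK scalerBr.
Qed.

Lemma tet_lam_point (mu : 'I_4 -> R) i : \sum_j mu j = 1 ->
  tet_lam i (\sum_j mu j *: v j) = mu i.
Proof.
rewrite big_ord_recl => /eqP; rewrite eq_sym -subr_eq => /eqP mu0.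
have cE : tet_coord (\sum_j mu j *: v j) = \row_k mu (lift ord0 k).
  rewrite /tet_coord; apply: (canLR (mulmxK tet_unit)); rewrite mul_rows big_ord_recl -mu0.
  have -> : \sum_k (\row_k mu (lift ord0 k)) 0 k = \sum_(k < 3) mu (lift ord0 k).
    by apply: eq_bigr => k _; rewrite mxE.
  have -> : \sum_k (\row_k mu (lift ord0 k)) 0 k *: v (lift ord0 k) =
            \sum_(k < 3) mu (lift ord0 k) *: v (lift ord0 k).
    by apply: eq_bigr => k _; rewrite mxE.
  by rewrite scalerBl scale1r addrAC [v ord0 - _ - _]addrAC subrr add0r addrC.
rewrite /tet_lam cE; case: unliftP => [k ->|->]; first by rewrite mxE.
by rewrite -mu0; congr (1 - _); apply: eq_bigr => k _; rewrite mxE.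
Qed.

Lemma tet_lam_sum x : \sum_i tet_lam i x = 1.
Proof.
rewrite big_ord_recl /tet_lam unlift_none; under [X in _ + X]eq_bigr do rewrite liftK.
by rewrite subrK.
Qed.

Lemma tet_lam_repr x : x = \sum_i tet_lam i x *: v i.
Proof.
rewrite big_ord_recl /tet_lam unlift_none; under [X in _ + X]eq_bigr do rewrite liftK.
have : tet_coord x *m M = x - v ord0 by rewrite /tet_coord mulmxKV ?tet_unit.
rewrite mul_rows scalerBl scale1r => E.
by rewrite -addrA [- _ + _]addrC E addrC subrK.
Qed.

Lemma tet_lam_poly i : polyfun 1 (tet_lam i).
Proof.
have pc k : polyfun 1 (fun x => tet_coord x 0 k).
  apply: (@polyfun_eq _ _ _ (fun x => \sum_j invmx M j k * (x 0 j - v ord0 0 j))).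
    by move=> x; rewrite [RHS]mxE; apply: eq_bigr => j _; rewrite !mxE mulrC.
  apply: polyfun_sum => j _; apply/polyfunZ/polyfunB; [exact: polyfun_coord | exact: polyfun_cst].
rewrite /tet_lam; case: unliftP => [k _|_] //.
by apply: polyfunB; [exact: polyfun_cst | apply: polyfun_sum].
Qed.

Lemma tet_lam_barycentric : barycentric tet_lam.
Proof.
split.
- exact: tet_lam_poly.
- exact: tet_lam_sum.
- move=> j; exists (fun i => v i 0 j) => x; rewrite {1}(tet_lam_repr x) summxE.
  by apply: eq_bigr => i _; rewrite mxE mulrC.
- by move=> mu mu1; exists (\sum_j mu j *: v j) => i; exact: tet_lam_point.
Qed.

Lemma fptE f s t : fpt v f s t =
  \sum_j (if unlift f j is Some k then (if k == 0 then 1 - s - t else if k == 1 then s else t) else 0) *: v j.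
Proof.
rewrite (bigD1_ord f) //= unlift_none scale0r add0r.
under eq_bigr do rewrite liftK.
rewrite !big_ord_recl big_ord0 addr0 /fpt /fv.
have -> : lift ord0 ord0 = 1 :> 'I_3 by apply: val_inj.
have -> : lift ord0 (lift ord0 ord0) = 2 :> 'I_3 by apply: val_inj.
by rewrite /=; apply/rowP => i; rewrite !mxE; ring.
Qed.

Lemma tet_lam_fpt f s t i : tet_lam i (fpt v f s t) =
  if unlift f i is Some k then (if k == 0 then 1 - s - t else if k == 1 then s else t) else 0.
Proof.
rewrite fptE tet_lam_point // (bigD1_ord f) //= unlift_none add0r.
by under eq_bigr do rewrite liftK; rewrite big_ord3 /=; ring.
Qed.

Lemma tet_lam_face f x : tet_lam f x = 0 ->
  x = fpt v f (tet_lam (lift f 1) x) (tet_lam (lift f 2) x).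
Proof.
move=> f0; rewrite {1}(tet_lam_repr x) fptE; apply: eq_bigr => i _; congr (_ *: _).
case: unliftP => [k ->|-> //].
have := tet_lam_sum x; rewrite (bigD1_ord f) //= f0 add0r big_ord3.
by move: k; apply: forall_ord3 => //= <-; ring.
Qed.

Lemma tet_vertex_inj : injective v.
Proof.
move=> i j vij; apply/eqP; apply: contraT => ij.
have E k : tet_lam i (v k) = (i == k)%:R.
  have -> : v k = \sum_j (k == j)%:R *: v j.
    rewrite (bigD1 k) //= eqxx scale1r big1 ?addr0 // => h; rewrite eq_sym => /negbTE ->.
    exact: scale0r.
  rewrite tet_lam_point 1?eq_sym // (bigD1 k) //= eqxx big1 ?addr0 // => h.
  by rewrite eq_sym => /negbTE ->.
have := E i; rewrite vij E eqxx (negbTE ij) => /eqP.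
by rewrite eq_sym oner_eq0.
Qed.

(** Parallel edge vectors would give (d1 . d2) d1 = |d1|^2 d2, hence equal points of the face with
    different barycentric coordinates. *)
Lemma tet_face_cross f : cross (fv v f 1 - fv v f 0) (fv v f 2 - fv v f 0) != 0.
Proof.
apply/eqP => C0; set d1 := fv v f 1 - _ in C0; set d2 := fv v f 2 - _ in C0.
have := cross_cross d1 d1 d2; rewrite C0 cross0r => /esym /eqP; rewrite subr_eq0 => /eqP E.
have : fpt v f (dot d1 d2) (- dot d1 d1) = fpt v f 0 0.
  by rewrite /fpt -/d1 -/d2 !scale0r !addr0 E scaleNr addrK.
move=> /(congr1 (tet_lam (lift f 2))); rewrite !tet_lam_fpt liftK /= => /eqP.
rewrite oppr_eq0 dot_eq0 subr_eq0 => /eqP /tet_vertex_inj /lift_inj.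
by [].
Qed.

Lemma kint_sq_eq0 m (tau : 'rV[R]_3 -> 'M[R]_3) : (forall (i j : 'I_3), polyfun m (fun x => tau x i j)) ->
  kint v (fun X => frob (tau X) (tau X)) = 0 -> forall x, tau x = 0.
Proof.
move=> pt; pose A (y : 'rV[R]_3) := v ord0 + y *m M.
pose F x := frob (tau x) (tau x).
have pF : polyfun (m + m) (fun y => F (A y)).
  apply: (@polyfun_comp _ _ _ _ F A) => [i|].
    apply: (@polyfun_eq _ _ _ (fun y => v ord0 0 i + \sum_j M j i * y 0 j)).
      by move=> y; rewrite !mxE; congr (_ + _); apply: eq_bigr => j _; rewrite mulrC.
    apply: polyfunD; first exact: polyfun_cst.
    by apply: polyfun_sum => j _; apply/polyfunZ/polyfun_coord.
  by apply: polyfun_sum => i _; apply: polyfun_sum => j _; apply: polyfunM.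
have F_ge0 x : 0 <= F x.
  by apply: sumr_ge0 => i _; apply: sumr_ge0 => j _; rewrite -expr2 sqr_ge0.
move=> /eqP; rewrite mulf_eq0 normr_eq0 (negbTE v_tetra) /= => /eqP I0.
have FA0 : forall y, F (A y) = 0.
  apply: (tet_rint_ge0_eq0 pF) => [y|]; first exact: F_ge0.
  rewrite -[RHS]I0; apply: eq_rint => s _; apply: eq_rint => t _; apply: eq_rint => u _.
  rewrite -/(F _); congr F; rewrite /A !mulmxDl -!scalemxAl -!rowE !rowK.
  have -> : lift ord0 (0 : 'I_3) = 1 :> 'I_4 by apply: val_inj.
  have -> : lift ord0 (1 : 'I_3) = 2 :> 'I_4 by apply: val_inj.
  have -> : lift ord0 (2 : 'I_3) = 3 :> 'I_4 by apply: val_inj.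
  by rewrite !addrA.
move=> x; have := FA0 (tet_coord x).
rewrite /A /tet_coord mulmxKV ?tet_unit // addrC subrK => /eqP.
rewrite psumr_eq0 => [/allP H|i _]; last by apply: sumr_ge0 => j _; rewrite -expr2 sqr_ge0.
apply/matrixP => i j; have := H i (mem_index_enum i); rewrite /= psumr_eq0 => [/allP H2|k _].
  by have := H2 j (mem_index_enum j); rewrite /= mulf_eq0 orbb mxE => /eqP.
by rewrite -expr2 sqr_ge0.
Qed.

End Tetrahedron.

(** * Unisolvence *)

Lemma unisolvence (R : realType) (l : nat) (v : 'I_4 -> 'rV[R]_3)
  (nF o : 'I_4 -> 'rV[R]_3) (e : 'I_4 -> 'I_2 -> 'rV[R]_3) (n1 : 'I_4 -> 'I_4 -> 'rV[R]_3)
  (tau : 'rV[R]_3 -> 'M[R]_3) :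
  (3 <= l)%N -> tetra v -> (forall f, outward_normal v f (nF f)) ->
  (forall f, face_frame v f (nF f) (o f) (e f)) ->
  (forall i j : 'I_4, (i < j)%N -> dot (n1 i j) (n1 i j) = 1 /\ dot (n1 i j) (etan v i j) = 0) ->
  PT l.+1 tau -> dofs_vanish l v nF o e n1 tau -> forall x, tau x = 0.
Proof.
move=> l3 vt hn he hn1 [pt tr0] [D1 [D2 [D3 [D4 [D5 [D6 [D7 D8]]]]]]].
have edge_lt (i j : 'I_4) : (i < j)%N -> edge_vanishing tau (v i) (v j - v i).
  move=> ij; have [n1u n1t] := hn1 i j ij.
  have d0 : v j - v i != 0.
    by rewrite subr_eq0; apply: contraTneq ij => /(tet_vertex_inj vt) ->; rewrite ltnn.
  have I0 g q : eint v i j g q = 0 -> rint 0 1 (fun s => g (v i + s *: (v j - v i)) * q.[s]) = 0.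
    by move=> /eqP; rewrite mulf_eq0 norm3_eq0 (negbTE d0) /= => /eqP.
  apply: (edge_vanishing_dofs (l := l) (n0 := n1 i j)) => //; first by lia.
  - by rewrite addrC subrK.
  - by rewrite addrC subrK.
  - by move=> a b q sq; have := I0 _ _ (D3 i j ij a b q sq).
  - by move=> a q sq; have := I0 _ _ (D4 i j ij a q sq).
  - by move=> q sq; have := I0 _ _ (D5 i j ij q sq).
(* Both orientations are needed: a face runs through its edges from vertex 0 to 1, from 0 to 2, and
   from 2 to 1. *)
have edge (i j : 'I_4) : i != j -> edge_vanishing tau (v i) (v j - v i).
  rewrite -val_eqE neq_ltn => /orP[/edge_lt //|/edge_lt].
  by move=> /(edge_vanishing_rev pt); rewrite opprB addrC subrK.
have B : Bspace v nF l tau.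
  split=> // f X [s [t [s0 t0 st ->]]].
  have [nn nd1 nd2 _] := hn f; have [ee en _] := he f.
  have C := tet_face_cross vt f.
  have I0 g : fint v f g = 0 ->
      rint 0 1 (fun s => rint 0 (1 - s) (fun t => g (fpt v f s t))) = 0.
    by move=> /eqP; rewrite mulf_eq0 norm3_eq0 (negbTE C) => /eqP.
  have neq (a b : 'I_3) : a != b -> lift f a != lift f b by apply: contra => /eqP /lift_inj ->.
  apply: (face_traces_vanish (l := l) (o := o f) (e := e f) l3 pt) => //.
  - by rewrite dotC.
  - by rewrite dotC.
  - exact: D1.
  - by rewrite addrC subrK; exact: D1.
  - by rewrite addrC subrK; exact: D1.
  - exact/edge/neq.
  - exact/edge/neq.
  - rewrite [_ + (_ - _)]addrC subrK opprB addrA subrK.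
    exact/edge/neq.
  - by move=> sg Vs; have := I0 _ (D6 f sg Vs).
  - by move=> q Vq; have := I0 _ (D7 f q Vq).
exact: (kint_sq_eq0 vt pt (D8 tau B)).
Qed.

(** * Dimensions from Bernstein expansions *)
(** The bases below are naturally indexed by multi-indices, matrix positions and sums of such types;
    enumeration converts them to ordinals once and for all. *)
Lemma has_dim_pred (R : realType) (V : lmodType R) (S : V -> Prop) (I : finType) (P : pred I)
    (b : I -> V) :
  (forall i, P i -> S (b i)) ->
  (forall c : I -> R, \sum_(i | P i) c i *: b i = 0 -> forall i, P i -> c i = 0) ->
  (forall w, S w -> exists c : I -> R, w = \sum_(i | P i) c i *: b i) ->
  has_dim S #|P|.
Proof.
move=> Sb ib sb; exists (fun k => b (enum_val k)); split.
- by move=> k; apply/Sb/(enum_valP k).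
- move=> c c0 k; pose c' i := c (enum_rank_in (enum_valP k) i).
  have c'E j : c' (enum_val j) = c j by rewrite /c' enum_valK_in.
  rewrite -c'E; apply: ib (enum_valP k); rewrite -[RHS]c0.
  transitivity (\sum_(j < #|P|) c' (enum_val j) *: b (enum_val j)).
    exact: (big_enum_val (A := P) (fun i => c' i *: b i)).
  by apply: eq_bigr => j _; rewrite c'E.
- move=> w /sb[c ->]; exists (fun k => c (enum_val k)).
  exact: (big_enum_val (A := P) (fun i => c i *: b i)).
Qed.

Lemma card_hindex n m : #|hindex (n := n) m| = 'C(n + m, n).
Proof.
rewrite -card_ord_partitions.
pose f (a : {ffun 'I_n.+1 -> 'I_m.+1}) := [tuple a i | i < n.+1].
have fbij : bijective f.
  exists (fun t => finfun (tnth t)) => [a|t].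
    by apply/ffunP => i; rewrite ffunE tnth_mktuple.
  by apply: eq_from_tnth => i; rewrite tnth_mktuple ffunE.
rewrite -(on_card_preimset (onW_bij _ fbij)); apply: eq_card => a.
rewrite !inE big_tuple; congr (_ == _); apply: eq_bigr => i _.
by rewrite tnth_mktuple.
Qed.

Lemma card_monomials n m :
  #|[pred a : {ffun 'I_n -> 'I_m.+1} | (\sum_i (a i : nat) <= m)%N]| = 'C(n + m, n).
Proof.
rewrite -card_partial_ord_partitions.
pose f (a : {ffun 'I_n -> 'I_m.+1}) := [tuple a i | i < n].
have fbij : bijective f.
  exists (fun t => finfun (tnth t)) => [a|t].
    by apply/ffunP => i; rewrite ffunE tnth_mktuple.
  by apply: eq_from_tnth => i; rewrite tnth_mktuple ffunE.
rewrite -(on_card_preimset (onW_bij _ fbij)); apply: eq_card => a.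
rewrite !inE big_tuple; congr (_ <= _)%N; apply: eq_bigr => i _.
by rewrite tnth_mktuple.
Qed.

Definition hpos n m := [pred a : {ffun 'I_n.+1 -> 'I_m.+1} | hindex m a & [forall i, a i != 0]].

(** Lowering each of the n + 1 positive exponents by one leaves an arbitrary index of total degree
    [k]. *)
Lemma card_hpos n k : #|hpos n (n + k.+1)| = 'C(n + k, n).
Proof.
rewrite -card_hindex.
pose f (b : {ffun 'I_n.+1 -> 'I_k.+1}) : {ffun 'I_n.+1 -> 'I_(n + k.+1).+1} :=
  [ffun i => inord (b i).+1].
have fE b i : f b i = (b i).+1 :> nat.
  rewrite ffunE inordK //; have := ltn_ord (b i); lia.
have f_inj : injective f.
  move=> b b' bb'; apply/ffunP => i; apply: val_inj; apply: succn_inj.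
  by rewrite -!fE bb'.
rewrite -(card_imset (hindex k) f_inj); apply: eq_card => a; apply/idP/imsetP.
  move=> /andP[/eqP am /forallP apos].
  have a0 i : (0 < a i)%N by rewrite lt0n; exact: apos.
  have as1 : (\sum_i (a i).-1 = k)%N.
    have : (\sum_i ((a i).-1 + 1) = n + k.+1)%N.
      by rewrite -[RHS]am; apply: eq_bigr => i _; rewrite addn1 prednK.
    by rewrite big_split /= sum1_card card_ord; lia.
  have alt i : ((a i).-1 < k.+1)%N by rewrite ltnS -[leqRHS]as1 (bigD1 i) //= leq_addr.
  exists [ffun i => Ordinal (alt i)].
    by apply/eqP; rewrite -[RHS]as1; apply: eq_bigr => i _; rewrite ffunE.
  by apply/ffunP => i; apply: val_inj; rewrite /= fE ffunE /= prednK.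
move=> [b /eqP bk ->]; apply/andP; split.
  apply/eqP; under eq_bigr do rewrite fE -addn1.
  by rewrite big_split /= bk sum1_card card_ord; lia.
by apply/forallP => i; rewrite -val_eqE /= fE.
Qed.

(** A face together with an index interior to it. The parameter [n] is the dimension of the face, so
    the tetrahedron corresponds to [n = 2]. *)
Definition hzero n m := [pred fa : 'I_n.+2 * {ffun 'I_n.+2 -> 'I_m.+1} |
  hindex m fa.2 & [forall i, (fa.2 i == 0) == (i == fa.1)]].

Lemma card_hzero n m : #|hzero n m| = (n.+2 * #|hpos n m|)%N.
Proof.
rewrite -[n.+2 in RHS]card_ord -cardX.
pose g (fb : 'I_n.+2 * {ffun 'I_n.+1 -> 'I_m.+1}) : 'I_n.+2 * {ffun 'I_n.+2 -> 'I_m.+1} :=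
  (fb.1, [ffun i => if unlift fb.1 i is Some k then fb.2 k else 0]).
have g_inj : injective g.
  move=> [f b] [f' b'] [<- /ffunP E]; congr (_, _); apply/ffunP => k.
  by have := E (lift f k); rewrite !ffunE liftK.
rewrite -(card_imset _ g_inj); apply: eq_card => -[f a]; apply/idP/imsetP.
  move=> /andP[/= /eqP am /forallP az].
  have af : a f = 0 by apply/eqP; have /eqP -> := az f; rewrite eqxx.
  exists (f, [ffun k => a (lift f k)]).
    rewrite !inE /=; apply/andP; split.
      rewrite -[X in _ == X]am (bigD1_ord f) //= af add0n.
      by apply/eqP; apply: eq_bigr => k _; rewrite ffunE.
    by apply/forallP => k; rewrite ffunE; have /eqP -> := az (lift f k); rewrite eq_sym neq_lift.
  congr (_, _); apply/ffunP => i; rewrite ffunE /=.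
  by case: unliftP => [k ->|->]; rewrite ?ffunE.
move=> [[f' b]]; rewrite !inE /= => /andP[/eqP bm /forallP bpos] [-> ->]; apply/andP; split => /=.
  rewrite (bigD1_ord f') //= ffunE unlift_none add0n -[X in _ == X]bm.
  by apply/eqP; apply: eq_bigr => k _; rewrite ffunE liftK.
apply/forallP => i; rewrite ffunE; case: unliftP => [k ->|->].
  by rewrite (negbTE (bpos k)) [lift _ _ == _]eq_sym (negbTE (neq_lift f' k)).
by rewrite !eqxx.
Qed.

Definition bmono (R : realType) n m (lam : 'I_n.+1 -> 'rV[R]_n -> R) (a : {ffun 'I_n.+1 -> 'I_m.+1}) x :=
  \prod_i lam i x ^+ a i.

(** Grouping the family by multi-index reduces independence and spanning to statements about the
    matrix coefficient at a single index, because Bernstein coefficients are unique. *)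
Lemma bern_family_dim (R : realType) n p (lam : 'I_n.+1 -> 'rV[R]_n -> R) m
    (S : ('rV[R]_n -> 'M[R]_p) -> Prop) (I : finType) (P : pred I)
    (al : I -> {ffun 'I_n.+1 -> 'I_m.+1}) (mat : I -> 'M[R]_p) :
  barycentric lam -> (forall i, P i -> hindex m (al i)) ->
  (forall i, P i -> S (fun x => bmono lam (al i) x *: mat i)) ->
  (forall (c : I -> R) a, \sum_(i | P i && (al i == a)) c i *: mat i = 0 ->
     forall i, P i -> al i = a -> c i = 0) ->
  (forall t, S t -> exists A, (forall x, t x = \sum_(a | hindex m a) bmono lam a x *: A a) /\
     forall a, hindex m a -> exists c : I -> R, A a = \sum_(i | P i && (al i == a)) c i *: mat i) ->
  has_dim S #|P|.
Proof.
move=> B Pal Sb ib sb.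
have regroup (c : I -> R) x : \sum_(i | P i) c i *: (bmono lam (al i) x *: mat i) =
    \sum_(a | hindex m a) bmono lam a x *: \sum_(i | P i && (al i == a)) c i *: mat i.
  rewrite (partition_big al (hindex m)) => [|i /Pal //]; apply: eq_bigr => a _.
  rewrite scaler_sumr; apply: eq_bigr => i /andP[_ /eqP ->].
  by rewrite !scalerA mulrC.
apply: (has_dim_pred Sb).
- move=> c; rewrite fct_sumE => c0 i Pi; apply: (ib c (al i)) => //.
  apply/matrixP => j k; rewrite [RHS]mxE.
  pose d a := (\sum_(i | P i && (al i == a)) c i *: mat i) j k.
  apply: (bern_eq0 (lam := lam) (c := d) (Z := pred0) B) (Pal i Pi) _ => //.
    by exists ord0.
  move=> x _ _; have /(congr1 (fun h : 'rV[R]_n -> 'M[R]_p => h x j k)) := c0; rewrite /= [RHS]mxE; move=> c0x.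
  rewrite -[RHS]c0x; move: (regroup c x) => /(congr1 (fun h : 'M[R]_p => h j k)) /= ->.
  by rewrite summxE; apply: eq_bigr => a _; rewrite [RHS]mxE mulrC.
- move=> t /sb[A [tE /= AE]].
  have /choice[C CE] : forall a, exists c : I -> R, hindex m a ->
      A a = \sum_(i | P i && (al i == a)) c i *: mat i.
    move=> a; have [am|am] := boolP (hindex m a); last by exists (fun=> 0).
    by have [c cE] := AE a am; exists c.
  exists (fun i => C (al i) i); rewrite fct_sumE; apply/funext => x; rewrite tE.
  rewrite [RHS](regroup (fun i => C (al i) i) x); apply: eq_bigr => a am; congr (_ *: _).
  by rewrite CE //; apply: eq_bigr => i /andP[_ /eqP ->].
Qed.

Section MatrixBernstein.
Context {R : realType} {n m : nat} (lam : 'I_n.+1 -> 'rV[R]_n -> R).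
Hypothesis B : barycentric lam.

Lemma mx_bern_repr p (t : 'rV[R]_n -> 'M[R]_p) : (forall i j, polyfun m (fun x => t x i j)) ->
  exists A, forall x, t x = \sum_(a | hindex m a) bmono lam a x *: A a.
Proof.
move=> pt; have /choice[c cE] : forall q : 'I_p * 'I_p, exists c, forall x,
    t x q.1 q.2 = bern lam (m := m) c x by move=> q; exact: bern_repr.
exists (fun a => \matrix_(i, j) c (i, j) a) => x; apply/matrixP => i j.
rewrite (cE (i, j)) summxE; apply: eq_bigr => a _.
by rewrite !mxE mulrC.
Qed.

(** A linear functional commutes with the expansion, so a linear condition on the values over a face
    passes to each coefficient whose index is supported on that face. *)
Lemma mx_bern_eq0 p (A : {ffun 'I_n.+1 -> 'I_m.+1} -> 'M[R]_p) (L : 'M[R]_p -> R)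
    (Z : pred 'I_n.+1) :
  (forall k X Y, L (k *: X + Y) = k * L X + L Y) -> (exists j, ~~ Z j) ->
  (forall x, (forall i, 0 <= lam i x) -> (forall i, Z i -> lam i x = 0) ->
     L (\sum_(a | hindex m a) bmono lam a x *: A a) = 0) ->
  forall a, hindex m a -> (forall i, Z i -> a i = 0) -> L (A a) = 0.
Proof.
move=> Llin Z1 L0; apply: (bern_eq0 (c := fun a => L (A a)) B Z1) => x x0 /(L0 x x0) <-.
have Lz : L 0 = 0.
  have := Llin 1 0 0; rewrite scaler0 addr0 mul1r => /eqP.
  by rewrite -subr_eq subrr => /eqP <-.
rewrite /bern; elim/big_rec2: _ => [//|a s y _ ->].
by rewrite Llin /bmono mulrC.
Qed.

End MatrixBernstein.

(** * Trace-free matrices and the dimension of the full polynomial space *)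

Section TraceFree.
Context {R : realType}.
Implicit Types (p : 'I_3 * 'I_3) (A : 'M[R]_3).

(** The position (2, 2) absorbs the trace, and [dmat (2, 2)] is zero; the other eight positions
    index a basis of the trace-free matrices. *)
Definition dmat p : 'M[R]_3 := delta_mx p.1 p.2 - (p.1 == p.2)%:R *: delta_mx 2 2.

Lemma dmatE p q : q != (2, 2) -> dmat p q.1 q.2 = (p == q)%:R.
Proof.
case: p q => [p1 p2] [q1 q2] /=; rewrite xpair_eqE => /negbTE q22.
by rewrite !mxE q22 mulr0 subr0 xpair_eqE [p1 == _]eq_sym [p2 == _]eq_sym.
Qed.

Lemma tr_dmat p : \tr (dmat p) = 0.
Proof.
have trd i j : \tr (delta_mx i j : 'M[R]_3) = (i == j)%:R.
  rewrite /mxtrace (bigD1 i) //= mxE eqxx big1 ?addr0 // => k ki.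
  by rewrite mxE (negbTE ki).
by rewrite linearB linearZ /= !trd eqxx mulr1 subrr.
Qed.

Lemma tracefree_eq0 A : \tr A = 0 -> (forall p, p != (2, 2) -> A p.1 p.2 = 0) -> A = 0.
Proof.
move=> trA A0; apply/matrixP => i j; rewrite [RHS]mxE.
have [/eqP|] := eqVneq (i, j) (2, 2); last by move=> /A0.
rewrite xpair_eqE => /andP[/eqP -> /eqP ->]; rewrite -[RHS]trA /mxtrace (bigD1 2) //= big1 ?addr0 //.
by move=> k k2; rewrite (A0 (k, k)) // xpair_eqE andbb.
Qed.

Lemma tracefree_decomp A : \tr A = 0 -> A = \sum_(p | p != (2, 2)) A p.1 p.2 *: dmat p.
Proof.
move=> trA; apply/eqP; rewrite -subr_eq0; apply/eqP/tracefree_eq0.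
  rewrite linearB /= trA (linear_sum (@mxtrace R 3)) big1 ?subr0 // => p _.
  by rewrite linearZ /= tr_dmat mulr0.
move=> q q2; rewrite !mxE summxE (bigD1 q) //= big1 ?addr0 => [|p /andP[_ pq]].
  by rewrite [X in _ - X]mxE dmatE // eqxx mulr1 subrr.
by rewrite mxE dmatE // (negbTE pq) mulr0.
Qed.

End TraceFree.

Lemma PT_dim (R : realType) m (lam : 'I_4 -> 'rV[R]_3 -> R) : barycentric lam ->
  has_dim (PT (R := R) m) ('C(3 + m, 3) * 8).
Proof.
move=> B; pose P := [predX hindex (n := 3) m & predC1 ((2, 2) : 'I_3 * 'I_3)].
have -> : ('C(3 + m, 3) * 8 = #|P|)%N.
  by rewrite cardX card_hindex cardC1 card_prod !card_ord.
have bpoly a : hindex m a -> polyfun m (bmono (m := m) lam a).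
  by move=> /eqP {1}<-; exact: polyfun_bmono.
apply: (bern_family_dim (lam := lam) (al := fst) (mat := fun i => dmat i.2) B).
- by move=> i /andP[].
- move=> i /andP[/bpoly pb _]; split => [j k|x]; last by rewrite linearZ /= tr_dmat mulr0.
  apply: polyfun_eq (polyfunZ (dmat i.2 j k) pb) => x.
  by rewrite [RHS]mxE mulrC.
- move=> c a c0 i /andP[ai i2] ia; have /matrixP/(_ i.2.1 i.2.2) := c0.
  rewrite summxE (bigD1 i) /=; last by rewrite ai i2 ia eqxx.
  rewrite [RHS]mxE mxE dmatE // eqxx mulr1 big1 ?addr0 // => j /andP[/andP[_ /eqP ja] ji].
  rewrite mxE dmatE // (negbTE (_ : j.2 != i.2)) ?mulr0 //.
  by apply: contra ji => /eqP E; rewrite [j]surjective_pairing [i]surjective_pairing ja ia E.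
move=> t [pt trt]; have [A tE] := mx_bern_repr B pt; exists A; split=> // a am.
have trA : \tr (A a) = 0.
  apply: (mx_bern_eq0 (L := fun X => \tr X) (Z := pred0) B _ _ _ am) => //.
  - by move=> k X Y; rewrite linearD linearZ.
  - by exists ord0.
  - by move=> x _ _; rewrite -tE.
exists (fun i => A a i.2.1 i.2.2); rewrite [LHS](tracefree_decomp trA).
rewrite (eq_bigl (fun i => (i.1 == a) && (i.2 != (2, 2)))) => [|i]; last first.
  have [ia|_] := eqVneq i.1 a; last by rewrite andbF.
  rewrite andbT -[P i]/((i.1 \in hindex m) && (i.2 != (2, 2))) ia.
  by rewrite (_ : a \in hindex m).
by rewrite -(pair_big (pred1 a) (fun p => p != (2, 2)) (fun _ p => A a p.1 p.2 *: dmat p)) big_pred1_eq.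
Qed.

(** * Bubbles *)
Section VanishingTraces.
Context {R : realType}.
Implicit Types (u n w z a b : 'rV[R]_3) (A : 'M[R]_3).

Definition dev u n : 'M[R]_3 := u^T *m n + (- (dot u n / 3))%:M.

Lemma devE u n i j : dev u n i j = u 0 i * n 0 j - dot u n / 3 * (i == j)%:R.
Proof. by rewrite !mxE big_ord1 !mxE; case: (i == j); rewrite ?mulr1n ?mulr0n; ring. Qed.

Lemma bilDm u k A A' w : bil u (k *: A + A') w = k * bil u A w + bil u A' w.
Proof. by rewrite /bil mulmxDr mulmxDl -scalemxAr -scalemxAl !mxE. Qed.

Lemma bil_eq0 A : (forall a b, bil a A b = 0) -> A = 0.
Proof. by move=> A0; apply/matrixP => i j; rewrite -bil_delta A0 mxE. Qed.

Lemma dot_eq_row u w : (forall a, dot u a = dot w a) -> u = w.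
Proof. by move=> uw; apply/rowP => j; rewrite -!dot_delta !(dotC _ u) !(dotC _ w). Qed.

Lemma bil_outer u n k w z : bil w (u^T *m n + k%:M) z = dot w u * dot n z + k * dot w z.
Proof.
rewrite bilE !dotE !big_ord3 !mxE !big_ord1 !mxE /= !mulr1n !mulr0n.
by mx_ring.
Qed.

Lemma bil_dev u n w z : bil w (dev u n) z = dot w u * dot n z - dot u n / 3 * dot w z.
Proof. by rewrite bil_outer mulNr. Qed.

Lemma dev0 n : dev 0 n = 0.
Proof.
apply/matrixP => i j; rewrite devE [dot _ _]big1 => [|k _]; by rewrite !mxE !mul0r ?subrr.
Qed.

Lemma dev_sum n (c : 'I_3 -> R) : \sum_k c k *: dev (delta_mx 0 k) n = dev (\row_k c k) n.
Proof.
apply/matrixP => i j; rewrite summxE devE.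
have -> : dot (\row_k c k) n = \sum_k c k * n 0 k by apply: eq_bigr => k _; rewrite mxE.
rewrite !mulr_suml.
rewrite (eq_bigr (fun k => c k * (i == k)%:R * n 0 j - c k * n 0 k / 3 * (i == j)%:R)) => [|k _].
  rewrite sumrB; congr (_ - _).
  rewrite mxE (bigD1 i) //= eqxx mulr1 big1 ?addr0 // => k.
  by rewrite eq_sym => /negbTE ->; rewrite mulr0 mul0r.
by rewrite mxE devE dot_delta mxE eqxx; mx_ring.
Qed.

Lemma tr_outer u n k : \tr (u^T *m n + k%:M) = dot u n + 3 * k.
Proof.
rewrite linearD /= mxtrace_scalar mxtrace_mulC trace_mx11 mxE mulr_natl; congr (_ + _).
by apply: eq_bigr => i _; rewrite mxE mulrC.
Qed.

Lemma tr_dev u n : \tr (dev u n) = 0.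
Proof.
by rewrite tr_outer mulrN mulrC divfK ?addrN // pnatr_eq0.
Qed.

Variable n : 'rV[R]_3.
Hypothesis n1 : dot n n = 1.

Lemma dot_crossn a : dot n (cross n a) = 0.
Proof. by rewrite dotC dot_crossl. Qed.

Lemma trace1_eq0 A : trace1 n A = 0 <-> forall a, dot n a = 0 -> bil n A a = 0.
Proof.
split=> [A0 a na|A0]; last first.
  by apply: dot_eq_row => a; rewrite dot_trace1 A0 ?dot_crossn // dotE !mxE !mul0r !addr0.
have := dot_trace1 n A (- cross n a); rewrite A0 -scaleN1r crossZr cross_cross na n1.
rewrite scale0r sub0r scale1r !scaleN1r opprK => <-.
by rewrite dotE !mxE !mul0r !addr0.
Qed.

Lemma trace2_eq0 A : trace2 n A = 0 <->
  forall a b, dot n a = 0 -> dot n b = 0 -> nform n A a b = 0.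
Proof.
have nn a : dot n a = 0 -> cross n (cross n (- a)) = a.
  by move=> na; rewrite cross_cross -scaleN1r dotZr na n1 mulr0 scale0r sub0r scale1r scaleN1r opprK.
split=> A0 => [a b na nb|]; last first.
  by apply: bil_eq0 => a b; rewrite bil_trace2 // A0 ?mulr0 ?dot_crossn.
have /esym/eqP := bil_trace2 A (- a) (- b) n1.
by rewrite !nn // A0 bil0m mulf_eq0 invr_eq0 pnatr_eq0 /= => /eqP.
Qed.

Lemma dev_traces u : trace1 n (dev u n) = 0 /\ trace2 n (dev u n) = 0.
Proof.
split; first by apply/trace1_eq0 => a na; rewrite bil_dev na !mulr0 subrr.
apply/trace2_eq0 => a b na nb; rewrite /nform !bil_dev na nb !mulr0 !add0r -mulrN -mulrN -mulrDr.
rewrite -opprD [dot (cross n b) a]dotC [dot a _]cross_dot [dot n _]cross_dot.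
by rewrite [cross a n]crossC -[- cross n a]scaleN1r dotZr mulN1r [dot _ b]dotC addrN oppr0 mulr0.
Qed.

Lemma dev_inj (d : 'rV[R]_3) u : d != 0 -> dot n d = 0 -> dev u n = 0 -> u = 0.
Proof.
move=> d0 nd D0; have E w z := bil_dev u n w z; rewrite D0 in E.
have c0 : dot u n / 3 = 0.
  apply/eqP; have /esym/eqP := E d d; rewrite bil0m nd mulr0 sub0r oppr_eq0 mulf_eq0 dot_eq0.
  by rewrite (negbTE d0) orbF.
have := E u n; rewrite bil0m c0 n1 mul0r mulr1 subr0 => /esym/eqP.
by rewrite dot_eq0 => /eqP.
Qed.

(** The second trace makes the tangential block of [A] a multiple [alpha] of the identity, and the
    first kills the row of [n] on tangential vectors. What remains of A - alpha I is u^T n with u =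
    A n - alpha n, and zero trace forces alpha = - (u . n) / 3. *)
Lemma traces_eq0_dev (e : 'I_2 -> 'rV[R]_3) A :
  (forall k l, dot (e k) (e l) = (k == l)%:R) -> (forall k, dot (e k) n = 0) ->
  \tr A = 0 -> trace1 n A = 0 -> trace2 n A = 0 -> exists u, A = dev u n.
Proof.
move=> ee en trA /trace1_eq0 A1 /trace2_eq0 A2; have ne k : dot n (e k) = 0 by rewrite dotC.
have [sg [sg2 c0 c1]] := frame_rotation n1 ee en.
have sg0 : sg != 0 by apply: contra_eq_neq sg2 => ->; rewrite mul0r eq_sym oner_eq0.
have decomp a : a = dot a n *: n + (dot a (e 0) *: e 0 + dot a (e 1) *: e 1).
  have := frame_decomp n1 ee en (a := a - dot a n *: n).
  rewrite dotBl dotZl n1 mulr1 subrr !dotBl !dotZl !ne !mulr0 !subr0 => /(_ erefl) <-.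
  by rewrite addrC subrK.
move: (A2 _ _ (ne 0) (ne 0)) (A2 _ _ (ne 1) (ne 1)) (A2 _ _ (ne 0) (ne 1)).
rewrite /nform c0 c1 !bil_lin -!mulrDr => /eqP + /eqP + /eqP.
rewrite !mulf_eq0 oppr_eq0 (negbTE sg0) -!mulr2n !mulrn_eq0 /= => /eqP A10 /eqP A01.
rewrite mulNr -mulrBr mulf_eq0 (negbTE sg0) subr_eq0 /= => /eqP A11.
pose alpha := bil (e 0) A (e 0); pose u := n *m A^T - alpha *: n.
have AE : A = u^T *m n + alpha%:M.
  apply/eqP; rewrite -subr_eq0; apply/eqP/bil_eq0 => a b.
  have bN : bil a (A - (u^T *m n + alpha%:M)) b = bil a A b - bil a (u^T *m n + alpha%:M) b.
    by rewrite addrC -scaleN1r bilDm mulN1r addrC.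
  rewrite bN bil_outer.
  have -> : dot a u = bil a A n - alpha * dot a n.
    rewrite dotC dotBl dotZl [dot n a]dotC; congr (_ - _).
    rewrite dotE bilE !big_ord3 !mxE !big_ord3 !mxE; mx_ring.
  have -> : dot a b = dot a n * dot b n + (dot a (e 0) * dot b (e 0) + dot a (e 1) * dot b (e 1)).
    by rewrite {1}(decomp b) !dotDr !dotZr; mx_ring.
  rewrite {1}(decomp b) !bil_lin.
  have -> : bil a A (e 0) = alpha * dot a (e 0).
    by rewrite {1}(decomp a) !bil_lin A1 // A10 /alpha; ring.
  have -> : bil a A (e 1) = alpha * dot a (e 1).
    by rewrite {1}(decomp a) !bil_lin A1 // A01 A11 /alpha; ring.
  by rewrite [dot n b]dotC; ring.
exists u; rewrite {1}AE /dev; congr (_ + _%:M).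
have : dot u n + 3 * alpha = 0 by rewrite -tr_outer -AE.
by move=> H; lra.
Qed.

End VanishingTraces.

(** Evaluation on b = n x n', orthogonal to both normals, equates the scalar parts. The rank-one
    parts then agree, and n x b, orthogonal to n but not to n', forces u' = 0. *)
Lemma dev_two_normals (R : realType) (n n' u u' : 'rV[R]_3) : cross n n' != 0 ->
  dev u n = dev u' n' -> dev u n = 0.
Proof.
set b := cross n n' => b0 E.
have Eb w z : dot w u * dot n z - dot u n / 3 * dot w z = dot w u' * dot n' z - dot u' n' / 3 * dot w z.
  by rewrite -!bil_dev E.
have nb : dot n b = 0 by rewrite dotC dot_crossl.
have n'b : dot n' b = 0 by rewrite dotC dot_crossr.
have bb0 : dot b b != 0 by rewrite dot_eq0.
have cc : dot u n / 3 = dot u' n' / 3.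
  by have := Eb b b; rewrite nb n'b !mulr0 !sub0r => /oppr_inj /(mulIf bb0).
have n'z : dot n' (cross n b) = - dot b b.
  by rewrite cross_dot cross_dot [cross n' n]crossC -scaleN1r dotZr mulN1r.
suff u'0 : u' = 0 by rewrite E u'0 dev0.
have := Eb u' (cross n b); rewrite cc => /addIr; rewrite dot_crossn mulr0 n'z => /esym/eqP.
by rewrite mulf_eq0 oppr_eq0 (negbTE bb0) orbF dot_eq0 => /eqP.
Qed.

Section BubbleSpace.
Context {R : realType}.
Variables (l : nat) (v nF : 'I_4 -> 'rV[R]_3) (e : 'I_4 -> 'I_2 -> 'rV[R]_3).
Hypothesis v_tetra : tetra v.
Hypothesis normals : forall f, outward_normal v f (nF f).
Hypothesis e_dot : forall f k l, dot (e f k) (e f l) = (k == l)%:R.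
Hypothesis e_n : forall f k, dot (e f k) (nF f) = 0.

Lemma normal_edge f i j : i != f -> j != f -> dot (nF f) (v i - v j) = 0.
Proof.
have [_ n1 n2 _] := normals f.
have n0 k : dot (nF f) (v (lift f k) - fv v f 0) = 0.
  by move: k; apply: forall_ord3 => //; rewrite subrr dotE !mxE !mulr0 !addr0.
case: (unliftP f i) => [k ->|->]; rewrite ?eqxx //.
case: (unliftP f j) => [k' ->|->]; rewrite ?eqxx // => _ _.
rewrite -[v (lift f k)](subrK (fv v f 0)) -addrA dotDr n0 add0r.
by rewrite -opprB -scaleN1r dotZr n0 mulr0.
Qed.

(** Take a vertex j other than [f] and [g]. The edge from j to [g] lies in face [f]; were the
    normals parallel, it would be orthogonal to the normal of face [g], against the strict sign in
    [outward_normal]. *)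
Lemma normals_independent f g : f != g -> cross (nF f) (nF g) != 0.
Proof.
move=> fg; apply/eqP => C0; have [n1 _ _ _] := normals f.
have := cross_cross (nF f) (nF f) (nF g); rewrite C0 cross0r n1 scale1r => /esym/eqP.
rewrite subr_eq0 => /eqP kE.
have [k fE] : exists k, f = lift g k by case: (unliftP g f) fg => [k ->|->]; [exists k|rewrite eqxx].
pose j := lift g (k + 1); have jg : j != g by rewrite eq_sym neq_lift.
have jf : j != f.
  rewrite fE (inj_eq lift_inj) -subr_eq0 addrC addrA addNr add0r oner_eq0 //.
have [_ n1' n2' neg] := normals g.
have gj : dot (nF g) (v j - fv v g 0) = 0 by rewrite normal_edge // eq_sym neq_lift.
have fgj : dot (nF f) (v g - v j) = 0 by rewrite normal_edge // eq_sym.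
have : dot (nF g) (v g - v j) = 0 by rewrite -kE dotZl fgj mulr0.
move=> gg; move: neg; rewrite -[v g](subrK (v j)) -addrA dotDr gg gj addr0 ltxx //.
Qed.

Local Notation lam := (tet_lam v).
Let B := tet_lam_barycentric v_tetra.

Lemma bmono_face (a : {ffun 'I_4 -> 'I_l.+2}) f X : a f != 0 -> in_face v f X -> bmono lam a X = 0.
Proof.
move=> af [s [t [_ _ _ ->]]]; rewrite /bmono (bigD1 f) //= tet_lam_fpt // unlift_none expr0n.
by rewrite (negbTE (_ : (a f : nat) != 0%N)) ?mul0r.
Qed.

Lemma in_face_lam f X : (forall i, 0 <= lam i X) -> lam f X = 0 -> in_face v f X.
Proof.
move=> X0 Xf; exists (lam (lift f 1) X), (lam (lift f 2) X); split=> //; last exact: tet_lam_face.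
have := bary_sum B X; rewrite (bigD1_ord f) //= Xf big_ord3 => E.
have := X0 (lift f 0); lra.
Qed.

Lemma bubble_coef_traces q A : Bspace v nF l q ->
  (forall x, q x = \sum_(a | hindex l.+1 a) bmono lam a x *: A a) ->
  forall a, hindex l.+1 a -> \tr (A a) = 0 /\
    forall f, a f = 0 -> trace1 (nF f) (A a) = 0 /\ trace2 (nF f) (A a) = 0.
Proof.
move=> [[pq trq] qB] qE a am; split.
  apply: (mx_bern_eq0 (L := fun X => \tr X) (Z := pred0) B _ _ _ am) => //.
  - by move=> k X Y; rewrite linearD linearZ.
  - by exists ord0.
  - by move=> x _ _; rewrite -qE.
move=> f af; have [n1 _ _ _] := normals f.
have Z0 : exists j, ~~ pred1 f j by exists (lift f 0); rewrite /= eq_sym neq_lift.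
have Za i : pred1 f i -> a i = 0 by move=> /eqP ->.
have onf x : (forall i, 0 <= lam i x) -> (forall i, pred1 f i -> lam i x = 0) -> in_face v f x.
  by move=> x0 xf; apply: in_face_lam => //; apply: xf => /=.
split.
  apply/trace1_eq0 => // b nb.
  apply: (mx_bern_eq0 (L := fun X => bil (nF f) X b) (Z := pred1 f) B _ Z0 _ am Za).
    by move=> k X Y; rewrite bilDm.
  move=> x x0 xf; rewrite -qE; have [/trace1_eq0 q1 _] := qB f x (onf x x0 xf).
  by rewrite q1.
apply/trace2_eq0 => // b d nb nd.
apply: (mx_bern_eq0 (L := fun X => nform (nF f) X b d) (Z := pred1 f) B _ Z0 _ am Za).
  by move=> k X Y; rewrite /nform !bilDm; ring.
move=> x x0 xf; rewrite -qE; have [_ /trace2_eq0 q2] := qB f x (onf x x0 xf).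
by rewrite q2.
Qed.

Lemma bubble_coef_dev A f : \tr A = 0 -> trace1 (nF f) A = 0 -> trace2 (nF f) A = 0 ->
  exists u, A = dev u (nF f).
Proof. by move=> trA A1 A2; have [n1 _ _ _] := normals f; exact: (traces_eq0_dev n1 (e_dot f) (e_n f)). Qed.

Lemma bubble_dim : has_dim (Bspace v nF l) (#|hpos 3 l.+1| * 8 + #|hzero 2 l.+1| * 3).
Proof.
(* The left summand pairs an interior index with one of eight trace-free matrices; the right one
   pairs a face and an index interior to it with one of three vectors u. *)
pose Idx := ({ffun 'I_4 -> 'I_l.+2} * ('I_3 * 'I_3) + ('I_4 * {ffun 'I_4 -> 'I_l.+2}) * 'I_3)%type.
pose P (i : Idx) := match i with
  | inl i => (i.1 \in hpos 3 l.+1) && (i.2 != (2, 2))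
  | inr i => i.1 \in hzero 2 l.+1 end.
pose al (i : Idx) := match i with inl i => i.1 | inr i => i.1.2 end.
pose mat (i : Idx) : 'M[R]_3 := match i with
  | inl i => dmat i.2 | inr i => dev (delta_mx 0 i.2) (nF i.1.1) end.
have -> : (#|hpos 3 l.+1| * 8 + #|hzero 2 l.+1| * 3 = #|P|)%N.
  rewrite -[RHS]sum1_card big_sumType /=; congr (_ + _)%N.
    rewrite (eq_bigl (mem [predX hpos 3 l.+1 & predC1 ((2, 2) : 'I_3 * 'I_3)])) => [|i //].
    by rewrite sum1_card cardX cardC1 card_prod !card_ord.
  rewrite (eq_bigl (mem [predX hzero 2 l.+1 & 'I_3])) => [|i]; last by rewrite -[LHS]andbT.
  by rewrite sum1_card cardX card_ord.
(* By [hposP] and [hzeroP] below, at most one of the two sums is nonempty for a given index, and the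
   second then has a single face. *)
have split_sum (F : Idx -> 'M[R]_3) a : \sum_(i | P i && (al i == a)) F i =
    \sum_(p | (a \in hpos 3 l.+1) && (p != (2, 2))) F (inl (a, p)) +
    \sum_(f | (f, a) \in hzero 2 l.+1) \sum_k F (inr ((f, a), k)).
  rewrite big_sumType /=; congr (_ + _).
    rewrite (eq_bigr (fun i => F (inl (i.1, i.2)))) => [|[] //].
    rewrite (eq_bigl (fun i => (i.1 == a) && ((a \in hpos 3 l.+1) && (i.2 != (2, 2))))) => [|[b p]].
      rewrite -(pair_big (pred1 a) (fun p => (a \in hpos 3 l.+1) && (p != (2, 2)))
        (fun b p => F (inl (b, p)))) big_pred1_eq //.
    by rewrite /= andbC; case: eqP => [->|].
  rewrite (eq_bigr (fun i => F (inr (i.1, i.2)))) => [|[] //].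
  rewrite (eq_bigl (fun i => ((i.1 \in hzero 2 l.+1) && (i.1.2 == a)) && true)) => [|i]; last by rewrite andbT.
  rewrite -(pair_big (fun j => (j \in hzero 2 l.+1) && (j.2 == a)) xpredT (fun j k => F (inr (j, k)))) /=.
  rewrite [RHS]big_mkcond (eq_bigr (fun j => \sum_k F (inr ((j.1, j.2), k)))) => [|[] //].
  rewrite (eq_bigl (fun j => true && (((j.1, j.2) \in hzero 2 l.+1) && (j.2 == a)))) => [|[] //].
  rewrite -(pair_big_dep xpredT (fun f b => ((f, b) \in hzero 2 l.+1) && (b == a))
    (fun f b => \sum_k F (inr ((f, b), k)))) /=; apply: eq_bigr => f _.
  rewrite (eq_bigl (fun b => (b == a) && ((f, a) \in hzero 2 l.+1))) => [|b].
    by rewrite big_mkcondr big_pred1_eq.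
  by rewrite andbC; case: eqP => [->|].
have hposP a : a \in hpos 3 l.+1 -> (forall i, a i != 0) /\ forall f, (f, a) \notin hzero 2 l.+1.
  move=> /andP[_ /forallP a0]; split=> // f; apply/negP => /andP[_ /forallP /(_ f)] /=.
  by rewrite eqxx (negbTE (a0 f)).
have hzeroP f a : (f, a) \in hzero 2 l.+1 -> [/\ a \notin hpos 3 l.+1, forall i, (a i == 0) = (i == f)
    & forall g, ((g, a) \in hzero 2 l.+1) = (g == f)].
  move=> /[dup] fa /andP[am /forallP /= az].
  have azE i : (a i == 0) = (i == f) by exact: eqP (az i).
  split=> //; first by apply/negP => /hposP[_ /(_ f)]; rewrite fa.
  move=> g; apply/idP/eqP => [/andP[_ /forallP /(_ g)] /=|-> //].
  by rewrite eqxx azE => /eqP/eqP.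
have Pal i : P i -> hindex l.+1 (al i).
  by case: i => [[a p] /andP[/andP[am _] _] //|[[f a] k] /andP[]].
apply: (bern_family_dim (lam := lam) (al := al) (mat := mat) B Pal).
- move=> i Pi; split; first split.
  + move=> j k; have := polyfun_bmono (fun j => al i j) B; rewrite (eqP (Pal i Pi)) => pb.
    by apply: polyfun_eq (polyfunZ (mat i j k) pb) => x; rewrite [RHS]mxE mulrC.
  + by move=> x; rewrite linearZ /=; case: i {Pi} => i /=; rewrite ?tr_dmat ?tr_dev mulr0.
  (* If the index is positive at [f], the monomial vanishes on that face; otherwise [f] is the face
     whose normal the deviator carries. *)
  + move=> f X Xf; have [n1 _ _ _] := normals f.
    have [af|/bmono_face/(_ Xf) b0] := eqVneq (al i f) 0; last first.
      rewrite b0 scale0r.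
      by have := dev_traces n1 0; rewrite dev0.
    case: i Pi af => [[a p] /andP[/hposP[a0 _] _] /= af|[[g a] k] /hzeroP[_ az _] /= af].
      by move: (a0 f); rewrite af eqxx.
    move: (az f); rewrite af eqxx => /esym/eqP ->.
    have -> : bmono lam a X *: dev (delta_mx 0 k) (nF g) =
        dev (bmono lam a X *: delta_mx 0 k) (nF g).
      by apply/matrixP => r s; rewrite mxE !devE dotZl [(_ *: delta_mx _ _ : 'rV_3) 0 r]mxE; ring.
    have [n1' _ _ _] := normals g; exact: dev_traces.
- move=> c a; rewrite split_sum => c0 [[a' p]|[[f a'] k]] /= Pi ia; subst a'.
    move: Pi => /andP[ap p2]; have [a0 anz] := hposP a ap.
    move: c0; rewrite [X in _ + X]big1 ?addr0 => [|f]; last by rewrite (negbTE (anz f)).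
    rewrite ap /= => /matrixP/(_ p.1 p.2).
    rewrite summxE (bigD1 p) //= [RHS]mxE mxE dmatE // eqxx mulr1 big1 ?addr0 //.
    by move=> q /andP[_ qp]; rewrite mxE dmatE // (negbTE qp) mulr0.
  have [aN az aZ] := hzeroP f a Pi.
  move: c0; rewrite (eq_bigl (pred1 f)) // big_pred1_eq [X in X + _]big_pred0 => [|p]; last by rewrite (negbTE aN).
  rewrite add0r /mat /= dev_sum => D0; have [n1 _ _ _] := normals f.
  have e0 : e f 0 != 0 by rewrite -dot_eq0 e_dot oner_eq0.
  have ne : dot (nF f) (e f 0) = 0 by rewrite dotC.
  by have /rowP/(_ k) := dev_inj n1 e0 ne D0; rewrite !mxE.
move=> q Bq; have [A qE] := mx_bern_repr B (proj1 (proj1 Bq)); exists A; split=> // a am.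
have [trA tA] := bubble_coef_traces Bq qE am.
have [ap|/forallPn[f]] := boolP [forall i, a i != 0].
  have ah : a \in hpos 3 l.+1 by apply/andP.
  have [a0 anz] := hposP a ah.
  exists (fun i => if i is inl i then A a i.2.1 i.2.2 else 0).
  rewrite split_sum [X in _ + X]big1 ?addr0 => [|f]; last by rewrite (negbTE (anz f)).
  by rewrite ah /=; exact: tracefree_decomp.
rewrite negbK => /eqP af.
have [A1 A2] := tA f af; have [u uE] := bubble_coef_dev trA A1 A2.
have aN : a \notin hpos 3 l.+1 by apply/negP => /hposP[/(_ f)]; rewrite af eqxx.
have [/forallP fa|/forallPn[g]] := boolP [forall i, (a i == 0) == (i == f)].
  have fh : (f, a) \in hzero 2 l.+1 by apply/andP; split=> //; apply/forallP.
  have [_ _ aZ] := hzeroP f a fh.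
  exists (fun i => if i is inr i then u 0 i.2 else 0).
  rewrite split_sum (eq_bigl (pred1 f)) // big_pred1_eq [X in X + _]big_pred0 => [|p]; last by rewrite (negbTE aN).
  by rewrite add0r /mat /= dev_sum uE; congr dev; apply/rowP => k; rewrite [RHS]mxE.
(* The index vanishes at two faces, so its coefficient is a deviator for two independent normals,
   hence zero. *)
have [->|gf] := eqVneq g f; first by rewrite af !eqxx.
case: (eqVneq (a g) 0) => // ag _.
have [B1 B2] := tA g ag; have [w wE] := bubble_coef_dev trA B1 B2.
exists (fun=> 0); rewrite uE (dev_two_normals (normals_independent (_ : f != g)) (etrans (esym uE) wE)) 1?eq_sym //.
by rewrite big1 // => i _; rewrite scale0r.
Qed.

End BubbleSpace.

(** * Monomial bases of the face test spaces *)
Definition deg n m (a : {ffun 'I_n -> 'I_m.+1}) := (\sum_i a i)%N.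

Lemma card_deg_le n m k : (k <= m)%N ->
  #|[pred a : {ffun 'I_n -> 'I_m.+1} | (deg a <= k)%N]| = 'C(n + k, n).
Proof.
move=> km; rewrite -card_monomials.
have kSm : (k.+1 <= m.+1)%N by [].
pose w (b : {ffun 'I_n -> 'I_k.+1}) : {ffun 'I_n -> 'I_m.+1} := [ffun i => widen_ord kSm (b i)].
have w_inj : injective w.
  move=> b b' /ffunP bb'; apply/ffunP => i; apply: val_inj.
  by have /(congr1 val) := bb' i; rewrite !ffunE.
rewrite -(card_imset _ w_inj); apply: eq_card => a; apply/idP/imsetP => [|[b bk ->]].
  rewrite inE /deg => ak; have alt i : (a i < k.+1)%N by rewrite ltnS (leq_trans _ ak) // (bigD1 i) //= leq_addr.
  exists [ffun i => Ordinal (alt i)]; last by apply/ffunP => i; apply: val_inj; rewrite !ffunE.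
  by rewrite inE; under eq_bigr do rewrite ffunE.
by rewrite inE /deg; under eq_bigr do rewrite ffunE; exact: bk.
Qed.

Lemma card_deg n m k : (k <= m)%N ->
  #|[pred a : {ffun 'I_n -> 'I_m.+1} | (k < deg a <= m)%N]| = ('C(n + m, n) - 'C(n + k, n))%N.
Proof.
move=> km; rewrite -(card_deg_le n (leqnn m)) -(card_deg_le n km).
rewrite -[X in (X - _)%N](cardID [pred a : {ffun 'I_n -> 'I_m.+1} | (deg a <= k)%N]).
rewrite (_ : #|[predI _ & _]| = #|[pred a : {ffun 'I_n -> 'I_m.+1} | (deg a <= k)%N]|); last first.
  by apply: eq_card => a; rewrite !inE; have [ak|//] := leqP (deg a) k; rewrite ?andbF // (leq_trans ak km).
by rewrite addKn; apply: eq_card => a; rewrite !inE ltnNge.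
Qed.

Lemma linear_bigsum (R : realType) (V W : lmodType R) (L : V -> W) (I : finType) (P : pred I) c (u : I -> V) :
  (forall k x y, L (k *: x + y) = k *: L x + L y) ->
  L (\sum_(i | P i) c i *: u i) = \sum_(i | P i) c i *: L (u i).
Proof.
move=> Llin; have L0 : L 0 = 0.
  have := Llin 1 0 0; rewrite scaler0 addr0 scale1r => /eqP.
  by rewrite -subr_eq subrr => /eqP <-.
by elim/big_rec2: _ => [//|i s y _ <-]; rewrite Llin.
Qed.

Section MonomialCombinations.
Context {R : realType} {n m : nat}.
Implicit Types (P : pred {ffun 'I_n.+1 -> 'I_m.+1}) (c : {ffun 'I_n.+1 -> 'I_m.+1} -> R)
  (a : {ffun 'I_n.+1 -> 'I_m.+1}) (x : 'rV[R]_n.+1).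

Definition mono a x := \prod_i x 0 i ^+ a i.
Definition pcomb P c x := \sum_(a | P a) c a * mono a x.

Lemma mono_poly a : polyfun (deg a) (mono a).
Proof. exact: polyfun_monomial. Qed.

Lemma pcomb_poly P c k : (forall a, P a -> (deg a <= k)%N) -> polyfun k (pcomb P c).
Proof.
by move=> Pk; apply: polyfun_sum => a /Pk ak; apply/polyfunZ/(polyfun_mono ak)/mono_poly.
Qed.

Lemma pcomb_is_poly P c : is_polyfun (pcomb P c).
Proof.
exists (\max_(a : {ffun 'I_n.+1 -> 'I_m.+1}) deg a)%N; apply: pcomb_poly => a _; exact: leq_bigmax.
Qed.

Lemma pcomb_eq0 P c : (forall x, pcomb P c x = 0) -> forall a, P a -> c a = 0.
Proof.
move=> c0 a Pa; have := @monomial_indep R _ m (fun a => if P a then c a else 0).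
move=> /(_ _ a); rewrite Pa; apply => x; rewrite -[RHS](c0 x) /pcomb [RHS]big_mkcond.
by apply: eq_bigr => b _; case: ifP => // _; rewrite mul0r.
Qed.

(** Derivatives are linear only on differentiable functions, so linearity of [L] is asked for
    polynomial arguments only, and polynomiality is carried through the induction. *)
Lemma pcomb_morph P c (V : lmodType R) (L : ('rV[R]_n.+1 -> R) -> V) :
  (forall k f g, is_polyfun f -> is_polyfun g -> L (fun x => k * f x + g x) = k *: L f + L g) ->
  L (pcomb P c) = \sum_(a | P a) c a *: L (mono a).
Proof.
move=> Llin; have pm a : is_polyfun (mono a) by exists (deg a); exact: mono_poly.
have L0 : L (fun=> 0) = 0.
  have := Llin 1 _ _ (is_polyfun_cst 0) (is_polyfun_cst 0); rewrite scale1r mulr0 addr0 => /eqP.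
  by rewrite -subr_eq subrr => /eqP <-.
rewrite /pcomb; suff [_ ->] : is_polyfun (fun x => \sum_(a | P a) c a * mono a x) /\
  L (fun x => \sum_(a | P a) c a * mono a x) = \sum_(a | P a) c a *: L (mono a) by [].
elim: (index_enum _) => [|a r [pr IH]].
  rewrite big_nil -L0 (_ : (fun x => _) = fun=> 0); first by split=> //; exact: is_polyfun_cst.
  by apply/funext => x; rewrite big_nil.
rewrite big_cons; case Pa: (P a); last first.
  by rewrite (_ : (fun x => _) = fun x => \sum_(a <- r | P a) c a * mono a x) //;
    apply/funext => x; rewrite big_cons Pa.
rewrite (_ : (fun x => _) = fun x => c a * mono a x + \sum_(a <- r | P a) c a * mono a x).
  split; last by rewrite Llin // IH.
  by apply: is_polyfunD => //; apply: is_polyfunM => //; exact: is_polyfun_cst.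
by apply/funext => x; rewrite big_cons Pa.
Qed.

Lemma pd_lin i k f g x : is_polyfun f -> is_polyfun g ->
  pd i (fun y => k * f y + g y) x = k * pd i f x + pd i g x.
Proof. by move=> pf pg; pd_tac; ring. Qed.

Lemma euler_mono a x : euler (mono a) x = (deg a)%:R * mono a x.
Proof.
rewrite /mono /deg; suff [_ ->] : is_polyfun (fun x => \prod_i x 0 i ^+ a i) /\
  euler (fun x => \prod_i x 0 i ^+ a i) x = (\sum_i a i)%:R * \prod_i x 0 i ^+ a i by [].
have powE i k : euler (fun x => x 0 i ^+ k) x = k%:R * x 0 i ^+ k.
  elim: k => [|k IH]; first by rewrite mul0r /euler big1 // => j _; rewrite pd_cst mulr0.
  have pk : polyfun (k * 1) (fun x : 'rV[R]_n.+1 => x 0 i ^+ k) by apply/polyfunX/polyfun_coord.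
  rewrite (_ : (fun x => _) = fun x => x 0 i * x 0 i ^+ k).
    by rewrite (euler_coordM _ _ pk) IH exprS; ring.
  by apply/funext => y; rewrite exprS.
elim: (index_enum _) => [|i r [pr IH]].
  rewrite !big_nil mul0r (_ : (fun x => _) = fun=> 1); last by apply/funext => y; rewrite big_nil.
  by split; [exact: is_polyfun_cst|rewrite /euler big1 // => j _; rewrite pd_cst mulr0].
rewrite !big_cons (_ : (fun x => _) = fun x => x 0 i ^+ a i * \prod_(j <- r) x 0 j ^+ a j); last first.
  by apply/funext => y; rewrite big_cons.
have pp : is_polyfun (fun y : 'rV[R]_n.+1 => y 0 i ^+ a i) by pf_tac.
split; first exact: is_polyfunM.
transitivity (euler (fun x => x 0 i ^+ a i) x * \prod_(j <- r) x 0 j ^+ a j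
  + x 0 i ^+ a i * euler (fun x => \prod_(j <- r) x 0 j ^+ a j) x).
  rewrite /euler mulr_suml mulr_sumr -big_split; apply: eq_bigr => j _ /=.
  by rewrite (pderM _ _ pp pr) mulrDr mulrA; congr (_ + _); rewrite mulrCA.
by rewrite powE IH natrD; ring.
Qed.

Lemma euler_pcomb P c x : euler (pcomb P c) x = pcomb P (fun a => c a * (deg a)%:R) x.
Proof.
rewrite (@pcomb_morph P c R^o (fun f => euler f x)) => [|k f g pf pg].
  by apply: eq_bigr => a _; rewrite euler_mono; exact: mulrA.
rewrite /euler scaler_sumr -big_split; apply: eq_bigr => i _ /=.
by rewrite pd_lin // mulrDr; congr (_ + _); rewrite mulrCA.
Qed.

(** A zero gradient gives a zero Euler derivative, which multiplies each coefficient by its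
    degree. *)
Lemma pcomb_grad_eq0 P c : (forall i x, pd i (pcomb P c) x = 0) ->
  forall a, P a -> (0 < deg a)%N -> c a = 0.
Proof.
move=> g0 a Pa da; have : c a * (deg a)%:R = 0.
  apply: (@pcomb_eq0 P (fun a => c a * (deg a)%:R)) => // x.
  by rewrite -euler_pcomb /euler big1 // => i _; rewrite g0 mulr0.
by move=> /eqP; rewrite mulf_eq0 pnatr_eq0 -leqn0 leqNgt da orbF => /eqP.
Qed.

End MonomialCombinations.

(** The operator E^2 - E is the sum of the x_i x_j times second derivatives, and it multiplies a
    monomial of degree d by d (d - 1). *)
Lemma pcomb_hess_eq0 (R : realType) m (P : pred {ffun 'I_2 -> 'I_m.+1}) (c : _ -> R) :
  (forall i j x, pd i (pd j (pcomb P c)) x = 0) ->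
  forall a, P a -> (1 < deg a)%N -> c a = 0.
Proof.
move=> h0 a Pa da; set f := pcomb P c in h0; have pf : is_polyfun f := pcomb_is_poly P c.
have /(pcomb_eq0 (P := P)) /(_ a Pa) : forall x, pcomb P (fun a => c a * (deg a)%:R * ((deg a)%:R - 1)) x = 0.
  move=> x; have E : pcomb P (fun a => c a * (deg a)%:R * ((deg a)%:R - 1)) x =
      pcomb P (fun a => c a * (deg a)%:R * (deg a)%:R) x - pcomb P (fun a => c a * (deg a)%:R) x.
    by rewrite /pcomb -sumrB; apply: eq_bigr => b _; ring.
  rewrite E -euler_pcomb -[pcomb P (fun a => _) x]euler_pcomb.
  have -> : pcomb P (fun a => c a * (deg a)%:R) = euler f by apply/funext => y; rewrite euler_pcomb.
  by rewrite -/f !euler2 (pd_euler 0 _ pf) (pd_euler 1 _ pf) !euler2 !h0 !mulr0 !addr0 subrr.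
move=> /eqP; rewrite !mulf_eq0 pnatr_eq0 -[deg a == 0%N]leqn0 leqNgt (ltnW da) orbF.
rewrite subr_eq0 -[1]/(1%:R) eqr_nat [deg a == _]gtn_eqF // orbF => /eqP //.
Qed.

(** Removes the monomials in the kernel of [L]: constants for the gradient, affine functions for the
    second derivatives. *)
Lemma pcomb_drop (R : realType) n m (P Q : pred {ffun 'I_n.+1 -> 'I_m.+1}) c (V : lmodType R)
    (L : ('rV[R]_n.+1 -> R) -> V) :
  (forall k f g, is_polyfun f -> is_polyfun g -> L (fun x => k * f x + g x) = k *: L f + L g) ->
  (forall a, P a -> ~~ Q a -> L (mono a) = 0) ->
  L (pcomb P c) = L (pcomb (fun a => Q a && P a) c).
Proof.
move=> Llin L0; rewrite !(pcomb_morph _ _ Llin) (bigID Q) /= [X in _ + X]big1 ?addr0.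
  by apply: eq_bigl => a; rewrite andbC.
by move=> a /andP[Pa /(L0 a Pa) ->]; rewrite scaler0.
Qed.

(* Taking row divergences eliminates p and leaves (E + 3) w + y div w = 0, E being the Euler operator. *)
Lemma hperp_position_independent (R : realType) (p w0 w1 : 'rV[R]_2 -> R) :
  is_polyfun p -> is_polyfun w0 -> is_polyfun w1 ->
  (forall y, pd 1 (pd 1 p) y + y 0 0 * w0 y = 0) ->
  (forall y, 2 * pd 1 (pd 0 p) y - (y 0 0 * w1 y + y 0 1 * w0 y) = 0) ->
  (forall y, pd 0 (pd 0 p) y + y 0 1 * w1 y = 0) ->
  (forall y, w0 y = 0) /\ (forall y, w1 y = 0).
Proof.
move=> pp p0 p1 E00 E01 E11; have [[mp mpp] [m0 mp0] [m1 mp1]] := And3 pp p0 p1.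
pose D y := pd 0 w0 y + pd 1 w1 y.
have pD : is_polyfun D by apply: is_polyfunD; exact: is_polyfun_pd.
have F0 : pd 0 (pd 1 (pd 1 p)) = pd 1 (pd 1 (pd 0 p)).
  by rewrite (pd_schwarz 0 1 (polyfun_pd 1 mpp)) (pd_schwarz 0 1 mpp).
have F1 : pd 1 (pd 0 (pd 0 p)) = pd 0 (pd 1 (pd 0 p)) by exact: (pd_schwarz 1 0 (polyfun_pd 0 mpp)).
have A0 y : 3 * w0 y + euler w0 y + y 0 0 * D y = 0.
  have := pd_cst 0 (0 : R) y; rewrite -{1}(funext E00 : _ = fun=> 0).
  have := pd_cst 1 (0 : R) y; rewrite -{1}(funext E01 : _ = fun=> 0).
  pd_tac; rewrite F0 euler2 /D /=.
  move: (pd 1 (pd 1 (pd 0 p)) y) (pd 0 w0 y) (pd 1 w0 y) (pd 1 w1 y) (w0 y) (w1 y) (y 0 0) (y 0 1) => *.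
  lra.
have A1 y : 3 * w1 y + euler w1 y + y 0 1 * D y = 0.
  have := pd_cst 1 (0 : R) y; rewrite -{1}(funext E11 : _ = fun=> 0).
  have := pd_cst 0 (0 : R) y; rewrite -{1}(funext E01 : _ = fun=> 0).
  pd_tac; rewrite F1 euler2 /D /=.
  move: (pd 0 (pd 1 (pd 0 p)) y) (pd 0 w0 y) (pd 0 w1 y) (pd 1 w1 y) (w0 y) (w1 y) (y 0 0) (y 0 1) => *.
  lra.
have q0 := is_polyfun_fun (polyfun_euler mp0); have q1 := is_polyfun_fun (polyfun_euler mp1).
have ED y : euler D y = euler (pd 0 w0) y + euler (pd 1 w1) y.
  exact: (eulerD _ (polyfun_pd 0 mp0) (polyfun_pd 1 mp1)).
have DE y : D y = pd 0 w0 y + pd 1 w1 y by [].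
clearbody D.
(* The divergence of the system in [A0], [A1] is 2 (E + 3) D = 0. *)
have D0 : forall y, D y = 0.
  have [m mD] := pD; apply: (euler_inj (k := 2) mD) => y.
  have := pd_cst 0 (0 : R) y; rewrite -{1}(funext A0 : _ = fun=> 0).
  have := pd_cst 1 (0 : R) y; rewrite -{1}(funext A1 : _ = fun=> 0).
  have := ED y; have := DE y; rewrite [euler D y]euler2.
  pd_tac.
  rewrite (pd_euler 1 y p1) (pd_euler 0 y p0).
  have true1 : true%:R = 1 :> R by [].
  rewrite !eqxx true1.
  move: (pd 0 D y) (pd 1 D y) (pd 0 w0 y) (pd 1 w1 y) (D y) (y 0 0) (y 0 1)
    (euler (pd 0 w0) y) (euler (pd 1 w1) y) => *; lra.
split; [apply: (euler_inj (k := 2) mp0) => y; have := A0 y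
  |apply: (euler_inj (k := 2) mp1) => y; have := A1 y]; rewrite D0 mulr0 addr0 addrC => E; exact: E.
Qed.

Lemma hperp_position_eq0 (R : realType) (p : 'rV[R]_2 -> R) (w : 'I_2 -> 'rV[R]_2 -> R) :
  is_polyfun p -> (forall k, is_polyfun (w k)) ->
  (forall y i j, hperp p y i j + 2^-1 * (y 0 i * w j y + y 0 j * w i y) = 0) ->
  (forall k y, w k y = 0) /\ (forall i j y, pd i (pd j p) y = 0).
Proof.
move=> pp pw E; have [m mp] := pp.
have E00 y : pd 1 (pd 1 p) y + y 0 0 * w 0 y = 0.
  have [h _ _ _] := hperpE y mp; have := E y 0 0; rewrite h.
  by move: (pd _ _ _) (w _ _) (y _ _) => *; lra.
have E01 y : 2 * pd 1 (pd 0 p) y - (y 0 0 * w 1 y + y 0 1 * w 0 y) = 0.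
  have [_ h _ _] := hperpE y mp; have := E y 0 1; rewrite h.
  by move: (pd _ _ _) (w 0 _) (w 1 _) (y 0 0) (y 0 1) => *; lra.
have E11 y : pd 0 (pd 0 p) y + y 0 1 * w 1 y = 0.
  have [_ _ _ h] := hperpE y mp; have := E y 1 1; rewrite h.
  by move: (pd _ _ _) (w _ _) (y _ _) => *; lra.
have [w00 w10] := hperp_position_independent pp (pw 0) (pw 1) E00 E01 E11.
have p10 y : pd 1 (pd 0 p) y = 0.
  have := E01 y; rewrite w00 w10 !mulr0 addr0 subr0 => /eqP.
  by rewrite mulf_eq0 pnatr_eq0 => /eqP.
split; first by apply: forall_ord2.
apply: forall_ord2; apply: forall_ord2 => y.
- by have := E11 y; rewrite w10 mulr0 addr0.
- by rewrite (pd_schwarz 0 1 mp) p10.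
- exact: p10.
- by have := E00 y; rewrite w00 mulr0 addr0.
Qed.

(** * Dimensions of the face test spaces *)

Section PlaneSpaces.
Context {R : realType}.
Variable l : nat.
Hypothesis l3 : (3 <= l)%N.

Let grad2_lin y k (f g : 'rV[R]_2 -> R) : is_polyfun f -> is_polyfun g ->
  grad2 (fun x => k * f x + g x) y = k *: grad2 f y + grad2 g y.
Proof. by move=> pf pg; apply/rowP => i; rewrite !mxE pd_lin. Qed.

Let P7 (i : {ffun 'I_2 -> 'I_(l - 3).+1} + {ffun 'I_2 -> 'I_(l - 1).+1}) :=
  match i with inl a => (0 < deg a <= l - 3)%N | inr a => (deg a <= l - 1)%N end.
Let b7 i : 'rV[R]_2 -> 'rV[R]_2 := match i with
  | inl a => grad2 (mono (m := l - 3) a) | inr a => fun y => mono (m := l - 1) a y *: perp2 y end.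

Let comb7 c : \sum_(i | P7 i) c i *: b7 i =
  fun y => grad2 (pcomb (fun a => P7 (inl a)) (c \o inl)) y
    + pcomb (fun a => P7 (inr a)) (c \o inr) y *: perp2 y.
Proof.
rewrite big_sumType /=; apply/funext => y; rewrite !fct_sumE /=; congr (_ + _).
  by rewrite (@pcomb_morph _ _ _ _ _ _ (fun f => grad2 f y)) // => k f g; exact: grad2_lin.
by rewrite /pcomb scaler_suml; apply: eq_bigr => a _; rewrite -scalerA.
Qed.

(** The subtracted 1 stands for the constants, killed by the gradient; 'C(l - 1, 2) and 'C(l + 1, 2)
    are the dimensions of the plane polynomials of degree at most l - 3 and l - 1. *)
Lemma V7_dim : has_dim (V7 (R := R) l) ('C(l - 1, 2) - 1 + 'C(l + 1, 2)).
Proof.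
have -> : ('C(l - 1, 2) - 1 + 'C(l + 1, 2) = #|P7|)%N.
  rewrite -[RHS]sum1_card big_sumType /=; congr (_ + _)%N.
    rewrite (eq_bigl (mem [pred a : {ffun 'I_2 -> 'I_(l - 3).+1} | (0 < deg a <= l - 3)%N])) //.
    by rewrite sum1_card card_deg //; congr ('C(_, _) - _)%N; lia.
  rewrite (eq_bigl (mem [pred a : {ffun 'I_2 -> 'I_(l - 1).+1} | (deg a <= l - 1)%N])) //.
  by rewrite sum1_card card_deg_le //; congr ('C(_, _))%N; lia.
apply: (has_dim_pred (b := b7)).
- move=> [a|a] /= Pa.
    exists (mono a), (fun=> 0); split; [|exact: polyfun0|by move=> y; rewrite scale0r addr0].
    by move: Pa => /andP[_ Pa]; apply: polyfun_mono Pa (mono_poly a).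
  exists (fun=> 0), (mono a); split; [exact: polyfun0|exact: polyfun_mono Pa (mono_poly a)|].
  move=> y; rewrite (_ : grad2 _ y = 0) ?add0r //.
  by apply/rowP => k; rewrite !mxE pd_cst.
- move=> c; rewrite comb7; set p := pcomb _ _; set r := pcomb _ _ => E.
  have pp : is_polyfun p := pcomb_is_poly _ _; have pr : is_polyfun r := pcomb_is_poly _ _.
  have E0 y : pd 0 p y - r y * y 0 1 = 0.
    by have /(congr1 (fun h : 'rV[R]_2 -> 'rV[R]_2 => h y 0 0)) := E; rewrite !mxE /= mulrN.
  have E1 y : pd 1 p y + r y * y 0 0 = 0.
    by have /(congr1 (fun h : 'rV[R]_2 -> 'rV[R]_2 => h y 0 1)) := E; rewrite !mxE.
  (* Cross-differentiation eliminates [p] and leaves (E + 2) r = 0. *)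
  have r0 y : r y = 0.
    move: y; case: (pr) => m mr; apply: (@euler_inj _ _ m r 1) => // y.
    have := pd_cst 1 (0 : R) y; rewrite -{1}(funext E0 : _ = fun=> 0).
    have := pd_cst 0 (0 : R) y; rewrite -{1}(funext E1 : _ = fun=> 0).
    case: (pp) => k mp; pd_tac; rewrite (pd_schwarz 0 1 mp) euler2 /=.
    by move: (pd 1 (pd 0 p) y) (pd 0 r y) (pd 1 r y) (r y) (y 0 0) (y 0 1) => *; lra.
  have p0 i y : pd i p y = 0.
    move: i; apply: forall_ord2; first by have := E0 y; rewrite r0 mul0r subr0.
    by have := E1 y; rewrite r0 mul0r addr0.
  move=> [a|a] /= Pa.
    by apply: (pcomb_grad_eq0 p0 Pa); case/andP: Pa.
  exact: (pcomb_eq0 r0 Pa).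
move=> q [p [r [[cp pE] [cr rE] qE]]].
exists (fun i => match i with inl a => cp a | inr a => cr a end); rewrite comb7.
apply/funext => y; rewrite qE rE; congr (_ + _).
have -> : p = pcomb (fun a => (deg a <= l - 3)%N) cp by apply/funext => x; rewrite pE.
apply: (@pcomb_drop _ _ _ _ (fun a => 0 < deg a)%N _ _ (fun f => grad2 f y) (grad2_lin y)) => a _; rewrite -leqNgt leqn0 => /eqP a0.
by apply/rowP => k; rewrite !mxE; apply: pd_polyfun0; have := @mono_poly R _ _ a; rewrite a0.
Qed.

Let mx2_linE k (A B : 'M[R]_2) i j : (k *: A + B) i j = k * A i j + B i j.
Proof. by rewrite !mxE. Qed.

Let mx2_addE (A B : 'M[R]_2) i j : (A + B) i j = A i j + B i j.
Proof. by rewrite mxE. Qed.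

Let symm_pos_entry (y w : 'rV[R]_2) i j :
  symm (y^T *m w) i j = 2^-1 * (y 0 i * w 0 j + y 0 j * w 0 i).
Proof. by rewrite !mxE !big_ord1 !mxE. Qed.

Lemma symm_lin k (A B : 'M[R]_2) : symm (k *: A + B) = k *: symm A + symm B.
Proof. by apply/matrixP => i j; rewrite !mxE; ring. Qed.

Let hperp_lin y k (f g : 'rV[R]_2 -> R) : is_polyfun f -> is_polyfun g ->
  hperp (fun x => k * f x + g x) y = k *: hperp f y + hperp g y.
Proof.
move=> pf pg; apply/matrixP => i j.
have entry h : hperp h y i j = rotd i (rotd j h) y by rewrite mxE.
transitivity (rotd i (rotd j (fun x => k * f x + g x)) y); first exact: entry.
transitivity (k * rotd i (rotd j f) y + rotd i (rotd j g) y); last first.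
  by rewrite mx2_linE; congr (k * _ + _); exact/esym/entry.
have rot h u : is_polyfun h -> is_polyfun (rotd u h).
  by rewrite /rotd; case: ifP => _ ph; pf_tac.
have rot_lin u h h' : is_polyfun h -> is_polyfun h' ->
    rotd u (fun x => k * h x + h' x) = fun x => k * rotd u h x + rotd u h' x.
  move=> ph ph'; apply/funext => x; rewrite /rotd; case: ifP => _; rewrite pd_lin //; ring.
by rewrite !rot_lin //; exact: rot.
Qed.

Let P6 (i : {ffun 'I_2 -> 'I_(l - 1).+1} + {ffun 'I_2 -> 'I_(l - 1).+1} * 'I_2) :=
  match i with inl a => (1 < deg a <= l - 1)%N | inr i => (deg i.1 <= l - 1)%N end.
Let b6 i : 'rV[R]_2 -> 'M[R]_2 := match i with
  | inl a => hperp (mono (m := l - 1) a)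
  | inr i => fun y => symm (y^T *m (mono (m := l - 1) i.1 y *: delta_mx 0 i.2)) end.

Let comb6 c : \sum_(i | P6 i) c i *: b6 i =
  fun y => hperp (pcomb (fun a => P6 (inl a)) (c \o inl)) y
    + symm (y^T *m \row_k pcomb (fun a => (deg a <= l - 1)%N) (fun a => c (inr (a, k))) y).
Proof.
rewrite big_sumType /=; apply/funext => y; rewrite !fct_sumE /=; congr (_ + _).
  by rewrite (@pcomb_morph _ _ _ _ _ _ (fun f => hperp f y)) // => k f g; exact: hperp_lin.
rewrite -(linear_bigsum (L := fun w => symm (y^T *m w)) _ (fun i => c (inr i))) => [|k u w]; last first.
  by rewrite mulmxDr -scalemxAr symm_lin.
congr (symm (_ *m _)); apply/rowP => j; rewrite summxE mxE /pcomb.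
rewrite (eq_bigr (fun i => c (inr (i.1, i.2)) * mono i.1 y * (j == i.2)%:R)) => [|[a k] _]; last first.
  by rewrite !mxE eqxx mulrA.
rewrite (eq_bigl (fun i => (deg i.1 <= l - 1)%N && true)) => [|i]; last by rewrite andbT.
rewrite -(pair_big (fun a => (deg a <= l - 1)%N) xpredT (fun a k => c (inr (a, k)) * mono a y * (j == k)%:R)) /=.
apply: eq_bigr => a _; rewrite (bigD1 j) //= eqxx mulr1 big1 ?addr0 // => k.
by rewrite eq_sym => /negbTE ->; rewrite mulr0.
Qed.

(** The subtracted 3 is the dimension of the affine functions, the kernel of the second derivatives;
    the factor 2 counts the components of w. *)
Lemma V6_dim : has_dim (V6 (R := R) l) ('C(l + 1, 2) - 3 + 'C(l + 1, 2) * 2).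
Proof.
have -> : ('C(l + 1, 2) - 3 + 'C(l + 1, 2) * 2 = #|P6|)%N.
  rewrite -[RHS]sum1_card big_sumType /=; congr (_ + _)%N.
    rewrite (eq_bigl (mem [pred a : {ffun 'I_2 -> 'I_(l - 1).+1} | (1 < deg a <= l - 1)%N])) //.
    by rewrite sum1_card card_deg; [congr ('C(_, _) - _)%N|]; lia.
  rewrite (eq_bigl (mem [predX [pred a : {ffun 'I_2 -> 'I_(l - 1).+1} | (deg a <= l - 1)%N] & 'I_2])).
    by rewrite sum1_card cardX card_ord card_deg_le //; congr ('C(_, _) * _)%N; lia.
  by move=> i; rewrite -[LHS]andbT.
apply: (has_dim_pred (b := b6)).
- move=> [a|[a j]] /= Pa.
    exists (mono a), (fun=> 0); split=> [|k|y].
    + by move: Pa => /andP[_ Pa]; apply: polyfun_mono Pa (mono_poly a).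
    + by apply: polyfun_eq (polyfun0 _) => y; rewrite mxE.
    + rewrite mulmx0 (_ : symm 0 = 0) ?addr0 //.
      by apply/matrixP => r s; rewrite !mxE addr0 mulr0.
  exists (fun=> 0), (fun y => mono a y *: delta_mx 0 j); split=> [|k|y]; first exact: polyfun0.
    apply: polyfun_eq (polyfunZ ((delta_mx 0 j : 'rV[R]_2) 0 k) (polyfun_mono Pa (mono_poly a))) => y.
    by rewrite [RHS]mxE mulrC.
  rewrite (_ : hperp _ y = 0) ?add0r //.
  have rot0 u : rotd u (fun _ : 'rV[R]_2 => 0 : R) = fun=> 0.
    by apply/funext => x; rewrite /rotd; case: ifP => _; rewrite pd_cst ?oppr0.
  by apply/matrixP => r s; rewrite !mxE !rot0.
- move=> c; rewrite comb6; set p := pcomb _ _ => E.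
  pose w k := pcomb (fun a => (deg a <= l - 1)%N) (fun a => c (inr (a, k))).
  have pw k : is_polyfun (w k) := pcomb_is_poly _ _; have pp : is_polyfun p := pcomb_is_poly _ _.
  have [|w0 h0] := hperp_position_eq0 pp pw.
    move=> y i j; have /(congr1 (fun h : 'rV[R]_2 -> 'M[R]_2 => h y i j)) := E.
    by rewrite mx2_addE symm_pos_entry [(\row__ _) 0 j]mxE [(\row__ _) 0 i]mxE [RHS]mxE.
  move=> [a|[a k]] /= Pa.
    by apply: (pcomb_hess_eq0 h0 Pa); case/andP: Pa.
  exact: (pcomb_eq0 (w0 k) Pa).
move=> q [p [w [[cp pE] pw qE]]].
have /choice[cw cwE] : forall k, exists c : {ffun 'I_2 -> 'I_(l - 1).+1} -> R,
    forall y, w y 0 k = pcomb (fun a => (deg a <= l - 1)%N) c y.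
  by move=> k; have [c cE] := pw k; exists c => y; rewrite cE.
exists (fun i => match i with inl a => cp a | inr i => cw i.2 i.1 end); rewrite comb6.
apply/funext => y; rewrite qE.
have -> : w y = \row_k pcomb (fun a => (deg a <= l - 1)%N) (cw k) y.
  by apply/rowP => k; rewrite mxE cwE.
apply: (congr2 +%R); last by [].
have -> : p = pcomb (fun a => (deg a <= l - 1)%N) cp by apply/funext => x; rewrite pE.
apply: (@pcomb_drop _ _ _ _ (fun a => 1 < deg a)%N _ _ (fun f => hperp f y) (hperp_lin y)) => a _; rewrite -leqNgt => a1.
have pa := polyfun_mono a1 (mono_poly a : polyfun _ (mono (R := R) a)).
have [h00 h01 h10 h11] := hperpE y pa.
have pd0 i j : pd i (pd j (mono a)) y = 0 by rewrite pd_polyfun0 //; exact: (polyfun_pd j pa).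
apply/matrixP => i j; rewrite [RHS]mxE; move: i j; apply: forall_ord2; apply: forall_ord2.
- by rewrite h00 pd0.
- by rewrite h01 pd0 oppr0.
- by rewrite h10 pd0 oppr0.
- by rewrite h11 pd0.
Qed.

End PlaneSpaces.

(** * Counting the degrees of freedom *)

Lemma bin2E n : ('C(n.+2, 2) * 2 = n.+2 * n.+1)%N.
Proof. by have := bin_ffact n.+2 2; rewrite !ffactnS ffactn0 muln1. Qed.

Lemma bin3E n : ('C(n.+3, 3) * 6 = n.+3 * (n.+2 * n.+1))%N.
Proof. by have := bin_ffact n.+3 3; rewrite !ffactnS ffactn0 muln1. Qed.

(** In [N], each of the 4 vertices carries a trace-free and a symmetric matrix (8 + 6). Each of the
    6 edges carries 3 pairs of normals against degree l - 2, 2 normals against degree l - 1, and one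
    functional against degree l. The 4 faces and the interior give the rest. *)
Lemma dof_count l : (3 <= l)%N ->
  let d6 := ('C(l + 1, 2) - 3 + 'C(l + 1, 2) * 2)%N in let d7 := ('C(l - 1, 2) - 1 + 'C(l + 1, 2))%N in
  let dB := (#|hpos 3 l.+1| * 8 + #|hzero 2 l.+1| * 3)%N in
  let N := (4 * 8 + 4 * 6 + 6 * (3 * (l - 1) + 2 * l + (l + 1)) + 4 * (d6 + d7) + dB)%N in
  (N = 'C(3 + l.+1, 3) * 8)%N /\ (3 * N = 4 * (l + 4) * (l + 3) * (l + 2))%N.
Proof.
(* Writing l = k + 3 resolves the subtractions from l; the bounds [a1] and [c3] do the same for
   those from binomials. With each binomial tied to its falling factorial, the claim is linear in
   the binomials and in the monomials of k. *)
case: l => [|[|[|k]]] // _ /=; rewrite card_hzero.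
have -> : k.+4 = (3 + k.+1)%N by lia.
rewrite card_hpos [X in #|hpos 2 X|](_ : _ = (2 + k.+2)%N) ?card_hpos; last by lia.
have -> : (k.+3 + 1 = k.+4)%N by lia.
have -> : (k.+3 - 1 = k.+2)%N by lia.
have -> : (3 + k = k.+3)%N by lia.
have -> : (2 + k.+1 = k.+3)%N by lia.
have -> : (3 + (3 + k.+1) = (k.+4).+3)%N by lia.
have a1 : (1 <= 'C(k.+2, 2))%N by rewrite bin_gt0.
have c3 : (3 <= 'C(k.+4, 2))%N by rewrite -(leq_pmul2r (isT : (0 < 2)%N)) bin2E; exact: (@leq_mul 3 2).
move: a1 c3; have := (bin2E k, bin2E k.+1, bin2E k.+2, bin3E k, bin3E k.+4) => -[[[[]]]].
move: 'C(k.+2, 2) 'C(k.+3, 2) 'C(k.+4, 2) 'C(k.+3, 3) 'C((k.+4).+3, 3) => a b c d f Ea Eb Ec Ed Ef a1 c3.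
by split; lia.
Qed.

Local Close Scope classical_set_scope.
Unset Implicit Arguments.

Theorem theorem6p4 (R : realType) (l : nat) (v : 'I_4 -> 'rV[R]_3)
  (nF o : 'I_4 -> 'rV[R]_3) (e : 'I_4 -> 'I_2 -> 'rV[R]_3) (n1 : 'I_4 -> 'I_4 -> 'rV[R]_3) :
  (3 <= l)%N ->
  tetra v ->
  (forall f, outward_normal v f (nF f)) ->
  (forall f, face_frame v f (nF f) (o f) (e f)) ->
  (forall i j : 'I_4, (i < j)%N -> dot (n1 i j) (n1 i j) = 1 /\ dot (n1 i j) (etan v i j) = 0) ->
  (* unisolvence: vanishing of all degrees of freedom forces tau = 0 *)
  (forall tau : 'rV[R]_3 -> 'M[R]_3, PT l.+1 tau -> dofs_vanish l v nF o e n1 tau ->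
     forall x, tau x = 0) /\
  (* the number of degrees of freedom equals dim P_{l+1}(K;T) = 4/3 (l+4)(l+3)(l+2) *)
  (exists d6 d7 dB : nat,
     [/\ has_dim (V6 (R := R) l) d6, has_dim (V7 (R := R) l) d7, has_dim (Bspace v nF l) dB,
         has_dim (PT (R := R) l.+1)
           (4 * 8 + 4 * 6 + 6 * (3 * (l - 1) + 2 * l + (l + 1)) + 4 * (d6 + d7) + dB)%N
       & (3 * (4 * 8 + 4 * 6 + 6 * (3 * (l - 1) + 2 * l + (l + 1)) + 4 * (d6 + d7) + dB)
          = 4 * (l + 4) * (l + 3) * (l + 2))%N]).
Proof.
move=> l3 v_tetra normals frames n1_edges; split.
  by move=> tau Ptau; exact: (unisolvence l3 v_tetra normals frames n1_edges Ptau).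
have [N1 N2] := dof_count l3.
exists ('C(l + 1, 2) - 3 + 'C(l + 1, 2) * 2)%N, ('C(l - 1, 2) - 1 + 'C(l + 1, 2))%N.
exists (#|hpos 3 l.+1| * 8 + #|hzero 2 l.+1| * 3)%N; split=> //.
- exact: V6_dim.
- exact: V7_dim.
- have [e_dot e_n] : (forall f k l, dot (e f k) (e f l) = (k == l)%:R) /\ (forall f k, dot (e f k) (nF f) = 0).
    by split=> f; have [] := frames f.
  exact: bubble_dim v_tetra normals e_dot e_n.
- by rewrite N1; exact: (PT_dim l.+1 (tet_lam_barycentric v_tetra)).
Qed.
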